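(* Let $l,d,m\in\mathbb N$ with $l\ge2$, $d\ge 1$, $m>\frac d2$, and let $p\geq 1$ be an integer. There are an integer $q$, depending only on $l,d,m$, and a constant $\kappa>0$, depending only on $l,d,m$, such that the following holds. Let $\omega\in\mathbb R^d$ satisfy $k\cdot\omega\ne0$ for all $k\in\mathbb Z^d\setminus\{0\}$. Let $f,h\in C^{m+p}(\mathbb T^d\times\mathbb R,\mathbb R)$, with $h$ vanishing to order $l+1$ at $x=0$ and all derivatives of $h$ up to order $q$ existing, continuous and bounded for $x$ in a neighborhood of the origin, and let $\widetilde f(\cdot,0)\in H^m(\mathbb T^d,\mathbb R)$. Assume $\overline f(0)\neq0$ and $$\|\widetilde f(\cdot,0)\|_{H^m}\le\kappa\,|\overline f(0)|.$$ Then there exists $\varepsilon_0>0$ such that, with $$\mathcal I=\begin{cases}(-\varepsilon_0,\varepsilon_0) & l \text{ odd},\\ (-\varepsilon_0,0)& l\text{ even and }\overline f(0)>0,\\ (0,\varepsilon_0)& l\text{ even and }\overline f(0)<0,\end{cases}$$ for every $\varepsilon\in\mathcal I$ the equation $$\dot x=x^l+h(\omega t,x)+\varepsilon f(\omega t,x),\qquad x\in\mathbb R,$$ has a solution of the form $x(t)=a+V(\omega t)$ with $a\in\mathbb R$ and $V\in H^m(\mathbb T^d,\mathbb R)$. Moreover, this solution is locally unique.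
   Context: $\mathbb T^d=\mathbb R^d/(2\pi\mathbb Z)^d$. For $V(\theta)=\sum_{k\in\mathbb Z^d}\widehat V_ke^{\mathrm ik\cdot\theta}$, $\|V\|_{H^m}^2=\sum_k|\widehat V_k|^2(|k|^2+1)^m$ with $|k|=|k_1|+\dots+|k_d|$; $H^m(\mathbb T^d,\mathbb R)$ is the usual Sobolev space of real functions with finite norm. For a function $f(\theta,x)$, $\overline f(x)=\int_{\mathbb T^d}f(\theta,x)\,d\theta$ (normalized measure, so this is the average in $\theta$) and $\widetilde f(\theta,x)=f(\theta,x)-\overline f(x)$. ''$h$ vanishes to order $l+1$'' means $\partial_x^jh(\theta,0)=0$ for all $\theta$ and $j=0,1,\dots,l$. ''Locally unique'' means: the number $a$ in the solution is a real root of $a^l+\varepsilon\overline f(0)=0$, and, this $a$ being fixed, there is a constant $A>0$ independent of $\varepsilon$ such that $V$ is the only function in the closed ball of radius $A|\varepsilon|^{1/l}$ around $0$ in $H^m(\mathbb T^d,\mathbb R)$ for which $a+V(\omega t)$ solves the equation. *)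

(* Defs.v *)
From HB Require Import structures.
From mathcomp Require Export all_boot all_order all_algebra complex.
From mathcomp Require Export all_classical all_reals all_analysis.

Set Implicit Arguments.
Unset Strict Implicit.
Unset Printing Implicit Defensive.
Export Order.TTheory GRing.Theory Num.Theory.
Export numFieldNormedType.Exports.

Local Open Scope classical_set_scope.
Local Open Scope ring_scope.

(* A function on the torus R^d / (2 pi Z)^d is a (2 pi Z)^d-periodic function
   on R^d = 'rV[R]_d. *)

Definition zvec (R : realType) (d : nat) (k : 'rV[int]_d) : 'rV[R]_d :=
  map_mx intr k.

Definition torus_periodic (R : realType) (d : nat) (T : Type)
    (g : 'rV[R]_d -> T) : Prop :=
  forall (k : 'rV[int]_d) (theta : 'rV[R]_d),
    g (theta + (2 * pi) *: zvec R k) = g theta.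

Definition dotv (R : realType) (d : nat) (u v : 'rV[R]_d) : R :=
  \sum_(i < d) u 0 i * v 0 i.

Definition normZ1 (d : nat) (k : 'rV[int]_d) : nat :=
  (\sum_(i < d) `|k ord0 i|)%N.

(* The average over the torus, as an iterated Lebesgue integral over [0, 2 pi].
   It is only applied to continuous functions, for which, by Fubini, it is the
   integral against the normalized Haar measure. *)
Fixpoint tmean (R : realType) (d : nat) : ('rV[R]_d -> R) -> R :=
  match d with
  | 0 => fun g => g 0
  | d'.+1 => fun g : 'rV[R]_(1 + d') -> R =>
      (2 * pi)^-1 *
      \int[@lebesgue_measure R]_(s in `[0, 2 * pi])
        tmean (fun theta : 'rV[R]_d' =>
                 g (row_mx (const_mx s : 'rV[R]_1) theta))
  end.

(* The mean of V(theta) e^{- i k . theta}. *)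
Definition fourier_coef (R : realType) (d : nat) (V : 'rV[R]_d -> R)
    (k : 'rV[int]_d) : R[i] :=
  (tmean (fun theta => V theta * cos (dotv (zvec R k) theta))
   -i* tmean (fun theta => V theta * sin (dotv (zvec R k) theta)))%C.

Definition Hm_norm (R : realType) (d m : nat) (V : 'rV[R]_d -> R) : \bar R :=
  sqrte (\esum_(k in [set: 'rV[int]_d])
    (ComplexField.Normc.normc (fourier_coef V k) ^+ 2
       * ((normZ1 k ^ 2 + 1) ^ m)%N%:R)%:E).

(* H^m is used for m > d/2 only, where every class of almost everywhere equal
   functions in it has exactly one continuous member; the class is represented
   by that member, which is what the values V(omega t) refer to. *)
Definition in_Hm (R : realType) (d m : nat) (V : 'rV[R]_d -> R) : Prop :=
  [/\ torus_periodic V, continuous V & (Hm_norm m V < +oo)%E].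

Definition coord_dir (R : realType) (d : nat) (o : option 'I_d) :
    'rV[R]_d * R :=
  if o is Some i then (delta_mx 0 i, 0) else (0, 1).

Definition iter_partial (R : realType) (d : nat) (s : seq (option 'I_d))
    (g : 'rV[R]_d * R -> R) : 'rV[R]_d * R -> R :=
  foldr (fun o g' => 'D_(coord_dir R o) g') g s.

(* For U open. *)
Definition class_C (R : realType) (d n : nat) (U : set ('rV[R]_d * R))
    (g : 'rV[R]_d * R -> R) : Prop :=
  forall (s : seq (option 'I_d)) (z : 'rV[R]_d * R), (size s <= n)%N -> U z ->
    {for z, continuous (iter_partial s g)} /\
    ((size s < n)%N ->
       forall o : option 'I_d, derivable (iter_partial s g) z (coord_dir R o)).

Definition bounded_derivs (R : realType) (d n : nat) (U : set ('rV[R]_d * R))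
    (g : 'rV[R]_d * R -> R) : Prop :=
  exists M : R, forall (s : seq (option 'I_d)) (z : 'rV[R]_d * R),
    (size s <= n)%N -> U z -> `|iter_partial s g z| <= M.

Definition class_C_torus (R : realType) (d n : nat)
    (f : 'rV[R]_d -> R -> R) : Prop :=
  torus_periodic f /\ class_C n setT (fun z => f z.1 z.2).

Definition class_C_bounded_near0 (R : realType) (d q : nat)
    (h : 'rV[R]_d -> R -> R) : Prop :=
  exists delta : R, 0 < delta /\
    let U := [set z : 'rV[R]_d * R | `|z.2| < delta] in
    class_C q U (fun z => h z.1 z.2) /\
    bounded_derivs q U (fun z => h z.1 z.2).

(* "h vanishes to order l + 1 at x = 0": all x-derivatives of order 0, ..., l
   vanish there. *)
Definition vanishes_to_orderS (R : realType) (d l : nat)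
    (h : 'rV[R]_d -> R -> R) : Prop :=
  forall (theta : 'rV[R]_d) (j : nat), (j <= l)%N -> derive1n j (h theta) 0 = 0.

Definition fbar (R : realType) (d : nat) (f : 'rV[R]_d -> R -> R) (x : R) : R :=
  tmean (fun theta => f theta x).

Definition ftilde (R : realType) (d : nat) (f : 'rV[R]_d -> R -> R)
    (theta : 'rV[R]_d) (x : R) : R :=
  f theta x - fbar f x.

Definition nonresonant (R : realType) (d : nat) (omega : 'rV[R]_d) : Prop :=
  forall k : 'rV[int]_d, k != 0 -> dotv (zvec R k) omega != 0.

(* c stands for the mean of f at x = 0 and is nonzero. *)
Definition eps_range (R : realType) (l : nat) (c eps0 : R) : interval R :=
  if odd l then `]- eps0, eps0[
  else if 0 < c then `]- eps0, 0[ else `]0, eps0[.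

Definition solves (R : realType) (d l : nat) (omega : 'rV[R]_d)
    (f h : 'rV[R]_d -> R -> R) (eps : R) (x : R -> R) : Prop :=
  forall t : R,
    is_derive t 1 x
      (x t ^+ l + h (t *: omega) (x t) + eps * f (t *: omega) (x t)).

Definition response (R : realType) (d : nat) (omega : 'rV[R]_d) (a : R)
    (V : 'rV[R]_d -> R) : R -> R :=
  fun t => a + V (t *: omega).

(* Main.v *)
Require Import Defs.
From mathcomp Require Import measurable_realfun ring lra zify.

(** Write c for the mean of f(., 0). At leading order the equation is
    x^l + eps c = 0, so the response should stay close to a root a of that
    balance. The root is chosen with a^(l - 1) > 0, which makes the linear
    rate lam = l a^(l - 1) positive: perturbations of a grow exponentially,
    and exactly one of them stays bounded. With x = a (1 + U(omega t)) the
    equation becomes, along the flow th + t omega,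

      U' = lam U + (lam / l) (bintail l U + G(th, U) - g(th)),

    where bintail collects the terms of (1 + u)^l beyond the first order, g is
    the relative oscillation of f(., 0), of mean zero, and G is what h and the
    x-dependence of f contribute ([solves_rescaled]).

    The bounded solution of U' = lam (U - F) along the flow is the Abel mean of
    F, lam times the integral of e^(- lam s) F(th + s omega) over s > 0
    ([abel_flow]). No small divisors occur: an Abel mean is an average, so it
    does not increase any sup norm, and it commutes with derivatives in th.
    Thus U solves the equation as soon as it is a fixed point of the map
    U |-> - (A (bintail l U + G(., U)) - A g) / l, with A the Abel mean.
    Three facts make this map contract a small ball:
    - bintail l is quadratic, hence has a small Lipschitz constant near 0;
    - G is O(a) together with its derivatives, because h vanishes to order
      l + 1 ([scaled_order_bound], [scaled_increment_bound]);
    - A g and the Abel means of the derivatives of g tend to 0 with lam. This is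
      the ergodic theorem ([abel_ergodic]): trigonometric polynomials are dense,
      and on a nonconstant character the Abel mean is O(lam) because
      k . omega is nonzero.

    The iterates converge in the sup norm while their derivatives of order at
    most m stay bounded by tau ([fixed_point_exists]). Bessel's inequality
    applied to the iterates bounds every finite partial sum of the H^m norm of
    the limit ([Hm_norm_Cb_lim]), so V = a U has H^m norm O(|a|), and |a| is
    proportional to |eps|^(1 / l).

    For uniqueness, the Sobolev embedding, valid since 2 m > d
    ([sobolev_sup]), turns the H^m ball into a sup norm ball in which the
    nonlinear terms have Lipschitz constant at most l / 2. The difference of
    two solutions along the orbit of 0 then satisfies y' = lam y + r with
    |r| <= (lam / 2) |y|; being bounded, it vanishes
    ([bounded_exp_growth_eq0]). A continuous function that vanishes on a
    nonresonant orbit is zero ([orbit_determines]), so the two profiles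
    agree on the whole torus. *)

Set Implicit Arguments.
Unset Strict Implicit.
Unset Printing Implicit Defensive.

Local Open Scope classical_set_scope.
Local Open Scope ring_scope.

(** * Differential equations and integrals on the line *)

Section real_line.
Context {R : realType}.
Implicit Types f F : R -> R.
Local Notation mu := (@lebesgue_measure R).

(** The form without division: the increment h = 0 is no exception, and
    estimates uniform in a parameter can be read off from it. *)
Lemma is_derive_epsP f (t l : R) :
  is_derive t (1:R) f l <->
  (forall e : R, 0 < e -> exists2 d : R, 0 < d &
     forall h : R, `|h| < d -> `|f (t + h) - f t - h * l| <= e * `|h|).
Proof.
split.
- move=> [df dl] e e0.
  have : h^-1 *: (f (h *: 1 + t) - f t) @[h --> 0^'] --> l.
    by rewrite -dl; exact: df.
  move=> /cvgrPdist_le /(_ _ e0) [d /= d0 H]; exists d => // h hd.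
  have [->|h0] := eqVneq h 0.
    by rewrite addr0 subrr mul0r subrr normr0 mulr0.
  have := H h; rewrite /= sub0r normrN => /(_ hd h0).
  rewrite distrC [h *: 1]mulr1 [h + t]addrC => HH.
  have -> : f (t + h) - f t - h * l = h * (h^-1 *: (f (t + h) - f t) - l).
    by rewrite mulrBr /GRing.scale /= mulrA divff // mul1r.
  by rewrite normrM mulrC ler_wpM2r.
- move=> H.
  have K : h^-1 *: (f (h *: 1 + t) - f t) @[h --> 0^'] --> l.
    apply/cvgrPdist_le => e e0; have [d d0 Hd] := H _ e0.
    exists d => //= h /=; rewrite sub0r normrN => hd h0.
    have := Hd h hd; rewrite [h *: 1]mulr1 [h + t]addrC distrC => HH.
    rewrite distrC; have -> : h^-1 *: (f (t + h) - f t) - l = h^-1 * (f (t + h) - f t - h * l).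
      by rewrite mulrBr mulrA mulVf // mul1r.
    rewrite normrM normfV mulrC ler_pdivrMr ?normr_gt0//.
    by rewrite distrC.
  by split; [apply/cvg_ex; exists l | apply/cvg_lim].
Qed.

Lemma is_derive_continuous f (t l : R) : is_derive t (1:R) f l -> {for t, continuous f}.
Proof. by move=> [/derivable1_diffP/differentiable_continuous]. Qed.

Lemma is_derive_ge0_le f (df : R -> R) (a b : R) : a <= b ->
  (forall t : R, is_derive t (1:R) f (df t)) -> (forall t, 0 <= df t) -> f a <= f b.
Proof.
move=> ab H H0.
have [c _ E] := @MVT_segment _ f df a b ab (fun x _ => H x)
  (continuous_subspaceT (fun x => is_derive_continuous (H x))).
by rewrite -subr_ge0 E mulr_ge0 // subr_ge0.
Qed.

(** The perturbation r costs at most half of the rate lam, so y^2 e^(- lam t)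
    is nondecreasing: if y does not vanish at some time, then y^2 grows at least
    like e^(lam t) from then on. *)
Lemma bounded_exp_growth_eq0 (y r : R -> R) (lam B : R) : 0 < lam ->
  (forall t, `|y t| <= B) ->
  (forall t : R, is_derive t (1:R) y (lam * y t + r t)) ->
  (forall t, `|r t| <= lam / 2 * `|y t|) ->
  forall t, y t = 0.
Proof.
move=> lam0 yB dy rB t0.
pose z (t : R) := y t ^+ 2 * expR (- lam * t).
pose dz (t : R) := (lam * y t ^+ 2 + 2 * y t * r t) * expR (- lam * t).
have dzP (t : R) : is_derive t (1:R) z (dz t).
  have d1 : is_derive t (1:R) (fun t => expR (- lam * t)) (- lam * expR (- lam * t)).
    have : is_derive t (1:R) (fun t : R => - lam * t) (- lam).
      have h := @is_deriveZ _ _ _ (@id R) (- lam) t 1 1 (@is_derive_id _ _ _ _).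
      by apply: is_derive_eq; rewrite /GRing.scale/= mulr1.
    move=> h; apply: is_derive_eq; rewrite /GRing.scale /=; ring.
  have d2 := @is_deriveM _ _ _ _ _ _ _ _ (is_deriveX 2 (dy t)) d1.
  apply: (@is_derive_eq _ _ _ _ _ _ _ _ d2).
  rewrite -[(y ^+ 2) t]/(y t ^+ 2) /dz /GRing.scale /= expr1; ring.
have dz0 (t : R) : 0 <= dz t.
  apply: mulr_ge0; last exact: expR_ge0.
  have h1 : `|2 * y t * r t| <= lam * y t ^+ 2.
    rewrite -[X in _ <= _ * X]real_normK ?num_real// !normrM ger0_norm//.
    have -> : lam * `|y t| ^+ 2 = 2 * `|y t| * (lam / 2 * `|y t|) by field.
    by apply: ler_wpM2l => //; rewrite mulr_ge0.
  by move: h1; rewrite ler_norml => /andP[h _]; lra.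
apply/eqP; rewrite -sqrf_eq0; apply/eqP.
have B0 : 0 <= B ^+ 2 by exact: sqr_ge0.
have key (t : R) : 0 <= t -> y t0 ^+ 2 * (1 + lam * t) <= B ^+ 2.
  move=> tge0.
  have := @is_derive_ge0_le z dz t0 (t0 + t) _ dzP dz0.
  rewrite lerDl => /(_ tge0); rewrite /z mulrDr expRD [X in _ <= X -> _]mulrA [X in _ <= X -> _]mulrAC.
  rewrite ler_pM2r ?expR_gt0// mulNr expRN => h.
  have {}h : y t0 ^+ 2 * expR (lam * t) <= y (t0 + t) ^+ 2.
    by rewrite -ler_pdivlMr ?expR_gt0.
  apply: le_trans (le_trans h _).
    by apply: ler_wpM2l; [exact: sqr_ge0 | exact: expR_ge1Dx].
  by rewrite -[X in X <= _]real_normK ?num_real// lerXn2r ?nnegrE// (le_trans _ (yB 0)).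
apply/eqP; rewrite eq_le sqr_ge0 andbT leNgt; apply/negP => y0.
(* At this time the lower bound y^2 (1 + lam t) for the exponential growth
   is y^2 + B^2. *)
have := key (B ^+ 2 / (y t0 ^+ 2 * lam)).
have -> : 0 <= B ^+ 2 / (y t0 ^+ 2 * lam).
  by apply: divr_ge0 => //; apply: mulr_ge0; apply: ltW.
move=> /(_ isT).
rewrite mulrDr mulr1.
have -> : y t0 ^+ 2 * (lam * (B ^+ 2 / (y t0 ^+ 2 * lam))) = B ^+ 2.
  have yn0 : y t0 != 0 by rewrite -sqrf_eq0 gt_eqF.
  have ln0 : lam != 0 by rewrite gt_eqF.
  by field; rewrite yn0 ln0.
lra.
Qed.

Definition bounded_measurable F :=
  measurable_fun setT F /\ exists M : R, forall x : R, `|F x| <= M.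

Lemma bounded_measurable_integrable F (a b : R) :
  bounded_measurable F -> mu.-integrable `[a, b] (EFin \o F).
Proof.
move=> [mF [M FM]]; apply: measurable_bounded_integrable => //.
- exact/compact_finite_measure/segment_compact.
- exact: measurable_funS mF.
- exists M; split; rewrite ?num_real // => x Mx y _.
  by apply: le_trans (FM y) (ltW Mx).
Qed.

Lemma bounded_measurable_cst (c : R) : bounded_measurable (fun=> c).
Proof. by split; [exact: measurable_cst | exists `|c|]. Qed.

Lemma continuous_bounded_measurable F (M : R) : continuous F ->
  (forall x, `|F x| <= M) -> bounded_measurable F.
Proof.
by move=> cF FM; split; [exact: continuous_measurable_fun | exists M].
Qed.

Lemma integral_FTC1 F (x : R) : bounded_measurable F -> 0 < x ->
  {for x, continuous F} ->
  is_derive x (1:R) (fun y : R => \int[mu]_(s in `[0, y]) F s) (F x).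
Proof.
move=> bF x0 cF.
have [|dF eF] := @continuous_FTC1_closed R F 0 x (x + 1) _ (bounded_measurable_integrable _ _ bF) x0 cF.
- by rewrite ltrDl.
- by split; [exact: dF | rewrite -eF derive1E].
Qed.

(** With P a primitive of F, the function u |-> P (u + L) - P u has
    derivative F (u + L) - F u = 0. The base point T of P lies to the left of
    both 0 and r. *)
Lemma integral_shift_periodic F (L r : R) : 0 < L -> continuous F ->
  bounded_measurable F -> (forall s, F (s + L) = F s) ->
  \int[mu]_(s in `[0, L]) F (s + r) = \int[mu]_(s in `[0, L]) F s.
Proof.
move=> L0 cF bF pF.
pose T : R := - (`|r| + 1).
pose P (x : R) := \int[mu]_(s in `[T, x]) F s.
have dP (x : R) : T < x -> is_derive x (1:R) P (F x).
  move=> x0; have [|dF eF] := @continuous_FTC1_closed R F T x (x + 1) _ (bounded_measurable_integrable _ _ bF) x0 (cF x).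
  - by rewrite ltrDl.
  - by split; [exact: dF | rewrite -eF derive1E].
have shiftE (G : R -> R) (u x l : R) : is_derive (x + u) (1:R) G l -> is_derive x (1:R) (fun s => G (s + u)) l.
  move=> /is_derive_epsP H; apply/is_derive_epsP => e e0.
  have [d d0 Hd] := H e e0; exists d => // h hd.
  by have := Hd h hd; rewrite [x + u + h]addrAC.
have main (u : R) : T < u -> \int[mu]_(s in `[0, L]) F (s + u) = P (L + u) - P u.
  move=> Tu.
  have dPu (x : R) : 0 <= x -> is_derive x (1:R) (fun s => P (s + u)) (F (x + u)).
    by move=> x0; apply: shiftE; apply: dP; apply: (lt_le_trans Tu); rewrite lerDr.
  have := @continuous_FTC2 R (fun s => F (s + u)) (fun s => P (s + u)) 0 L L0.
  rewrite /Rintegral => ->.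
  - by rewrite add0r.
  - apply: continuous_subspaceT => x.
    apply: (@continuous_comp _ _ _ (fun s => s + u) F); last exact: cF.
    by apply: continuousD; [exact: id | exact: cst_continuous].
  - split.
    + by move=> x; rewrite in_itv/= => /andP[x0 _]; have [] := dPu x (ltW x0).
    + apply: cvg_at_right_filter.
      exact: (is_derive_continuous (dPu 0 (lexx _))).
    + apply: cvg_at_left_filter.
      exact: (is_derive_continuous (dPu L (ltW L0))).
  - move=> x; rewrite in_itv/= => /andP[x0 _]; rewrite derive1E.
    by have [_] := dPu x (ltW x0).
have Tr : T < r.
  by rewrite /T ltrNl; apply: le_lt_trans (ler_norm _) _; rewrite normrN ltrDl.
have T0 : T < 0 by rewrite /T oppr_lt0 ltr_wpDl.
rewrite main //.
have -> : \int[mu]_(s in `[0, L]) F s = \int[mu]_(s in `[0, L]) F (s + 0).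
  by apply: eq_Rintegral => s _; rewrite addr0.
rewrite main //.
pose D (u : R) := P (u + L) - P u.
have dD (x : R) : T < x -> is_derive x (1:R) D 0.
  move=> Tx.
  have h1 : is_derive x (1:R) (fun s => P (s + L)) (F (x + L)).
    by apply: shiftE; apply: dP; rewrite (lt_trans Tx)// ltrDl.
  have h2 := @is_deriveB _ _ _ _ _ _ _ _ _ h1 (dP x Tx).
  by apply: (@is_derive_eq _ _ _ _ _ _ _ _ h2); rewrite pF subrr.
have Dcst (a b : R) : T < a -> a <= b -> D a = D b.
  move=> Ta ab; have [||c _ E] := @MVT_segment _ D (fun=> 0) a b ab.
  - move=> x; rewrite in_itv/= => /andP[ax _]; exact/dD/(lt_trans Ta).
  - apply: derivable_within_continuous => x; rewrite in_itv/= => /andP[ax _].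
    by have [] := dD x (lt_le_trans Ta ax).
  by apply/esym/eqP; rewrite -subr_eq0 E mul0r.
rewrite ![L + _]addrC -/(D r) -/(D 0).
by have [/Dcst->|/ltW/Dcst->] := leP 0 r.
Qed.

End real_line.

(** * Continuous functions on the torus *)

Section compactness.
Context {R : realType} {d : nat}.
Implicit Types (F : 'rV[R]_d * R -> R) (th : 'rV[R]_d).

Definition periodic_in_theta F := forall (k : 'rV[int]_d) th (x : R),
  F (th + (2 * pi) *: zvec R k, x) = F (th, x).

Lemma twopi_gt0 : 0 < 2 * pi :> R.
Proof. by rewrite mulr_gt0 // pi_gt0. Qed.

Definition slab (rho : R) : set ('rV[R]_d * R) :=
  [set th : 'rV[R]_d | forall i, `[0, 2 * pi]%classic (th ord0 i)] `*` `[- rho, rho].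

Lemma slab_compact rho : compact (slab rho).
Proof.
apply: compact_setX; last exact: segment_compact.
by apply: (@rV_compact R d (fun=> `[0, 2 * pi]%classic)) => i; exact: segment_compact.
Qed.

Lemma slab_reduction th : exists k : 'rV[int]_d,
  forall i, `[0, 2 * pi]%classic ((th + (2 * pi) *: zvec R k) ord0 i).
Proof.
exists (\row_i - Num.floor (th 0 i / (2 * pi))) => i.
rewrite !mxE /= in_itv/= rmorphN /= mulrN.
have p0 := twopi_gt0.
set q := th 0 i / (2 * pi).
have -> : th ord0 i = 2 * pi * q by rewrite /q mulrC divfK // gt_eqF.
have := Num.Theory.floor_le_tmp q; have := lt_succ_floor q.
rewrite -mulrBr intrD => h1 h2.
apply/andP; split; first by apply: mulr_ge0; [exact: ltW | rewrite subr_ge0].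
by rewrite ger_pMr// lerBlDl ltW // addrC.
Qed.

Lemma periodic_continuous_bounded F rho : periodic_in_theta F ->
  (forall z, `|z.2| <= rho -> {for z, continuous F}) ->
  exists M : R, forall z, `|z.2| <= rho -> `|F z| <= M.
Proof.
move=> pF cF.
have /compact_near_coveringP K := @slab_compact rho.
have [//|M [_ HM]] := K R (pinfty_nbhs R) (fun M z => `|F z| <= M) _.
  move=> z [_ /=]; rewrite in_itv/= -ler_norml => zr.
  have /cvgrPdist_le /(_ 1 ltr01) Hz := cF z zr.
  exists ([set z' | `|F z - F z'| <= 1], [set M | `|F z| + 1 < M]).
    split => //=; exists (`|F z| + 1); split; rewrite ?num_real// => M /=.
  move=> [z' M] [/= h1 h2].
  have := ler_normB (F z) (F z - F z'); rewrite subKr => /le_trans; apply.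
  lra.
exists (M + 1) => -[th x] zr.
have [k Hk] := slab_reduction th.
rewrite -(pF k); apply: HM; first by rewrite ltrDl.
by split => //=; rewrite in_itv/= -ler_norml.
Qed.

(** Only the first of the two points is confined to the slab: the compactness
    argument is applied to moduli of continuity on full neighbourhoods, and the
    second point may leave the fundamental cube. *)
Lemma periodic_continuous_unif F rho : periodic_in_theta F ->
  (forall z, `|z.2| <= rho -> {for z, continuous F}) ->
  forall e : R, 0 < e -> exists2 del : R, 0 < del &
    forall th th' (x x' : R), `|x| <= rho ->
      (forall i, `|th 0 i - th' 0 i| <= del) -> `|x - x'| <= del ->
      `|F (th, x) - F (th', x')| <= e.
Proof.
move=> pF cF e e0.
have /compact_near_coveringP K := @slab_compact rho.
have [|del /= del0 H] := K R (0:R)^'+ (fun del z => forall z' : 'rV[R]_d * R, `|z - z'| <= del -> `|F z - F z'| <= e) _.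
  move=> z [_ /=]; rewrite in_itv/= -ler_norml => zr.
  have /cvgrPdist_le /(_ (e / 2)) := cF z zr.
  rewrite divr_gt0// => /(_ isT) /nbhs_normP[r /= r0 Hr].
  exists (ball z (r / 2), [set del | del < r / 2]).
    split => /=; first by apply: nbhsx_ballx; rewrite divr_gt0.
    by apply: nbhs_right_lt; rewrite divr_gt0.
  move=> [z' del] [/= h1 h2] z'' h3.
  rewrite -ball_normE /= in h1.
  have A1 : `|F z - F z'| <= e / 2.
    by apply: Hr => /=; lra.
  have A2 : `|F z - F z''| <= e / 2.
    apply: Hr => /=; rewrite -(subrK z' z) -addrA.
    by apply: le_lt_trans (ler_normD _ _) _; lra.
  have := ler_normB (F z - F z'') (F z - F z').
  have -> : F z - F z'' - (F z - F z') = F z' - F z'' by ring.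
  move=> A3.
  by apply: (le_trans A3); lra.
exists (del / 2); first by rewrite divr_gt0.
move=> th th' x x' xr hth hx.
have [k Hk] := slab_reduction th.
rewrite -(pF k) -(pF k th').
apply: (H (del / 2)) => //=.
- by rewrite sub0r normrN gtr0_norm ?divr_gt0// ltr_pdivrMr// ltr_pMr// ltr1n.
- by rewrite divr_gt0.
- by split => //=; rewrite in_itv/= -ler_norml.
- rewrite /Num.norm /= ge_max hx andbT.
  have d2 : 0 <= del / 2 by rewrite divr_ge0 // ltW.
  rewrite /= opprD addrACA subrr addr0.
  rewrite [leLHS]mx_normrE; apply: bigmax_le => // -[i j] _ /=.
  by rewrite !mxE (ord1 i); exact: hth.
Qed.
End compactness.

Section torus_cont.
Context {R : realType}.

(** By periodicity, continuity is the same as uniform continuity. Carrying the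
    uniform form avoids a compactness argument for each section, mean and uniform
    limit. *)
Definition torus_cont d (g : 'rV[R]_d -> R) := torus_periodic g /\
  forall e : R, 0 < e -> exists2 del : R, 0 < del &
    forall th th' : 'rV[R]_d, (forall i, `|th 0 i - th' 0 i| <= del) ->
      `|g th - g th'| <= e.

Lemma continuous_torus_cont d (g : 'rV[R]_d -> R) :
  torus_periodic g -> continuous g -> torus_cont g.
Proof.
move=> pg cg; split=> // e e0.
have [||del del0 H] := @periodic_continuous_unif R d (fun z => g z.1) 0 _ _ e e0.
- by move=> k th x; exact: pg.
- move=> z _; apply: (@continuous_comp _ _ _ fst g); [exact: cvg_fst | exact: cg].
exists del => // th th' h; apply: (H th th' 0 0) => //; by rewrite ?subrr normr0 // ltW.
Qed.

Lemma continuous_rV_eps d (g : 'rV[R]_d -> R) (th : 'rV[R]_d) :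
  (forall e : R, 0 < e -> exists2 del : R, 0 < del &
    forall th' : 'rV[R]_d, (forall i, `|th 0 i - th' 0 i| <= del) ->
      `|g th - g th'| <= e) -> {for th, continuous g}.
Proof.
move=> H; have FF : Filter (nbhs th) by exact: nbhs_filter.
apply/(@cvgrPdist_le _ _ _ (nbhs th) FF g (g th)) => e e0.
have [del del0 Hd] := H e e0.
apply/nbhs_ballP; exists del => //= th' /= h; apply: Hd => i.
by have [_ /(_ 0 i)/ltW] := h.
Qed.

Lemma torus_cont_continuous d (g : 'rV[R]_d -> R) : torus_cont g -> continuous g.
Proof.
move=> [_ H] th; apply: continuous_rV_eps => e /H[del del0 Hd].
by exists del => // th'; exact: Hd.
Qed.

Lemma torus_cont_bounded d (g : 'rV[R]_d -> R) : torus_cont g ->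
  exists2 M : R, 0 <= M & forall th, `|g th| <= M.
Proof.
move=> Hg; have cg := torus_cont_continuous Hg; have [pg _] := Hg.
have [||M HM] := @periodic_continuous_bounded R d (fun z => g z.1) 0.
- by move=> k th x; exact: pg.
- move=> z _; apply: (@continuous_comp _ _ _ fst g); [exact: cvg_fst | exact: cg].
exists M => [|th]; last by apply: (HM (th, 0)); rewrite /= normr0.
by apply: le_trans (HM (0, 0) _); rewrite //= normr0.
Qed.

Lemma torus_contD d (g1 g2 : 'rV[R]_d -> R) : torus_cont g1 -> torus_cont g2 ->
  torus_cont (fun th => g1 th + g2 th).
Proof.
move=> [p1 c1] [p2 c2]; split; first by move=> k th; rewrite p1 p2.
move=> e e0; have e20 : 0 < e / 2 by rewrite divr_gt0.
have [d1 d10 H1] := c1 _ e20; have [d2 d20 H2] := c2 _ e20.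
exists (Num.min d1 d2); first by rewrite lt_min d10.
move=> th th' h; rewrite opprD addrACA (splitr e).
apply: le_trans (ler_normD _ _) _; apply: lerD; [apply: H1|apply: H2] => i;
  by have := h i; rewrite le_min => /andP[].
Qed.

Lemma torus_contM d (g1 g2 : 'rV[R]_d -> R) : torus_cont g1 -> torus_cont g2 ->
  torus_cont (fun th => g1 th * g2 th).
Proof.
move=> t1 t2; have [M1 M10 H1] := torus_cont_bounded t1.
have [M2 M20 H2] := torus_cont_bounded t2.
case: t1 t2 => [p1 c1] [p2 c2]; split; first by move=> k th; rewrite p1 p2.
move=> e e0; have e20 : 0 < e / (M1 + M2 + 1) by rewrite divr_gt0// ltr_wpDl// addr_ge0.
have [d1 d10 K1] := c1 _ e20; have [d2 d20 K2] := c2 _ e20.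
exists (Num.min d1 d2); first by rewrite lt_min d10.
move=> th th' h.
have -> : g1 th * g2 th - g1 th' * g2 th' =
  g1 th * (g2 th - g2 th') + (g1 th - g1 th') * g2 th' by ring.
have h1 : `|g1 th - g1 th'| <= e / (M1 + M2 + 1).
  by apply: K1 => i; have := h i; rewrite le_min => /andP[].
have h2 : `|g2 th - g2 th'| <= e / (M1 + M2 + 1).
  by apply: K2 => i; have := h i; rewrite le_min => /andP[].
have : M1 * (e / (M1 + M2 + 1)) + e / (M1 + M2 + 1) * M2 <= e.
  have -> : M1 * (e / (M1 + M2 + 1)) + e / (M1 + M2 + 1) * M2 = e * ((M1 + M2) / (M1 + M2 + 1)).
    by ring.
  by rewrite ger_pMr// ler_pdivrMr ?mul1r ?lerDl// ltr_wpDl// addr_ge0.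
apply: le_trans; apply: le_trans (ler_normD _ _) _.
by apply: lerD; rewrite normrM; apply: ler_pM.
Qed.

Lemma torus_cont_cst d (c : R) : torus_cont ((fun=> c) : 'rV[R]_d -> R).
Proof. by split => // e e0; exists 1 => // *; rewrite subrr normr0 ltW. Qed.

Lemma torus_contZ d (c : R) (g : 'rV[R]_d -> R) : torus_cont g ->
  torus_cont (fun th => c * g th).
Proof. exact/torus_contM/torus_cont_cst. Qed.

Lemma torus_contB d (g1 g2 : 'rV[R]_d -> R) : torus_cont g1 -> torus_cont g2 ->
  torus_cont (fun th => g1 th - g2 th).
Proof.
move=> t1 t2; have -> : (fun th => g1 th - g2 th) = (fun th => g1 th + -1 * g2 th).
  by apply/funext => th; rewrite mulN1r.
by apply: torus_contD => //; exact: torus_contZ.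
Qed.

Lemma torus_cont_sum d (I : Type) (s : seq I) (P : pred I) (g : I -> 'rV[R]_d -> R) :
  (forall i, torus_cont (g i)) ->
  torus_cont (fun th => \sum_(i <- s | P i) g i th).
Proof.
move=> H; elim: s => [|i s IH].
  have -> : (fun th => \sum_(i <- [::] | P i) g i th) = (fun=> 0).
    by apply/funext => th; rewrite big_nil.
  exact: torus_cont_cst.
have -> : (fun th => \sum_(i <- i :: s | P i) g i th) =
  (fun th => (if P i then g i th else 0) + \sum_(i <- s | P i) g i th).
  by apply/funext => th; rewrite big_cons; case: ifP; rewrite ?add0r.
by apply: torus_contD => //; case: (P i) => //; exact: torus_cont_cst.
Qed.

Lemma torus_cont_shift d (v : 'rV[R]_d) (g : 'rV[R]_d -> R) : torus_cont g ->
  torus_cont (fun th => g (th + v)).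
Proof.
move=> [p c]; split; first by move=> k th; rewrite addrAC p.
move=> e e0; have [del del0 H] := c e e0; exists del => // th th' h.
by apply: H => i; rewrite !mxE opprD addrACA subrr addr0.
Qed.

Lemma torus_cont_reflect d (v : 'rV[R]_d) (g : 'rV[R]_d -> R) : torus_cont g ->
  torus_cont (fun th => g (v - th)).
Proof.
move=> [p c]; split.
  move=> k th; rewrite opprD addrA -[RHS](p (- k)); congr (g (_ + _)).
  rewrite -scalerN; congr (_ *: _); apply/matrixP => i j.
  by rewrite !mxE mulrNz.
move=> e e0; have [del del0 H] := c e e0; exists del => // th th' h.
by apply: H => i; rewrite !mxE opprD addrACA subrr add0r -opprD normrN.
Qed.

Lemma torus_cont_unif_lim d (g : 'rV[R]_d -> R) : torus_periodic g ->
  (forall e : R, 0 < e -> exists2 u : 'rV[R]_d -> R, torus_cont u &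
     forall th, `|g th - u th| <= e) -> torus_cont g.
Proof.
move=> pg H; split=> // e e0; have e30 : 0 < e / 3 by rewrite divr_gt0.
have [u [_ cu] Hu] := H _ e30.
have [del del0 Hd] := cu _ e30; exists del => // th th' h.
have := Hd _ _ h; have := Hu th; have := Hu th'.
rewrite !ler_norml => /andP[? ?] /andP[? ?] /andP[? ?]; apply/andP; split; lra.
Qed.

Lemma dotvDr d (k u v : 'rV[R]_d) : dotv k (u + v) = dotv k u + dotv k v.
Proof.
by rewrite /dotv -big_split; apply: eq_bigr => i _; rewrite mxE mulrDr.
Qed.

Lemma dotvZr d (k v : 'rV[R]_d) (c : R) : dotv k (c *: v) = c * dotv k v.
Proof.
by rewrite /dotv mulr_sumr; apply: eq_bigr => i _; rewrite mxE mulrCA.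
Qed.

Lemma dotvDl d (u v k : 'rV[R]_d) : dotv (u + v) k = dotv u k + dotv v k.
Proof.
by rewrite /dotv -big_split; apply: eq_bigr => i _; rewrite mxE mulrDl.
Qed.

Lemma dotvNl d (u k : 'rV[R]_d) : dotv (- u) k = - dotv u k.
Proof.
by rewrite /dotv -sumrN; apply: eq_bigr => i _; rewrite mxE mulNr.
Qed.

Lemma dotvNr d (u k : 'rV[R]_d) : dotv u (- k) = - dotv u k.
Proof.
by rewrite /dotv -sumrN; apply: eq_bigr => i _; rewrite mxE mulrN.
Qed.

Lemma periodic_int (f : R -> R) (n : int) (x : R) :
  (forall y, f (y + pi *+ 2) = f y) -> f (x + (2 * pi) * n%:~R) = f x.
Proof.
move=> H; have K m y : f (y + (2 * pi) * m%:R) = f y.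
  elim: m y => [|m IH] y; first by rewrite mulr0 addr0.
  have -> : y + 2 * pi * m.+1%:R = y + 2 * pi * m%:R + pi *+ 2.
    by rewrite -[pi *+ 2]mulr_natl [m.+1%:R]mulrSr; ring.
  by rewrite H.
case: n => n; first exact: K.
by rewrite NegzE mulrNz mulrN -[LHS](K n.+1) subrK.
Qed.

Definition ccos d (k : 'rV[int]_d) (th : 'rV[R]_d) : R := cos (dotv (zvec R k) th).
Definition csin d (k : 'rV[int]_d) (th : 'rV[R]_d) : R := sin (dotv (zvec R k) th).

Lemma dotv_zvec d (k j : 'rV[int]_d) :
  dotv (zvec R k) (zvec R j) = (\sum_i k 0 i * j 0 i)%:~R.
Proof.
by rewrite /dotv rmorph_sum; apply: eq_bigr => i _; rewrite !mxE rmorphM.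
Qed.

Lemma torus_cont_dotv (f : R -> R) d (k : 'rV[int]_d) :
  (forall y, f (y + pi *+ 2) = f y) -> continuous f ->
  torus_cont (fun th => f (dotv (zvec R k) th)).
Proof.
move=> pf cf; apply: continuous_torus_cont.
  by move=> j th; rewrite dotvDr dotvZr dotv_zvec periodic_int.
move=> th; apply: (@continuous_comp _ _ _ (dotv (zvec R k)) f); last exact: cf.
apply: continuous_rV_eps => e e0.
pose S := \sum_i `|zvec R k 0 i| + 1.
have S0 : 0 < S by rewrite ltr_wpDl// sumr_ge0.
exists (e / S); first by rewrite divr_gt0.
move=> th' h.
rewrite -dotvNr -dotvDr /dotv; apply: le_trans (ler_norm_sum _ _ _) _.
apply: (@le_trans _ _ (\sum_i `|zvec R k 0 i| * (e / S))).
  apply: ler_sum => i _; rewrite normrM ler_wpM2l//.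
  by have := h i; rewrite !mxE.
rewrite -mulr_suml mulrCA ger_pMr// ler_pdivrMr// mul1r /S; lra.
Qed.

Lemma torus_cont_ccos d k : torus_cont (@ccos d k).
Proof. by apply: torus_cont_dotv; [exact: cosD2pi|exact: continuous_cos]. Qed.

Lemma torus_cont_csin d k : torus_cont (@csin d k).
Proof. by apply: torus_cont_dotv; [exact: sinD2pi|exact: continuous_sin]. Qed.

End torus_cont.

(** * The mean over the torus *)

Section tmean.
Context {R : realType}.
Local Notation mu := (@lebesgue_measure R).

Definition section1 d (g : 'rV[R]_(1 + d) -> R) (s : R) : 'rV[R]_d -> R :=
  fun th => g (row_mx (const_mx s : 'rV[R]_1) th).

Lemma tmeanS d (g : 'rV[R]_(1 + d) -> R) : @tmean R d.+1 g =
  (2 * pi)^-1 * \int[mu]_(s in `[0, 2 * pi]) tmean (section1 g s).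
Proof. by []. Qed.

Lemma row_mx_close d (s s' del : R) (th th' : 'rV[R]_d) :
  `|s - s'| <= del -> (forall i, `|th 0 i - th' 0 i| <= del) ->
  forall i, `|row_mx (const_mx s : 'rV[R]_1) th 0 i -
              row_mx (const_mx s' : 'rV[R]_1) th' 0 i| <= del.
Proof.
move=> hs h i; case: (splitP i) => j ij.
  have -> : i = lshift d j by apply/val_inj.
  by rewrite !row_mxEl !mxE.
have -> : i = rshift 1 j by apply/val_inj.
by rewrite !row_mxEr.
Qed.

Lemma torus_cont_section1 d (g : 'rV[R]_(1 + d) -> R) s :
  torus_cont g -> torus_cont (section1 g s).
Proof.
move=> [p c]; split.
  move=> k th; rewrite /section1 -[RHS](p (row_mx 0 k)); congr g.
  rewrite /zvec map_row_mx scale_row_mx add_row_mx.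
  by congr row_mx; apply/matrixP => i j; rewrite !mxE mulr0 addr0.
move=> e e0; have [del del0 H] := c e e0; exists del => // th th' h.
by apply: H => i; apply: row_mx_close => //; rewrite subrr normr0 ltW.
Qed.

Lemma section1_periodic d (g : 'rV[R]_(1 + d) -> R) s :
  torus_cont g -> section1 g (s + 2 * pi) = section1 g s.
Proof.
move=> [p c]; apply/funext => th; rewrite /section1.
rewrite -[RHS](p (row_mx (const_mx 1) 0)); congr g.
rewrite /zvec map_row_mx scale_row_mx add_row_mx.
by congr row_mx; apply/matrixP => i j; rewrite !mxE ?mulr1// mulr0 addr0.
Qed.

Lemma section1_unif d (g : 'rV[R]_(1 + d) -> R) : torus_cont g ->
  forall e : R, 0 < e -> exists2 del : R, 0 < del &
    forall s s' th, `|s - s'| <= del -> `|section1 g s th - section1 g s' th| <= e.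
Proof.
move=> [p c] e e0; have [del del0 H] := c e e0; exists del => // s s' th h.
by apply: H => i; apply: row_mx_close => // j; rewrite subrr normr0 ltW.
Qed.

(** The induction on the dimension needs these four properties of the mean in
    d variables together: they make the mean of the sections a continuous
    function, which is what the outer integral requires. *)
Definition tmean_spec d (m : ('rV[R]_d -> R) -> R) :=
  [/\ forall g1 g2, torus_cont g1 -> torus_cont g2 ->
        m (fun th => g1 th + g2 th) = m g1 + m g2,
      forall c g, torus_cont g -> m (fun th => c * g th) = c * m g,
      forall g1 g2, torus_cont g1 -> torus_cont g2 ->
        (forall th, g1 th <= g2 th) -> m g1 <= m g2 &
      forall c, m (fun=> c) = c].

Lemma tmean_spec_unif d (m : ('rV[R]_d -> R) -> R) g1 g2 (e : R) : tmean_spec m ->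
  torus_cont g1 -> torus_cont g2 -> (forall th, `|g1 th - g2 th| <= e) ->
  `|m g1 - m g2| <= e.
Proof.
move=> [mD mZ mle mc] c1 c2 H.
have K g g' : torus_cont g -> torus_cont g' -> (forall th, `|g th - g' th| <= e) -> m g <= m g' + e.
  move=> cg cg' h; rewrite -[X in _ + X](mc e) -mD //; last exact: torus_cont_cst.
  apply: mle => //; first by apply: torus_contD => //; exact: torus_cont_cst.
  by move=> th; have := h th; rewrite ler_norml => /andP[_]; rewrite lerBlDl.
have h1 := K _ _ c1 c2 H.
have h2 : m g2 <= m g1 + e by apply: K => // th; rewrite distrC.
by rewrite ler_norml; apply/andP; split; lra.
Qed.

Lemma tmean_section1_regular d (g : 'rV[R]_(1 + d) -> R) : tmean_spec (@tmean R d) ->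
  torus_cont g -> continuous (fun s => tmean (section1 g s)) /\
  bounded_measurable (fun s => tmean (section1 g s)).
Proof.
move=> S cg.
have C : continuous (fun s => tmean (section1 g s)).
  move=> s; apply/cvgrPdist_le => e e0.
  have [del del0 H] := section1_unif cg e0.
  exists del => //= s' /= hs; apply: (tmean_spec_unif S); try exact: torus_cont_section1.
  by move=> th; apply: H; exact: ltW.
split => //; have [M M0 HM] := torus_cont_bounded cg.
apply: (@continuous_bounded_measurable _ _ M) => // s.
have [_ _ _ mc] := S; rewrite -[X in `|X|]subr0 -(mc 0).
apply: (tmean_spec_unif S); first exact: torus_cont_section1.
  exact: torus_cont_cst.
by move=> th; rewrite subr0; exact: HM.
Qed.

Lemma tmean_specP d : tmean_spec (@tmean R d).
Proof.
elim: d => [|d IH].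
  by split => //= g1 g2 _ _; apply.
have p0 := @twopi_gt0 R.
have [mD mZ mle mc] := IH.
split.
- move=> g1 g2 c1 c2; rewrite !tmeanS -mulrDr; congr (_ * _).
  rewrite -RintegralD//; last 2 first.
  + by apply: bounded_measurable_integrable; have [] := tmean_section1_regular IH c1.
  + by apply: bounded_measurable_integrable; have [] := tmean_section1_regular IH c2.
  by apply: eq_Rintegral => s _; rewrite -mD //; exact: torus_cont_section1.
- move=> c g cg; rewrite !tmeanS mulrCA; congr (_ * _).
  rewrite -RintegralZl//; last first.
    by apply: bounded_measurable_integrable; have [] := tmean_section1_regular IH cg.
  by apply: eq_Rintegral => s _; rewrite -mZ //; exact: torus_cont_section1.
- move=> g1 g2 c1 c2 H; rewrite !tmeanS ler_wpM2l//; first by rewrite invr_ge0 ltW.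
  apply: le_Rintegral => //.
  + by apply: bounded_measurable_integrable; have [] := tmean_section1_regular IH c1.
  + by apply: bounded_measurable_integrable; have [] := tmean_section1_regular IH c2.
  move=> s _; apply: mle; try exact: torus_cont_section1.
  by move=> th; exact: H.
- move=> c; rewrite tmeanS.
  have -> : \int[mu]_(s in `[0, 2 * pi]) tmean (section1 (fun=> c : R) s : 'rV[R]_d -> R) =
            \int[mu]_(s in `[0, 2 * pi]) c.
    by apply: eq_Rintegral => s _; rewrite /section1 mc.
  rewrite Rintegral_cst//.
  set M := fine _; have -> : M = 2 * pi.
    have H := @lebesgue_measure_itv R `[0, 2 * pi].
    by rewrite /= lte_fin p0 oppr0 adde0 in H; exact: (congr1 fine H).
  by rewrite mulrCA mulVf ?mulr1// gt_eqF.
Qed.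

Context {d : nat}.
Implicit Types g : 'rV[R]_d -> R.

Lemma tmeanD g1 g2 : torus_cont g1 -> torus_cont g2 ->
  tmean (fun th => g1 th + g2 th) = tmean g1 + tmean g2.
Proof. by have [H _ _ _] := @tmean_specP d; exact: H. Qed.

Lemma tmeanZ (c : R) g : torus_cont g -> tmean (fun th => c * g th) = c * tmean g.
Proof. by have [_ H _ _] := @tmean_specP d; exact: H. Qed.

Lemma tmean_le g1 g2 : torus_cont g1 -> torus_cont g2 ->
  (forall th, g1 th <= g2 th) -> tmean g1 <= tmean g2.
Proof. by have [_ _ H _] := @tmean_specP d; exact: H. Qed.

Lemma tmean_cst (c : R) : tmean ((fun=> c) : 'rV[R]_d -> R) = c.
Proof. by have [_ _ _ H] := @tmean_specP d; exact: H. Qed.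

Lemma tmean_unif g1 g2 (e : R) : torus_cont g1 -> torus_cont g2 ->
  (forall th, `|g1 th - g2 th| <= e) -> `|tmean g1 - tmean g2| <= e.
Proof. by move=> ? ?; apply: tmean_spec_unif => //; exact: tmean_specP. Qed.

Lemma tmean_bound g (M : R) : torus_cont g -> (forall th, `|g th| <= M) ->
  `|tmean g| <= M.
Proof.
move=> cg H; rewrite -[tmean g]subr0 -(tmean_cst 0).
by apply: tmean_unif => //; [exact: torus_cont_cst|move=> th; rewrite subr0].
Qed.

Lemma tmeanB g1 g2 : torus_cont g1 -> torus_cont g2 ->
  tmean (fun th => g1 th - g2 th) = tmean g1 - tmean g2.
Proof.
move=> c1 c2; rewrite -mulN1r -tmeanZ// -tmeanD//; last exact: torus_contZ.
by congr tmean; apply/funext => th; rewrite mulN1r.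
Qed.

Lemma tmean_sum (I : Type) (s : seq I) (P : pred I) (g : I -> 'rV[R]_d -> R) :
  (forall i, torus_cont (g i)) ->
  tmean (fun th => \sum_(i <- s | P i) g i th) = \sum_(i <- s | P i) tmean (g i).
Proof.
move=> H; elim: s => [|i s IH].
  rewrite big_nil -[RHS](tmean_cst 0); congr tmean.
  by apply/funext => th; rewrite big_nil.
rewrite big_cons -IH.
have -> : (fun th => \sum_(i <- i :: s | P i) g i th) =
  (fun th => (if P i then g i th else 0) + \sum_(i <- s | P i) g i th).
  by apply/funext => th; rewrite big_cons; case: ifP; rewrite ?add0r.
have cs : torus_cont (fun th => \sum_(i <- s | P i) g i th) by exact: torus_cont_sum.
rewrite tmeanD//; last by case: (P i) => //; exact: torus_cont_cst.
by case: (P i) => //; rewrite tmean_cst add0r.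
Qed.

End tmean.

(** The first coordinate of the shift is absorbed by the one-dimensional
    periodic integral, the others by induction on the dimension. *)
Lemma tmean_shift (R : realType) d (g : 'rV[R]_d -> R) (v : 'rV[R]_d) : torus_cont g ->
  tmean (fun th => g (th + v)) = tmean g.
Proof.
elim: d g v => [|d IH] g v cg; first by congr g; apply/matrixP => i [].
rewrite !tmeanS; congr (_ * _).
have [C B] := tmean_section1_regular (tmean_specP d) cg.
have vE : v = row_mx (const_mx (v 0 0) : 'rV[R]_1) (rsubmx (v : 'rV[R]_(1 + d))).
  apply/rowP => i; rewrite mxE; case: splitP => j ij; rewrite !mxE.
    by congr (v 0 _); apply/val_inj; rewrite /= ij (ord1 j).
  by congr (v 0 _); apply/val_inj.
rewrite -(@integral_shift_periodic _ _ (2 * pi) (v 0 0) twopi_gt0 C B); last first.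
  by move=> s; rewrite section1_periodic.
apply: eq_Rintegral => s _.
rewrite -(IH (section1 g (s + v 0 0)) (rsubmx (v : 'rV[R]_(1 + d)))).
  congr tmean; apply/funext => th; rewrite /section1; congr g.
  apply/rowP => i; rewrite !mxE; case: splitP => j ij; rewrite !mxE; congr (_ + v 0 _).
    by apply/val_inj; rewrite /= ij (ord1 j).
  exact/val_inj.
exact: torus_cont_section1.
Qed.

(** * Fourier coefficients and uniform partial derivatives *)

Section fourier.
Context {R : realType} {d : nat}.
Implicit Types (u v g : 'rV[R]_d -> R) (th : 'rV[R]_d) (k j : 'rV[int]_d).
Local Notation ccos := (@ccos R d).
Local Notation csin := (@csin R d).

Lemma zvecD k j : zvec R (k + j) = zvec R k + zvec R j.
Proof. by apply/rowP => i; rewrite !mxE intrD. Qed.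

Lemma zvecN k : zvec R (- k) = - zvec R k.
Proof. by apply/rowP => i; rewrite !mxE mulrNz. Qed.

Lemma ccosD k th w : ccos k (th + w) = ccos k th * ccos k w - csin k th * csin k w.
Proof. by rewrite /ccos /csin dotvDr cosD. Qed.

Lemma csinD k th w : csin k (th + w) = csin k th * ccos k w + ccos k th * csin k w.
Proof. by rewrite /ccos /csin dotvDr sinD. Qed.

Lemma ccosN k th : ccos k (- th) = ccos k th.
Proof. by rewrite /ccos dotvNr cosN. Qed.

Lemma csinN k th : csin k (- th) = - csin k th.
Proof. by rewrite /csin dotvNr sinN. Qed.

Lemma ccosDk k j th : ccos (k + j) th = ccos k th * ccos j th - csin k th * csin j th.
Proof. by rewrite /ccos /csin zvecD dotvDl cosD. Qed.

Lemma csinDk k j th : csin (k + j) th = csin k th * ccos j th + ccos k th * csin j th.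
Proof. by rewrite /ccos /csin zvecD dotvDl sinD. Qed.

Lemma ccosNk k th : ccos (- k) th = ccos k th.
Proof. by rewrite /ccos zvecN dotvNl cosN. Qed.

Lemma csinNk k th : csin (- k) th = - csin k th.
Proof. by rewrite /csin zvecN dotvNl sinN. Qed.

Lemma ccos0k th : ccos 0 th = 1.
Proof.
rewrite /ccos (_ : dotv _ _ = 0) ?cos0//.
by rewrite /dotv big1 // => i _; rewrite !mxE mul0r.
Qed.

Lemma csin0k th : csin 0 th = 0.
Proof.
rewrite /csin (_ : dotv _ _ = 0) ?sin0//.
by rewrite /dotv big1 // => i _; rewrite !mxE mul0r.
Qed.

Lemma ccos_csin_sqr k th : ccos k th ^+ 2 + csin k th ^+ 2 = 1.
Proof. exact: cos2Dsin2. Qed.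

Lemma ccos_le1 k th : `|ccos k th| <= 1.
Proof. by rewrite ler_norml cos_geN1 cos_le1. Qed.

Lemma csin_le1 k th : `|csin k th| <= 1.
Proof. by rewrite ler_norml sin_geN1 sin_le1. Qed.

Lemma tmean_antiperiodic g w : torus_cont g -> (forall th, g (th + w) = - g th) ->
  tmean g = 0.
Proof.
move=> cg H; have := tmean_shift w cg.
have -> : (fun th => g (th + w)) = (fun th => -1 * g th).
  by apply/funext => th; rewrite H mulN1r.
rewrite tmeanZ // mulN1r => h; lra.
Qed.

(** A nontrivial character changes sign under a suitable translation.
    Together with [tmean_antiperiodic] this gives its mean without computing an
    integral. *)
Lemma half_period k : k != 0 -> exists v : 'rV[R]_d, dotv (zvec R k) v = pi.
Proof.
move=> k0; have [i ki] : exists i, k 0 i != 0.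
  apply/existsP; apply: contraNT k0; rewrite negb_exists => /forallP H.
  by apply/eqP/rowP => i; rewrite mxE; apply/eqP; have := H i; rewrite negbK.
exists ((pi / (k 0 i)%:~R) *: delta_mx 0 i).
rewrite dotvZr /dotv (bigD1 i) //= big1 ?addr0.
  by rewrite !mxE !eqxx mulr1 divfK // intr_eq0.
by move=> l li; rewrite !mxE (negbTE li) andbF mulr0.
Qed.

Lemma tmean_ccos k : tmean (ccos k) = (k == 0)%:R.
Proof.
have [->|k0] := eqVneq k 0.
  rewrite (_ : ccos 0 = fun=> 1) ?tmean_cst//.
  by apply/funext => th; rewrite ccos0k.
have [v hv] := half_period k0.
apply: (@tmean_antiperiodic _ v); first exact: torus_cont_ccos.
by move=> th; rewrite ccosD /ccos /csin hv cospi sinpi mulr0 subr0 mulrN1.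
Qed.

Lemma tmean_csin k : tmean (csin k) = 0.
Proof.
have [->|k0] := eqVneq k 0.
  rewrite (_ : csin 0 = fun=> 0) ?tmean_cst//.
  by apply/funext => th; rewrite csin0k.
have [v hv] := half_period k0.
apply: (@tmean_antiperiodic _ v); first exact: torus_cont_csin.
by move=> th; rewrite csinD /ccos /csin hv cospi sinpi mulr0 addr0 mulrN1.
Qed.

Definition fcos u k := tmean (fun th => u th * ccos k th).
Definition fsin u k := tmean (fun th => u th * csin k th).
(** The squared modulus of the k-th Fourier coefficient. *)
Definition fpow u k := fcos u k ^+ 2 + fsin u k ^+ 2.

Lemma normc_fourier_coef u k :
  ComplexField.Normc.normc (fourier_coef u k) ^+ 2 = fpow u k.
Proof.
by rewrite /fourier_coef /= sqr_sqrtr ?sqrrN// addr_ge0// sqr_ge0.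
Qed.

Lemma fpow_ge0 u k : 0 <= fpow u k.
Proof. by rewrite addr_ge0// sqr_ge0. Qed.

Lemma torus_cont_fcos u k : torus_cont u -> torus_cont (fun th => u th * ccos k th).
Proof. by move=> cu; apply: torus_contM => //; exact: torus_cont_ccos. Qed.

Lemma torus_cont_fsin u k : torus_cont u -> torus_cont (fun th => u th * csin k th).
Proof. by move=> cu; apply: torus_contM => //; exact: torus_cont_csin. Qed.

(** A k and B k are the real and imaginary parts of the k-th term of the
    Fourier series, so the mean of A k A j + B k B j is 0 for distinct k, j. The
    mean of (u - sum A)^2 + (sum B)^2 is nonnegative, and by orthogonality it is
    the difference of the two sides. *)
Lemma bessel u (s : seq 'rV[int]_d) : torus_cont u -> uniq s ->
  \sum_(k <- s) fpow u k <= tmean (fun th => u th ^+ 2).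
Proof.
move=> cu us.
pose A k th := fcos u k * ccos k th + fsin u k * csin k th.
pose B k th := fcos u k * csin k th - fsin u k * ccos k th.
have cA k : torus_cont (A k).
  by apply: torus_contD; apply: torus_contZ; [exact: torus_cont_ccos|exact: torus_cont_csin].
have cB k : torus_cont (B k).
  by apply: torus_contB; apply: torus_contZ; [exact: torus_cont_csin|exact: torus_cont_ccos].
have cAB k j : torus_cont (fun th => A k th * A j th + B k th * B j th).
  by apply: torus_contD; apply: torus_contM.
have mAB k j : tmean (fun th => A k th * A j th + B k th * B j th) =
    (k == j)%:R * fpow u k.
  have -> : (fun th => A k th * A j th + B k th * B j th) =
    (fun th => (fcos u k * fcos u j + fsin u k * fsin u j) * ccos (k - j) th +
       (fsin u k * fcos u j - fcos u k * fsin u j) * csin (k - j) th).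
    apply/funext => th; rewrite ccosDk csinDk ccosNk csinNk /A /B; ring.
  rewrite tmeanD ?tmeanZ; try exact: torus_cont_ccos; try exact: torus_cont_csin;
    try (apply: torus_contZ; try exact: torus_cont_ccos; try exact: torus_cont_csin).
  rewrite tmean_ccos tmean_csin mulr0 addr0 subr_eq0.
  by have [->|] := eqVneq k j; rewrite ?mul0r ?mulr0// mulrC.
have muA k : tmean (fun th => u th * A k th) = fpow u k.
  have -> : (fun th => u th * A k th) = (fun th => fcos u k * (u th * ccos k th) + fsin u k * (u th * csin k th)).
    by apply/funext => th; rewrite /A; ring.
  rewrite tmeanD ?tmeanZ; try (apply: torus_contZ); try exact: torus_cont_fcos; try exact: torus_cont_fsin.
  by rewrite /fpow !expr2.
pose SA th := \sum_(k <- s) A k th; pose SB th := \sum_(k <- s) B k th.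
have cSA : torus_cont SA by exact: torus_cont_sum.
have cSB : torus_cont SB by exact: torus_cont_sum.
have cu2 : torus_cont (fun th => u th ^+ 2).
  by have -> : (fun th => u th ^+ 2) = (fun th => u th * u th); [apply/funext|exact: torus_contM].
have cuSA : torus_cont (fun th => 2 * (u th * SA th)).
  by apply: torus_contZ; exact: torus_contM.
have cQ : torus_cont (fun th => SA th * SA th + SB th * SB th).
  by apply: torus_contD; apply: torus_contM.
have mQ : tmean (fun th => SA th * SA th + SB th * SB th) = \sum_(k <- s) fpow u k.
  have -> : (fun th => SA th * SA th + SB th * SB th) =
    (fun th => \sum_(k <- s) \sum_(j <- s) (A k th * A j th + B k th * B j th)).
    apply/funext => th; rewrite /SA /SB !mulr_suml -big_split /=.
    by apply: eq_bigr => k _; rewrite !mulr_sumr -big_split.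
  rewrite tmean_sum; last by move=> k; exact: torus_cont_sum.
  rewrite big_seq [RHS]big_seq; apply: eq_bigr => k ks.
  rewrite tmean_sum // (bigD1_seq k) //= mAB eqxx mul1r big1_seq ?addr0//.
  by move=> j /andP[jk _]; rewrite mAB eq_sym (negbTE jk) mul0r.
have muSA : tmean (fun th => u th * SA th) = \sum_(k <- s) fpow u k.
  have -> : (fun th => u th * SA th) = (fun th => \sum_(k <- s) u th * A k th).
    by apply/funext => th; rewrite mulr_sumr.
  rewrite tmean_sum; last by move=> k; exact: torus_contM.
  by apply: eq_bigr => k _; rewrite muA.
have : 0 <= tmean (fun th => (u th ^+ 2 - 2 * (u th * SA th)) + (SA th * SA th + SB th * SB th)).
  rewrite -(@tmean_cst R d 0); apply: tmean_le; first exact: torus_cont_cst.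
    by apply: torus_contD => //; exact: torus_contB.
  move=> th.
  have -> : u th ^+ 2 - 2 * (u th * SA th) + (SA th * SA th + SB th * SB th) =
    (u th - SA th) ^+ 2 + SB th ^+ 2 by ring.
  by rewrite addr_ge0 // sqr_ge0.
rewrite tmeanD ?tmeanB //; last exact: torus_contB.
rewrite tmeanZ; last exact: torus_contM.
rewrite mQ muSA; lra.
Qed.

(** Convergence of the difference quotients is uniform on the torus, so that
    it survives averaging in th. *)
Definition udiff (i : 'I_d) u v := forall e : R, 0 < e -> exists2 del : R, 0 < del &
  forall h th, `|h| <= del -> `|u (th + h *: delta_mx 0 i) - u th - h * v th| <= e * `|h|.

Lemma udiff_cst i (c : R) : udiff i (fun=> c) (fun=> 0).
Proof.
move=> e e0; exists 1 => // h th _.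
by rewrite subrr mulr0 subrr normr0 mulr_ge0// ltW.
Qed.

Lemma udiffD i u1 v1 u2 v2 : udiff i u1 v1 -> udiff i u2 v2 ->
  udiff i (fun th => u1 th + u2 th) (fun th => v1 th + v2 th).
Proof.
move=> H1 H2 e e0; have e20 : 0 < e / 2 by rewrite divr_gt0.
have [d1 d10 K1] := H1 _ e20; have [d2 d20 K2] := H2 _ e20.
exists (Num.min d1 d2); first by rewrite lt_min d10.
move=> h th; rewrite le_min => /andP[h1 h2].
set w := th + _; have -> : u1 w + u2 w - (u1 th + u2 th) - h * (v1 th + v2 th) =
  (u1 w - u1 th - h * v1 th) + (u2 w - u2 th - h * v2 th) by ring.
rewrite [e]splitr mulrDl.
by apply: le_trans (ler_normD _ _) _; apply: lerD; [exact: K1|exact: K2].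
Qed.

Lemma udiffM i u1 v1 u2 v2 : torus_cont u1 -> torus_cont u2 -> torus_cont v1 ->
  torus_cont v2 -> udiff i u1 v1 -> udiff i u2 v2 ->
  udiff i (fun th => u1 th * u2 th) (fun th => v1 th * u2 th + u1 th * v2 th).
Proof.
move=> cu1 cu2 cv1 cv2 H1 H2 e e0.
have [A A0 HA] := torus_cont_bounded cu1; have [B B0 HB] := torus_cont_bounded cu2.
have [C C0 HC] := torus_cont_bounded cv1; have [D D0 HD] := torus_cont_bounded cv2.
pose S := A + B + (C + 1) * (D + 1) + 1.
have CD : 0 <= (C + 1) * (D + 1) by rewrite mulr_ge0 // addr_ge0.
have S0 : 0 < S by rewrite /S ltr_wpDl// addr_ge0// addr_ge0.
pose e1 := Num.min 1 (e / S).
have e10 : 0 < e1 by rewrite lt_min ltr01 divr_gt0.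
have [d1 d10 K1] := H1 _ e10; have [d2 d20 K2] := H2 _ e10.
exists (Num.min (Num.min d1 d2) (e / S)); first by rewrite !lt_min d10 d20 divr_gt0.
move=> h th; rewrite !le_min => /andP[/andP[/K1 h1 /K2 h2] h3].
have e11 : e1 <= 1 by rewrite ge_min lexx.
have e1S : e1 <= e / S by rewrite ge_min lexx orbT.
set w := th + _; have {}h1 := h1 th; have {}h2 := h2 th; rewrite -/w in h1 h2.
have -> : u1 w * u2 w - u1 th * u2 th - h * (v1 th * u2 th + u1 th * v2 th) =
  u1 th * (u2 w - u2 th - h * v2 th) + (u1 w - u1 th - h * v1 th) * u2 th +
  (u1 w - u1 th) * (u2 w - u2 th) by ring.
have h0 := normr_ge0 h.
have q u v (M : R) : `|u w - u th - h * v th| <= e1 * `|h| -> `|v th| <= M ->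
    `|u w - u th| <= (M + 1) * `|h|.
  move=> a1 a2; have -> : u w - u th = (u w - u th - h * v th) + h * v th by ring.
  apply: le_trans (ler_normD _ _) _; rewrite mulrDl addrC mul1r; apply: lerD.
    by rewrite normrM mulrC ler_wpM2r.
  by apply: le_trans a1 _; rewrite ler_piMl.
have q1 := q _ _ _ h1 (HC th); have q2 := q _ _ _ h2 (HD th).
have eSh : 0 <= e / S * `|h| by rewrite mulr_ge0// ltW// divr_gt0.
have t1 : `|u1 th * (u2 w - u2 th - h * v2 th)| <= A * (e / S * `|h|).
  by rewrite normrM; apply: ler_pM => //; apply: le_trans h2 _; rewrite ler_wpM2r.
have t2 : `|(u1 w - u1 th - h * v1 th) * u2 th| <= B * (e / S * `|h|).
  by rewrite normrM mulrC; apply: ler_pM => //; apply: le_trans h1 _; rewrite ler_wpM2r.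
have t3 : `|(u1 w - u1 th) * (u2 w - u2 th)| <= (C + 1) * (D + 1) * (e / S * `|h|).
  rewrite normrM; apply: le_trans (ler_pM _ _ q1 q2) _ => //.
  have -> : (C + 1) * `|h| * ((D + 1) * `|h|) = (C + 1) * (D + 1) * (`|h| * `|h|) by ring.
  by apply: ler_wpM2l => //; apply: ler_wpM2r.
have : S * (e / S * `|h|) = e * `|h| by rewrite mulrA mulrCA divff ?mulr1// gt_eqF.
move=> <-.
apply: le_trans (ler_normD _ _) _; apply: le_trans (lerD (ler_normD _ _) (lexx _)) _.
apply: le_trans (lerD (lerD t1 t2) t3) _.
by rewrite -!mulrDl; apply: ler_wpM2r => //; rewrite /S lerDl.
Qed.

Lemma udiffZ i (c : R) u v : torus_cont u -> torus_cont v -> udiff i u v ->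
  udiff i (fun th => c * u th) (fun th => c * v th).
Proof.
move=> cu cv H; have K := @udiffM i (fun=> c) (fun=> 0) u v (torus_cont_cst d c) cu (torus_cont_cst d 0) cv (udiff_cst i c) H.
move=> e e0; have [del del0 Hd] := K e e0; exists del => // h th hh.
by have := Hd h th hh; rewrite mul0r add0r.
Qed.

Lemma dotv_delta (w : 'rV[R]_d) (i : 'I_d) : dotv w (delta_mx 0 i) = w 0 i.
Proof.
rewrite /dotv (bigD1 i) //= big1 ?addr0; first by rewrite mxE !eqxx mulr1.
by move=> l li; rewrite !mxE (negbTE li) andbF mulr0.
Qed.

Lemma trig_small (e : R) : 0 < e -> exists2 del : R, 0 < del &
  forall t, `|t| <= del -> `|cos t - 1| <= e * `|t| /\ `|sin t - t| <= e * `|t|.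
Proof.
move=> e0.
have /is_derive_epsP/(_ e e0)[d1 d10 H1] := is_derive_cos (0 : R).
have /is_derive_epsP/(_ e e0)[d2 d20 H2] := is_derive_sin (0 : R).
exists (Num.min d1 d2 / 2); first by rewrite divr_gt0// lt_min d10.
move=> t ht; have : `|t| < Num.min d1 d2.
  by apply: (le_lt_trans ht); rewrite ltr_pdivrMr// ltr_pMr ?ltr1n// lt_min d10.
rewrite lt_min => /andP[t1 t2]; split.
  by have := H1 t t1; rewrite add0r cos0 sin0 oppr0 mulr0 subr0.
by have := H2 t t2; rewrite add0r cos0 sin0 mulr1 subr0.
Qed.

Lemma udiff_trig i k : udiff i (ccos k) (fun th => - (k 0 i)%:~R * csin k th) /\
  udiff i (csin k) (fun th => (k 0 i)%:~R * ccos k th).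
Proof.
pose n : R := (k 0 i)%:~R.
have n0 := normr_ge0 n.
suff H : forall e : R, 0 < e -> exists2 del : R, 0 < del &
  forall h th, `|h| <= del -> forall a b, `|a| <= 1 -> `|b| <= 1 ->
    `|a * (cos (h * n) - 1) + b * (sin (h * n) - h * n)| <= e * `|h|.
  split => e e0; have [del del0 Hd] := H e e0; exists del => // h th hh.
    have -> : ccos k (th + h *: delta_mx 0 i) - ccos k th - h * (- n * csin k th) =
       ccos k th * (cos (h * n) - 1) + (- csin k th) * (sin (h * n) - h * n).
      by rewrite ccosD /ccos /csin dotvZr dotv_delta !mxE -/n; ring.
    by apply: (Hd _ th) => //; [exact: ccos_le1|rewrite normrN; exact: csin_le1].
  have -> : csin k (th + h *: delta_mx 0 i) - csin k th - h * (n * ccos k th) =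
       csin k th * (cos (h * n) - 1) + (ccos k th) * (sin (h * n) - h * n).
    by rewrite csinD /ccos /csin dotvZr dotv_delta !mxE -/n; ring.
  by apply: (Hd _ th) => //; [exact: csin_le1|exact: ccos_le1].
move=> e e0.
have N0 : 0 < 2 * (`|n| + 1) by rewrite mulr_gt0// ltr_wpDl.
have [del del0 Hd] := trig_small (divr_gt0 e0 N0).
exists (del / (`|n| + 1)); first by rewrite divr_gt0// ltr_wpDl.
move=> h th hh a b a1 b1.
have hn : `|h * n| <= del.
  rewrite normrM; move: hh; rewrite ler_pdivlMr ?ltr_wpDl// => /(le_trans _); apply.
  by rewrite ler_wpM2l // lerDl.
have [h1 h2] := Hd _ hn.
apply: le_trans (ler_normD _ _) _; rewrite !normrM.
apply: le_trans (lerD (ler_pM _ _ a1 h1) (ler_pM _ _ b1 h2)) _ => //.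
rewrite !mul1r normrM; set X := e / _ * _.
have -> : X + X = e * `|h| * (`|n| / (`|n| + 1)).
  by rewrite /X; field; rewrite gt_eqF // ltr_wpDl.
have eh : 0 <= e * `|h| by rewrite mulr_ge0 // ltW.
by rewrite ler_piMr // ler_pdivrMr ?mul1r ?lerDl// ltr_wpDl.
Qed.

(** By shift invariance the difference quotients of u have mean zero. *)
Lemma udiff_tmean0 i u v : torus_cont u -> torus_cont v -> udiff i u v -> tmean v = 0.
Proof.
move=> cu cv H; apply/eqP; rewrite -normr_eq0 eq_le normr_ge0 andbT.
apply/ler_addgt0Pr => e e0; rewrite add0r.
have [del del0 Hd] := H e e0.
have ndel : `|del| = del by rewrite gtr0_norm.
have cs := torus_cont_shift (del *: delta_mx 0 i) cu.
have : `|tmean (fun th => u (th + del *: delta_mx 0 i) - u th - del * v th)| <= e * del.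
  apply: tmean_bound.
    by apply: torus_contB; [exact: torus_contB|exact: torus_contZ].
  by move=> th; have := Hd del th; rewrite ndel; apply.
rewrite tmeanB; [|exact: torus_contB|exact: torus_contZ].
rewrite tmeanB// tmean_shift// subrr sub0r normrN tmeanZ// normrM ndel mulrC.
by rewrite ler_pM2r.
Qed.

(** Integration by parts: the derivatives of u cos and u sin have mean
    zero. *)
Lemma fpow_udiff i u v k : torus_cont u -> torus_cont v -> udiff i u v ->
  fpow v k = (k 0 i)%:~R ^+ 2 * fpow u k.
Proof.
move=> cu cv H; have [dc ds] := udiff_trig i k.
have cc := @torus_cont_ccos R d k; have cs := @torus_cont_csin R d k.
have ccn := torus_contZ (- (k 0 i)%:~R) cs; have csn := torus_contZ ((k 0 i)%:~R) cc.
have E1 := udiff_tmean0 (torus_contM cu cc) (torus_contD (torus_contM cv cc) (torus_contM cu ccn)) (udiffM cu cc cv ccn H dc).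
have E2 := udiff_tmean0 (torus_contM cu cs) (torus_contD (torus_contM cv cs) (torus_contM cu csn)) (udiffM cu cs cv csn H ds).
have F1 : fcos v k = (k 0 i)%:~R * fsin u k.
  apply/eqP; rewrite -subr_eq0 -mulNr -tmeanZ; last exact: torus_contM.
  rewrite -tmeanD; [|exact: torus_contM|by apply: torus_contZ; exact: torus_contM].
  by rewrite -[X in _ == X]E1; apply/eqP; congr tmean; apply/funext => th; ring.
have F2 : fsin v k = - (k 0 i)%:~R * fcos u k.
  apply/eqP; rewrite -subr_eq0 -mulNr opprK -tmeanZ; last exact: torus_contM.
  rewrite -tmeanD; [|exact: torus_contM|by apply: torus_contZ; exact: torus_contM].
  by rewrite -[X in _ == X]E2; apply/eqP; congr tmean; apply/funext => th; ring.
by rewrite /fpow F1 F2; ring.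
Qed.

End fourier.

(** * Density of trigonometric polynomials *)

Section trig.
Context {R : realType} {d : nat}.
Implicit Types (u v g : 'rV[R]_d -> R) (th : 'rV[R]_d) (k j : 'rV[int]_d).
Local Notation ccos := (@ccos R d).
Local Notation csin := (@csin R d).

(** Trigonometric polynomials, presented by generation: whatever is linear in
    the function can be proved for characters and extended by induction. *)
Inductive trig : ('rV[R]_d -> R) -> Prop :=
| trig_cos k : trig (ccos k)
| trig_sin k : trig (csin k)
| trig_add u v : trig u -> trig v -> trig (fun th => u th + v th)
| trig_scale (c : R) u : trig u -> trig (fun th => c * u th).

Lemma trig_torus_cont u : trig u -> torus_cont u.
Proof.
elim=> [k|k|{}u v _ cu _ cv|c {}u _ cu].
- exact: torus_cont_ccos.
- exact: torus_cont_csin.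
- exact: torus_contD.
- exact: torus_contZ.
Qed.

Lemma trig_cst (c : R) : trig (fun=> c).
Proof.
have -> : (fun=> c) = (fun th => c * ccos 0 th).
  by apply/funext => th; rewrite ccos0k mulr1.
exact/trig_scale/trig_cos.
Qed.

Lemma trig_lin (a b : R) u v : trig u -> trig v -> trig (fun th => a * u th + b * v th).
Proof. by move=> tu tv; apply: trig_add; apply: trig_scale. Qed.

Lemma trig_mul u v : trig u -> trig v -> trig (fun th => u th * v th).
Proof.
move=> tu tv; elim: tu v tv => [k|k|u1 u2 _ IH1 _ IH2|c {}u _ IH] v tv; last 2 first.
- have -> : (fun th => (u1 th + u2 th) * v th) = (fun th => u1 th * v th + u2 th * v th).
    by apply/funext => th; rewrite mulrDl.
  by apply: trig_add; [exact: IH1|exact: IH2].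
- have -> : (fun th => c * u th * v th) = (fun th => c * (u th * v th)).
    by apply/funext => th; rewrite mulrA.
  by apply: trig_scale; exact: IH.
- elim: tv => [j|j|v1 v2 _ IH1 _ IH2|c {}v _ IH].
  + have -> : (fun th => ccos k th * ccos j th) = (fun th => 2^-1 * ccos (k + j) th + 2^-1 * ccos (k - j) th).
      by apply/funext => th; rewrite !ccosDk ccosNk csinNk; field.
    by apply: trig_lin; exact: trig_cos.
  + have -> : (fun th => ccos k th * csin j th) = (fun th => 2^-1 * csin (k + j) th + (- 2^-1) * csin (k - j) th).
      by apply/funext => th; rewrite !csinDk ccosNk csinNk; field.
    by apply: trig_lin; exact: trig_sin.
  + have -> : (fun th => ccos k th * (v1 th + v2 th)) = (fun th => ccos k th * v1 th + ccos k th * v2 th).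
      by apply/funext => th; rewrite mulrDr.
    exact: trig_add.
  + have -> : (fun th => ccos k th * (c * v th)) = (fun th => c * (ccos k th * v th)).
      by apply/funext => th; rewrite mulrCA.
    exact: trig_scale.
- elim: tv => [j|j|v1 v2 _ IH1 _ IH2|c {}v _ IH].
  + have -> : (fun th => csin k th * ccos j th) = (fun th => 2^-1 * csin (k + j) th + 2^-1 * csin (k - j) th).
      by apply/funext => th; rewrite !csinDk ccosNk csinNk; field.
    by apply: trig_lin; exact: trig_sin.
  + have -> : (fun th => csin k th * csin j th) = (fun th => 2^-1 * ccos (k - j) th + (- 2^-1) * ccos (k + j) th).
      by apply/funext => th; rewrite !ccosDk ccosNk csinNk; field.
    by apply: trig_lin; exact: trig_cos.
  + have -> : (fun th => csin k th * (v1 th + v2 th)) = (fun th => csin k th * v1 th + csin k th * v2 th).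
      by apply/funext => th; rewrite mulrDr.
    exact: trig_add.
  + have -> : (fun th => csin k th * (c * v th)) = (fun th => c * (csin k th * v th)).
      by apply/funext => th; rewrite mulrCA.
    exact: trig_scale.
Qed.

Lemma trig_exp u n : trig u -> trig (fun th => u th ^+ n).
Proof.
move=> tu; elim: n => [|n IH]; first exact: trig_cst.
have -> : (fun th => u th ^+ n.+1) = (fun th => u th * u th ^+ n).
  by apply/funext => th; rewrite exprS.
exact: trig_mul.
Qed.

Definition conv g u th := tmean (fun ph => g ph * u (th - ph)).

Lemma conv_cos g k th : torus_cont g ->
  conv g (ccos k) th = fcos g k * ccos k th + fsin g k * csin k th.
Proof.
move=> cg; rewrite /conv.
have -> : (fun ph => g ph * ccos k (th - ph)) =
  (fun ph => ccos k th * (g ph * ccos k ph) + csin k th * (g ph * csin k ph)).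
  by apply/funext => ph; rewrite ccosD ccosN csinN; ring.
rewrite tmeanD ?tmeanZ; try (apply: torus_contZ);
  try exact: torus_cont_fcos; try exact: torus_cont_fsin.
by rewrite /fcos /fsin mulrC [X in _ + X]mulrC.
Qed.

Lemma conv_sin g k th : torus_cont g ->
  conv g (csin k) th = fcos g k * csin k th - fsin g k * ccos k th.
Proof.
move=> cg; rewrite /conv.
have -> : (fun ph => g ph * csin k (th - ph)) =
  (fun ph => csin k th * (g ph * ccos k ph) - ccos k th * (g ph * csin k ph)).
  by apply/funext => ph; rewrite csinD ccosN csinN; ring.
rewrite tmeanB ?tmeanZ; try (apply: torus_contZ);
  try exact: torus_cont_fcos; try exact: torus_cont_fsin.
by rewrite /fcos /fsin mulrC [X in _ - X]mulrC.
Qed.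

Lemma torus_cont_conv_integrand g u th : torus_cont g -> torus_cont u ->
  torus_cont (fun ph => g ph * u (th - ph)).
Proof. by move=> cg cu; apply: torus_contM => //; exact: torus_cont_reflect. Qed.

Lemma convD g u v th : torus_cont g -> torus_cont u -> torus_cont v ->
  conv g (fun ph => u ph + v ph) th = conv g u th + conv g v th.
Proof.
move=> cg cu cv; rewrite /conv -tmeanD; try exact: torus_cont_conv_integrand.
by congr tmean; apply/funext => ph; rewrite mulrDr.
Qed.

Lemma convZ g (c : R) u th : torus_cont g -> torus_cont u ->
  conv g (fun ph => c * u ph) th = c * conv g u th.
Proof.
move=> cg cu; rewrite /conv -tmeanZ; last exact: torus_cont_conv_integrand.
by congr tmean; apply/funext => ph; rewrite mulrCA.
Qed.

Lemma trig_conv g u : torus_cont g -> trig u -> trig (conv g u).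
Proof.
move=> cg; elim=> [k|k|{}u v tu IHu tv IHv|c {}u tu IH].
- have -> : conv g (ccos k) = (fun th => fcos g k * ccos k th + fsin g k * csin k th).
    by apply/funext => th; exact: conv_cos.
  by apply: trig_lin; [exact: trig_cos|exact: trig_sin].
- have -> : conv g (csin k) = (fun th => fcos g k * csin k th + (- fsin g k) * ccos k th).
    by apply/funext => th; rewrite conv_sin// mulNr.
  by apply: trig_lin; [exact: trig_sin|exact: trig_cos].
- have -> : conv g (fun th => u th + v th) = (fun th => conv g u th + conv g v th).
    by apply/funext => th; rewrite convD //; exact: trig_torus_cont.
  exact: trig_add.
- have -> : conv g (fun th => c * u th) = (fun th => c * conv g u th).
    by apply/funext => th; rewrite convZ //; exact: trig_torus_cont.
  exact: trig_scale.
Qed.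

Definition ei (i : 'I_d) : 'rV[int]_d := delta_mx 0 i.

Lemma ccos_ei i th : ccos (ei i) th = cos (th 0 i).
Proof.
rewrite /ccos /dotv (bigD1 i) //= big1 ?addr0; first by rewrite !mxE !eqxx mul1r.
by move=> l li; rewrite !mxE (negbTE li) andbF mul0r.
Qed.

(** A de la Vallee-Poussin kernel, left unnormalized. Its concentration at 0
    follows from shifts and derivatives alone, with no integral to evaluate. *)
Definition kern n (S : seq 'I_d) th := \prod_(i <- S) (1 + ccos (ei i) th) ^+ n.

Lemma kern_cons n i S th : kern n (i :: S) th = (1 + ccos (ei i) th) ^+ n * kern n S th.
Proof. by rewrite /kern big_cons. Qed.

Lemma trig_1Dcos i n : trig (fun th => (1 + ccos (ei i) th) ^+ n).
Proof. by apply/trig_exp/trig_add; [exact: trig_cst|exact: trig_cos]. Qed.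

Lemma trig_kern n S : trig (kern n S).
Proof.
elim: S => [|i S IH].
  have -> : kern n [::] = fun=> 1 by apply/funext => th; rewrite /kern big_nil.
  exact: trig_cst.
have -> : kern n (i :: S) = (fun th => (1 + ccos (ei i) th) ^+ n * kern n S th).
  by apply/funext => th; rewrite kern_cons.
by apply: trig_mul => //; exact: trig_1Dcos.
Qed.

Lemma onepcos_ge0 i th : 0 <= 1 + ccos (ei i) th.
Proof. by have := ccos_le1 (ei i) th; rewrite ler_norml => /andP[? _]; lra. Qed.

Lemma kern_ge0 n S th : 0 <= kern n S th.
Proof. by apply: prodr_ge0 => i _; rewrite exprn_ge0 // onepcos_ge0. Qed.

Lemma kern_even n S th : kern n S (- th) = kern n S th.
Proof. by apply: eq_bigr => i _; rewrite ccosN. Qed.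

(** The first order terms of the two Bernoulli inequalities cancel. *)
Lemma bernoulli_sum (c : R) n : -1 <= c -> c <= 1 -> 2 <= (1 + c) ^+ n + (1 - c) ^+ n.
Proof.
move=> c1 c2.
have B (x : R) m : -1 <= x -> 1 + m%:R * x <= (1 + x) ^+ m.
  move=> x1; elim: m => [|m IH]; first by rewrite mul0r addr0 expr0.
  rewrite exprS; apply: (@le_trans _ _ ((1 + x) * (1 + m%:R * x))).
    have : 0 <= m%:R * x ^+ 2 by rewrite mulr_ge0// sqr_ge0.
    by rewrite -natr1; lra.
  by apply: ler_wpM2l => //; lra.
have h1 := B c n c1; have h2 := B (- c) n; rewrite lerN2 in h2.
by have := h2 c2; lra.
Qed.

Lemma kern_shift n S i th : i \notin S ->
  kern n S (th + pi *: delta_mx 0 i) = kern n S th.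
Proof.
move=> iS; rewrite /kern big_seq [RHS]big_seq; apply: eq_bigr => l lS.
rewrite !ccos_ei !mxE eqxx /= (_ : (l == i) = false) ?mulr0 ?addr0//.
by apply/negbTE; apply: contraNneq iS => <-.
Qed.

(** Averaging over the shift by pi in one coordinate replaces the factor (1 +
    cos)^n by half of (1 + cos)^n + (1 - cos)^n, which is at least 1. *)
Lemma kern_mean_ge1 n S : uniq S -> 1 <= tmean (kern n S).
Proof.
elim: S => [|i S IH] /=.
  by rewrite (_ : kern n [::] = fun=> 1) ?tmean_cst//; apply/funext => th; rewrite /kern big_nil.
move=> /andP[iS uS]; apply: (le_trans (IH uS)).
have ck := trig_torus_cont (trig_kern n (i :: S)).
have ckS := trig_torus_cont (trig_kern n S).
pose w : 'rV[R]_d := pi *: delta_mx 0 i.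
have sh := tmean_shift w ck.
have cw := torus_cont_shift w ck.
have : tmean (fun th => 2 * kern n S th) <= tmean (fun th => kern n (i :: S) th + kern n (i :: S) (th + w)).
  apply: tmean_le; [exact: torus_contZ|exact: torus_contD|move=> th].
  rewrite !kern_cons kern_shift // !ccos_ei !mxE !eqxx mulr1 cosDpi -mulrDl.
  by apply: ler_wpM2r; [exact: kern_ge0|apply: bernoulli_sum; [exact: cos_geN1|exact: cos_le1]].
rewrite tmeanZ// tmeanD// sh; lra.
Qed.

Lemma udiffX i n u v : torus_cont u -> torus_cont v -> udiff i u v ->
  udiff i (fun th => u th ^+ n) (fun th => n%:R * u th ^+ n.-1 * v th) /\
  torus_cont (fun th => u th ^+ n).
Proof.
move=> cu cv H.
have cX m : torus_cont (fun th => u th ^+ m).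
  elim: m => [|m IH]; first exact: torus_cont_cst.
  have -> : (fun th => u th ^+ m.+1) = (fun th => u th * u th ^+ m).
    by apply/funext => th; rewrite exprS.
  exact: torus_contM.
split; last exact: cX.
elim: n => [|n IH].
  have -> : (fun th => 0%:R * u th ^+ 0.-1 * v th) = (fun=> 0).
    by apply/funext => th; rewrite mul0r mul0r.
  exact: udiff_cst.
have -> : (fun th => u th ^+ n.+1) = (fun th => u th * u th ^+ n).
  by apply/funext => th; rewrite exprS.
have -> : (fun th => n.+1%:R * u th ^+ n.+1.-1 * v th) =
  (fun th => v th * u th ^+ n + u th * (n%:R * u th ^+ n.-1 * v th)).
  apply/funext => th; rewrite -natr1; case: n IH => [|n] _ /=; first by rewrite expr0; ring.
  by rewrite exprS; ring.
apply: udiffM => //; apply: torus_contM => //; exact: torus_contZ.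
Qed.

Lemma udiff_1Dcos i l : udiff i (fun th => 1 + ccos (ei l) th)
  (fun th => - (i == l)%:R * csin (ei l) th).
Proof.
have [H _] := @udiff_trig R d i (ei l).
have := udiffD (udiff_cst (R:=R) i 1) H.
have -> // : (fun th => 0 + - ((ei l) 0 i)%:~R * csin (ei l) th) = (fun th => - (i == l)%:R * csin (ei l) th).
by apply/funext => th; rewrite add0r !mxE eqxx /=; case: (i == l).
Qed.

Lemma udiff_kern i n S : i \notin S -> udiff i (kern n S) (fun=> 0).
Proof.
elim: S => [_|l S IH].
  have -> : kern n [::] = fun=> 1 by apply/funext => th; rewrite /kern big_nil.
  exact: udiff_cst.
rewrite inE negb_or => /andP[il iS].
have c1 : torus_cont (fun th => 1 + ccos (ei l) th).
  by apply: torus_contD; [exact: torus_cont_cst|exact: torus_cont_ccos].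
have c2 : torus_cont (fun th => - (i == l)%:R * csin (ei l) th).
  by apply: torus_contZ; exact: torus_cont_csin.
have [H cH] := udiffX n c1 c2 (@udiff_1Dcos i l).
have E : (fun th => n%:R * (1 + ccos (ei l) th) ^+ n.-1 * (- (i == l)%:R * csin (ei l) th)) = fun=> 0.
  by apply/funext => th; rewrite (negbTE il) oppr0 mul0r mulr0.
rewrite E in H.
have := udiffM cH (trig_torus_cont (trig_kern n S)) (torus_cont_cst _ 0) (torus_cont_cst _ 0) H (IH iS).
have -> : (fun th => (1 + ccos (ei l) th) ^+ n * kern n S th) = kern n (l :: S).
  by apply/funext => th; rewrite kern_cons.
by under eq_fun do rewrite mul0r mulr0 addr0.
Qed.

(** With N = n + 1, the derivative of sin (1 + cos)^N is (cos - N (1 - cos))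
    (1 + cos)^N, and it has mean zero; hence N times the moment of 1 - cos is the
    moment of cos, which is at most the mass of the kernel. *)
Lemma kern_moment i n S : uniq S -> i \in S ->
  tmean (fun th => (1 - ccos (ei i) th) * kern n.+1 S th) <= n.+1%:R^-1 * tmean (kern n.+1 S).
Proof.
move=> uS iS; set S' := rem i S.
have iS' : i \notin S' by rewrite mem_rem_uniq // !inE eqxx.
have -> : kern n.+1 S = kern n.+1 (i :: S').
  by apply/funext => th; rewrite /kern (perm_big _ (perm_to_rem iS)).
have c1 : torus_cont (fun th => 1 + ccos (ei i) th).
  by apply: torus_contD; [exact: torus_cont_cst|exact: torus_cont_ccos].
have c2 : torus_cont (fun th => - (i == i)%:R * csin (ei i) th).
  by apply: torus_contZ; exact: torus_cont_csin.
have [H cH] := udiffX n.+1 c1 c2 (@udiff_1Dcos i i).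
have [_ cHn] := udiffX n c1 c2 (@udiff_1Dcos i i).
set K := kern n.+1 (i :: S').
have cK : torus_cont K by exact/trig_torus_cont/trig_kern.
have cdH : torus_cont (fun th => n.+1%:R * (1 + ccos (ei i) th) ^+ n.+1.-1 * (- (i == i)%:R * csin (ei i) th)).
  by apply: torus_contM => //; exact: torus_contZ.
have dK := udiffM cH (trig_torus_cont (trig_kern n.+1 S')) cdH (torus_cont_cst _ 0) H (udiff_kern n.+1 iS').
set dKf := (fun th => _ + _) in dK.
have KE : (fun th => (1 + ccos (ei i) th) ^+ n.+1 * kern n.+1 S' th) = K.
  by apply/funext => th; rewrite /K kern_cons.
rewrite KE in dK.
have cdK : torus_cont dKf.
  apply: torus_contD; apply: torus_contM => //; last exact: torus_cont_cst.
  exact/trig_torus_cont/trig_kern.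
have [_ ds] := @udiff_trig R d i (ei i).
have cs := @torus_cont_csin R d (ei i); have cc := @torus_cont_ccos R d (ei i).
have cds : torus_cont (fun th => (ei i 0 i)%:~R * ccos (ei i) th) by exact: torus_contZ.
have := udiff_tmean0 _ _ (udiffM cs cK cds cdK ds dK).
have -> : (fun th => (ei i 0 i)%:~R * ccos (ei i) th * K th + csin (ei i) th * dKf th) =
  (fun th => ccos (ei i) th * K th - n.+1%:R * ((1 - ccos (ei i) th) * K th)).
  apply/funext => th; rewrite !mxE !eqxx mul1r /dKf /= !eqxx mulr0 addr0 -KE exprS.
  have -> : csin (ei i) th * (n.+1%:R * (1 + ccos (ei i) th) ^+ n * (- 1 * csin (ei i) th) * kern n.+1 S' th) =
    - (csin (ei i) th ^+ 2) * (n.+1%:R * (1 + ccos (ei i) th) ^+ n * kern n.+1 S' th) by ring.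
  have -> : csin (ei i) th ^+ 2 = 1 - ccos (ei i) th ^+ 2.
    by rewrite -(ccos_csin_sqr (ei i) th); ring.
  by ring.
have cK2 : torus_cont (fun th => (1 - ccos (ei i) th) * K th).
  by apply: torus_contM => //; apply: torus_contB => //; exact: torus_cont_cst.
rewrite tmeanB ?tmeanZ; [|by []|exact: torus_contM|exact: torus_contZ].
move=> HH.
have {}HH := HH (torus_contM cs cK) (torus_contB (torus_contM cc cK) (torus_contZ n.+1%:R cK2)).
have le1 : tmean (fun th => ccos (ei i) th * K th) <= tmean K.
  apply: tmean_le => //; first exact: torus_contM.
  move=> th; rewrite ler_piMl ?kern_ge0//.
  by have := ccos_le1 (ei i) th; rewrite ler_norml => /andP[].
rewrite ler_pdivlMl ?ltr0n//; lra.
Qed.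

Lemma near_period_or_far (del : R) : 0 < del -> exists2 c : R, 0 < c &
  forall x : R, (exists n : int, `|x + (2 * pi) * n%:~R| <= del) \/ c <= 1 - cos x.
Proof.
move=> del0; pose dl := Num.min del 1.
have dl0 : 0 < dl by rewrite lt_min del0 ltr01.
have dl1 : dl <= 1 by rewrite ge_min lexx orbT.
have p2 : 2 <= pi :> R by exact: pi_ge2.
have ddl : dl \in `[0, pi] by rewrite in_itv/= ltW//=; lra.
have z0 : (0 : R) \in `[0, pi] by rewrite in_itv/= lexx /=; lra.
exists (1 - cos dl).
  by rewrite subr_gt0 -cos0 ltr_cos.
move=> x; pose n := Num.floor (x / (2 * pi) + 2^-1).
have p0 := @twopi_gt0 R.
pose y := x + (2 * pi) * (- n)%:~R.
have yx : cos y = cos x.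
  by rewrite /y periodic_int //; exact: cosD2pi.
have hy : `|y| <= pi.
  have := Num.Theory.floor_le_tmp (x / (2 * pi) + 2^-1).
  have := lt_succ_floor (x / (2 * pi) + 2^-1).
  rewrite -/n intrD => h1 h2.
  have xE : x = 2 * pi * (x / (2 * pi)) by rewrite mulrC divfK // gt_eqF.
  rewrite /y {1}xE mulrNz -mulrDr; set q := x / (2 * pi) in h1 h2 *.
  rewrite normrM gtr0_norm // -ler_pdivlMl //.
  have -> : (2 * pi)^-1 * pi = 2^-1 :> R by rewrite invfM -mulrA mulVf ?mulr1// gt_eqF// (lt_le_trans _ p2).
  rewrite ler_norml; apply/andP; split; lra.
have [h|h] := leP `|y| dl.
  by left; exists (- n); apply: le_trans h _; rewrite ge_min lexx.
right; rewrite -yx lerD2l lerN2.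
have cy : cos y = cos `|y| by case: (ler0P y) => _ //; rewrite cosN.
by rewrite cy ltW // ltr_cos// in_itv/= normr_ge0.
Qed.

(** The test functions 1 - cos control the oscillation of g. If some
    coordinate of ph - th is far from the periods, the corresponding 1 - cos is
    bounded below and C times it exceeds twice the sup norm of g; otherwise ph is
    close to th modulo the lattice. *)
Lemma korovkin_bound g (e : R) : torus_cont g -> 0 < e -> exists2 C : R, 0 <= C &
  forall th ph, `|g ph - g th| <= e + C * \sum_i (1 - ccos (ei i) (ph - th)).
Proof.
move=> cg e0; have [M M0 HM] := torus_cont_bounded cg.
have [pg /(_ e e0)[del del0 Hd]] := cg.
have [c c0 Hc] := near_period_or_far del0.
exists (2 * M / c); first by rewrite divr_ge0 ?mulr_ge0// ltW.
move=> th ph.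
have t0 i : 0 <= 1 - ccos (ei i) (ph - th).
  by have := ccos_le1 (ei i) (ph - th); rewrite ler_norml => /andP[_ ?]; lra.
have [[i hi]|H] := pselect (exists i, c <= 1 - ccos (ei i) (ph - th)).
  apply: (@le_trans _ _ (2 * M)).
    by apply: le_trans (ler_normB _ _) _; rewrite mulr_natl mulr2n lerD.
  apply: (@le_trans _ _ (2 * M / c * (1 - ccos (ei i) (ph - th)))).
    rewrite -[leLHS]mulr1 -[X in _ <= X]mulrA ler_wpM2l ?mulr_ge0//.
    by rewrite ler_pdivlMl // mulr1.
  rewrite -[leLHS]add0r; apply: lerD; first exact: ltW.
  apply: ler_wpM2l; first by rewrite divr_ge0 ?mulr_ge0// ltW.
  by rewrite (bigD1 i) //= lerDl sumr_ge0.
have K i : exists n : int, `|(ph - th) 0 i + (2 * pi) * n%:~R| <= del.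
  have [//|h] := Hc ((ph - th) 0 i).
  by exfalso; apply: H; exists i; rewrite ccos_ei.
have [n Hn] := choice K.
rewrite -(pg (\row_i n i) ph); apply: (@le_trans _ _ e).
  by apply: Hd => i; have := Hn i; rewrite !mxE addrAC.
by rewrite lerDl mulr_ge0 ?sumr_ge0// divr_ge0 ?mulr_ge0// ltW.
Qed.

Definition vp_kernel n : 'rV[R]_d -> R := kern n (enum 'I_d).

Lemma vp_kernel_mean_ge1 n : 1 <= tmean (vp_kernel n).
Proof. by apply: kern_mean_ge1; exact: enum_uniq. Qed.

Lemma tmean_norm_le g u : torus_cont g -> torus_cont u ->
  (forall th, `|g th| <= u th) -> `|tmean g| <= tmean u.
Proof.
move=> cg cu H; rewrite ler_norml; apply/andP; split.
  rewrite -mulN1r -tmeanZ//; apply: tmean_le => //; first exact: torus_contZ.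
  by move=> th; have := H th; rewrite ler_norml mulN1r => /andP[].
by apply: tmean_le => // th; have := H th; rewrite ler_norml => /andP[].
Qed.

Lemma vp_kernel_approx g (e : R) : torus_cont g -> 0 < e -> exists n, forall th,
  `|conv g (vp_kernel n) th - tmean (vp_kernel n) * g th| <= e * tmean (vp_kernel n).
Proof.
move=> cg e0; have e20 : 0 < e / 2 by rewrite divr_gt0.
have [C C0 HC] := korovkin_bound cg e20.
pose n := Num.bound (2 * C * d%:R / e).
exists n.+1 => th.
set K := vp_kernel n.+1.
have cK : torus_cont K by exact/trig_torus_cont/trig_kern.
have K0 ph : 0 <= K ph by exact: kern_ge0.
have cKr : torus_cont (fun ph => K (th - ph)) by exact: torus_cont_reflect.
have KE ph : K (th - ph) = K (ph - th) by rewrite /K /vp_kernel -kern_even opprB.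
have cKs : torus_cont (fun ph => K (ph - th)) by exact: torus_cont_shift.
have mK : tmean (fun ph => K (ph - th)) = tmean K by exact: tmean_shift.
have -> : conv g K th - tmean K * g th = tmean (fun ph => (g ph - g th) * K (ph - th)).
  rewrite /conv -mK [X in _ - X]mulrC -tmeanZ // -tmeanB; last 2 first.
  - exact: torus_contM.
  - exact: torus_contZ.
  by congr tmean; apply/funext => ph; rewrite KE mulrBl.
pose B ph := (e / 2) * K ph + \sum_(i : 'I_d) C * ((1 - ccos (ei i) ph) * K ph).
have c1 i : torus_cont (fun ph => (1 - ccos (ei i) ph) * K ph).
  apply: torus_contM => //; apply: torus_contB; [exact: torus_cont_cst|exact: torus_cont_ccos].
have c2 : torus_cont (fun ph => \sum_(i : 'I_d) C * ((1 - ccos (ei i) ph) * K ph)).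
  by apply: torus_cont_sum => i; exact: torus_contZ.
have cB : torus_cont B by apply: torus_contD => //; exact: torus_contZ.
apply: (@le_trans _ _ (tmean (fun ph => B (ph - th)))).
  apply: tmean_norm_le.
  - by apply: torus_contM => //; apply: torus_contB => //; exact: torus_cont_cst.
  - exact: torus_cont_shift.
  - move=> ph; rewrite normrM (ger0_norm (K0 _)).
    apply: le_trans (ler_wpM2r (K0 _) (HC th ph)) _.
    by rewrite /B mulrDl mulr_sumr mulr_suml lerD2l; apply: ler_sum => i _; rewrite mulrA.
rewrite tmean_shift // /B tmeanD //; last exact: torus_contZ.
rewrite tmeanZ // tmean_sum; last by move=> i; exact: torus_contZ.
have -> : e * tmean K = e / 2 * tmean K + e / 2 * tmean K by field.
rewrite lerD2l.
apply: (@le_trans _ _ (\sum_(i : 'I_d) C * (n.+1%:R^-1 * tmean K))).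
  apply: ler_sum => i _; rewrite tmeanZ //; apply: ler_wpM2l => //.
  by apply: kern_moment; [exact: enum_uniq|rewrite mem_enum].
rewrite sumr_const card_ord.
have -> : C * (n.+1%:R^-1 * tmean K) *+ d = (d%:R * C) / n.+1%:R * tmean K.
  by rewrite -[LHS]mulr_natl; ring.
apply: ler_wpM2r.
  by apply: le_trans (vp_kernel_mean_ge1 n.+1).
rewrite ler_pdivrMr ?ltr0n//.
have := archi_boundP (x := 2 * C * d%:R / e).
have -> : 0 <= 2 * C * d%:R / e.
  by apply: divr_ge0; [apply: mulr_ge0 => //; exact: mulr_ge0|exact: ltW].
move=> /(_ isT).
rewrite -/n ltr_pdivrMr// => hn.
have -> : n.+1%:R = n%:R + 1 :> R by rewrite -natr1.
by move: hn; lra.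
Qed.

(** The convolution of g with a trigonometric polynomial involves only the
    Fourier coefficients of g; for the kernels it is, after normalization, close
    to g. *)
Lemma fourier_uniqueness g : torus_cont g ->
  (forall k, fcos g k = 0 /\ fsin g k = 0) -> forall th, g th = 0.
Proof.
move=> cg H th; apply/eqP; rewrite -normr_eq0 eq_le normr_ge0 andbT.
apply/ler_addgt0Pr => e e0; rewrite add0r.
have [n /(_ th) Hn] := vp_kernel_approx cg e0.
have Z u : trig u -> conv g u th = 0.
  elim=> [k|k|{}u v tu IHu tv IHv|c {}u tu IH].
  - by have [h1 h2] := H k; rewrite conv_cos // h1 h2 !mul0r addr0.
  - by have [h1 h2] := H k; rewrite conv_sin // h1 h2 !mul0r subr0.
  - by rewrite convD ?IHu ?IHv ?addr0//; exact: trig_torus_cont.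
  - by rewrite convZ ?IH ?mulr0//; exact: trig_torus_cont.
have c1 := vp_kernel_mean_ge1 n; have c0 := lt_le_trans ltr01 c1.
move: Hn; rewrite Z; last exact: trig_kern.
by rewrite sub0r normrN normrM gtr0_norm // mulrC ler_pM2r.
Qed.

Lemma trig_dense g (e : R) : torus_cont g -> 0 < e ->
  exists2 u, trig u & forall th, `|g th - u th| <= e.
Proof.
move=> cg e0; have [n Hn] := vp_kernel_approx cg e0.
have c0 := lt_le_trans ltr01 (vp_kernel_mean_ge1 n).
exists (fun th => (tmean (vp_kernel n))^-1 * conv g (vp_kernel n) th).
  by apply/trig_scale/trig_conv => //; exact: trig_kern.
set c := tmean _ in c0 Hn *.
move=> th; have -> : g th - c^-1 * conv g (vp_kernel n) th = - (c^-1 * (conv g (vp_kernel n) th - c * g th)).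
  by field; rewrite gt_eqF.
by rewrite normrN normrM gtr0_norm ?invr_gt0// ler_pdivrMl// [c * e]mulrC; exact: Hn.
Qed.

(** Fourier inversion over every finite set of frequencies that is large
    enough: the freedom in the set allows the expansions of two summands to be
    added. *)
Lemma trig_fourier u : trig u -> exists S0 : seq 'rV[int]_d,
  forall S, uniq S -> {subset S0 <= S} -> forall th,
  u th = \sum_(k <- S) (fcos u k * ccos k th + fsin u k * csin k th).
Proof.
elim=> [j|j|{}u v tu [S1 H1] tv [S2 H2]|c {}u tu [S1 H1]].
- exists [:: j; - j] => S uS sS th.
  have jS : j \in S by apply: sS; rewrite inE eqxx.
  have njS : - j \in S by apply: sS; rewrite !inE eqxx orbT.
  have fc k : fcos (ccos j) k = 2^-1 * (k == j)%:R + 2^-1 * (k == - j)%:R.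
    rewrite /fcos; have -> : (fun th => ccos j th * ccos k th) = (fun th => 2^-1 * ccos (k - j) th + 2^-1 * ccos (k + j) th).
      by apply/funext => ph; rewrite !ccosDk ccosNk csinNk; field.
    rewrite tmeanD ?tmeanZ ?tmean_ccos ?subr_eq0 ?addr_eq0//;
      by try (apply: torus_contZ); exact: torus_cont_ccos.
  have fs k : fsin (ccos j) k = 0.
    rewrite /fsin; have -> : (fun th => ccos j th * csin k th) = (fun th => 2^-1 * csin (k - j) th + 2^-1 * csin (k + j) th).
      by apply/funext => ph; rewrite !csinDk ccosNk csinNk; field.
    rewrite tmeanD ?tmeanZ ?tmean_csin ?mulr0 ?addr0//;
      by try (apply: torus_contZ); exact: torus_cont_csin.
  rewrite (eq_bigr (fun k => (k == j)%:R * (2^-1 * ccos k th) + (k == - j)%:R * (2^-1 * ccos k th))); last first.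
    by move=> k _; rewrite fc fs mul0r addr0; ring.
  rewrite big_split /= (bigD1_seq j) //= [X in _ + X](bigD1_seq (- j)) //= !eqxx !mul1r ccosNk.
  rewrite !big1 ?addr0 => [|k /negbTE->|k /negbTE->]; rewrite ?mul0r//; by field.
- exists [:: j; - j] => S uS sS th.
  have jS : j \in S by apply: sS; rewrite inE eqxx.
  have njS : - j \in S by apply: sS; rewrite !inE eqxx orbT.
  have fs k : fsin (csin j) k = 2^-1 * (k == j)%:R - 2^-1 * (k == - j)%:R.
    rewrite /fsin; have -> : (fun th => csin j th * csin k th) = (fun th => 2^-1 * ccos (k - j) th - 2^-1 * ccos (k + j) th).
      by apply/funext => ph; rewrite !ccosDk ccosNk csinNk; field.
    rewrite tmeanB ?tmeanZ ?tmean_ccos ?subr_eq0 ?addr_eq0//;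
      by try (apply: torus_contZ); exact: torus_cont_ccos.
  have fc k : fcos (csin j) k = 0.
    rewrite /fcos; have -> : (fun th => csin j th * ccos k th) = (fun th => 2^-1 * csin (k + j) th - 2^-1 * csin (k - j) th).
      by apply/funext => ph; rewrite !csinDk ccosNk csinNk; field.
    rewrite tmeanB ?tmeanZ ?tmean_csin ?mulr0 ?subr0//;
      by try (apply: torus_contZ); exact: torus_cont_csin.
  rewrite (eq_bigr (fun k => (k == j)%:R * (2^-1 * csin k th) + (k == - j)%:R * (- 2^-1 * csin k th))); last first.
    by move=> k _; rewrite fc fs mul0r add0r; ring.
  rewrite big_split /= (bigD1_seq j) //= [X in _ + X](bigD1_seq (- j)) //= !eqxx !mul1r csinNk.
  rewrite !big1 ?addr0 => [|k /negbTE->|k /negbTE->]; rewrite ?mul0r//; by field.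
- exists (S1 ++ S2) => S uS sS th.
  have cu := trig_torus_cont tu; have cv := trig_torus_cont tv.
  rewrite (H1 S uS) ?(H2 S uS) -?big_split; last 2 first.
  + by move=> k kS; apply: sS; rewrite mem_cat kS orbT.
  + by move=> k kS; apply: sS; rewrite mem_cat kS.
  apply: eq_bigr => k _ /=.
  have -> : fcos (fun th => u th + v th) k = fcos u k + fcos v k.
    rewrite /fcos -tmeanD; try exact: torus_cont_fcos.
    by congr tmean; apply/funext => ph; rewrite mulrDl.
  have -> : fsin (fun th => u th + v th) k = fsin u k + fsin v k.
    rewrite /fsin -tmeanD; try exact: torus_cont_fsin.
    by congr tmean; apply/funext => ph; rewrite mulrDl.
  ring.
- exists S1 => S uS sS th.
  have cu := trig_torus_cont tu.
  rewrite (H1 S uS) // mulr_sumr; apply: eq_bigr => k _ /=.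
  have -> : fcos (fun th => c * u th) k = c * fcos u k.
    rewrite /fcos -tmeanZ; last exact: torus_cont_fcos.
    by congr tmean; apply/funext => ph; rewrite mulrA.
  have -> : fsin (fun th => c * u th) k = c * fsin u k.
    rewrite /fsin -tmeanZ; last exact: torus_cont_fsin.
    by congr tmean; apply/funext => ph; rewrite mulrA.
  ring.
Qed.

(** The modulus of the coefficient is the mean of u against a rotated
    character, whose values are at most 1. *)
Lemma fpow_le_mean u k : torus_cont u -> (forall th, 0 <= u th) ->
  Num.sqrt (fpow u k) <= tmean u.
Proof.
move=> cu u0; set r := Num.sqrt _.
have m0 : 0 <= tmean u.
  rewrite -(tmean_cst (d := d) 0); apply: tmean_le => //; exact: torus_cont_cst.
have r2 : r ^+ 2 = fpow u k by rewrite sqr_sqrtr // fpow_ge0.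
have [->//|r0] := eqVneq r 0.
have rp : 0 < r by rewrite lt_neqAle eq_sym r0 sqrtr_ge0.
rewrite -(ler_pM2r rp) -expr2 r2.
have -> : fpow u k = tmean (fun th => fcos u k * (u th * ccos k th) + fsin u k * (u th * csin k th)).
  rewrite tmeanD ?tmeanZ ?expr2//; try (apply: torus_contZ);
    try exact: torus_cont_fcos; try exact: torus_cont_fsin.
rewrite mulrC -tmeanZ //; apply: tmean_le.
- by apply: torus_contD; apply: torus_contZ; [exact: torus_cont_fcos|exact: torus_cont_fsin].
- exact: torus_contZ.
move=> th; have -> : fcos u k * (u th * ccos k th) + fsin u k * (u th * csin k th) =
  (fcos u k * ccos k th + fsin u k * csin k th) * u th by ring.
apply: ler_wpM2r => //; apply: le_trans (ler_norm _) _.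
rewrite -sqrtr_sqr ler_wsqrtr// /fpow -subr_ge0.
have -> : fcos u k ^+ 2 + fsin u k ^+ 2 - (fcos u k * ccos k th + fsin u k * csin k th) ^+ 2 =
  (fcos u k * csin k th - fsin u k * ccos k th) ^+ 2 +
  (fcos u k ^+ 2 + fsin u k ^+ 2) * (1 - (ccos k th ^+ 2 + csin k th ^+ 2)) by ring.
by rewrite ccos_csin_sqr subrr mulr0 addr0 sqr_ge0.
Qed.

(** The coefficients of the nonnegative kernel are at most its mean, so the
    convolution with g is bounded by the mean of the kernel times the sum of the
    moduli for g. Since g is the uniform limit of normalized convolutions, the
    convergence of its Fourier series does not enter. *)
Lemma sup_le_fourier_sum g (B : R) : torus_cont g ->
  (forall S, uniq S -> \sum_(k <- S) Num.sqrt (fpow g k) <= B) ->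
  forall th, `|g th| <= B.
Proof.
move=> cg HB th; apply/ler_addgt0Pr => e e0.
have [n /(_ th) Hn] := vp_kernel_approx cg e0.
have c1 := vp_kernel_mean_ge1 n; have c0 := lt_le_trans ltr01 c1.
have tK : trig (vp_kernel n) := trig_kern n (enum 'I_d).
have cK := trig_torus_cont tK.
suff h : `|conv g (vp_kernel n) th| <= tmean (vp_kernel n) * B.
  rewrite -(ler_pM2l c0) mulrDr -[X in X * `|_|]gtr0_norm // -normrM.
  set a := conv _ _ _ in Hn h; set c := tmean _ in Hn h *.
  have -> : c * g th = a - (a - c * g th) by ring.
  by apply: le_trans (ler_normB _ _) _; rewrite [c * e]mulrC; apply: lerD.
have [S0 HS0] := trig_fourier tK.
pose S := undup S0.
have uS : uniq S by exact: undup_uniq.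
have sS : {subset S0 <= S} by move=> k; rewrite mem_undup.
have E := HS0 S uS sS.
have -> : conv g (vp_kernel n) th = \sum_(k <- S) (fcos (vp_kernel n) k * conv g (ccos k) th + fsin (vp_kernel n) k * conv g (csin k) th).
  have cc k : torus_cont (fun ph => g ph * ccos k (th - ph)).
    by apply: torus_cont_conv_integrand => //; exact: torus_cont_ccos.
  have cs k : torus_cont (fun ph => g ph * csin k (th - ph)).
    by apply: torus_cont_conv_integrand => //; exact: torus_cont_csin.
  rewrite {1}/conv.
  have -> : (fun ph => g ph * vp_kernel n (th - ph)) = (fun ph => \sum_(k <- S)
     (fcos (vp_kernel n) k * (g ph * ccos k (th - ph)) + fsin (vp_kernel n) k * (g ph * csin k (th - ph)))).
    by apply/funext => ph; rewrite {1}E mulr_sumr; apply: eq_bigr => k _; ring.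
  rewrite tmean_sum; last by move=> k; apply: torus_contD; exact: torus_contZ.
  apply: eq_bigr => k _; rewrite tmeanD ?tmeanZ//; exact: torus_contZ.
apply: le_trans (ler_norm_sum _ _ _) _.
apply: (@le_trans _ _ (\sum_(k <- S) tmean (vp_kernel n) * Num.sqrt (fpow g k))); last first.
  by rewrite -mulr_sumr ler_wpM2l ?HB // ltW.
apply: ler_sum => k _.
apply: (@le_trans _ _ (Num.sqrt (fpow (vp_kernel n) k) * Num.sqrt (fpow g k))); last first.
  apply: ler_wpM2r; first exact: sqrtr_ge0.
  by apply: fpow_le_mean => // ph; exact: kern_ge0.
rewrite conv_cos // conv_sin // -sqrtrM ?fpow_ge0// -sqrtr_sqr ler_wsqrtr// /fpow.
set a := fcos (vp_kernel n) k; set b := fsin (vp_kernel n) k; set p := fcos g k; set q := fsin g k.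
set c := ccos k th; set s := csin k th.
have cs : c ^+ 2 + s ^+ 2 = 1 by exact: ccos_csin_sqr.
rewrite -subr_ge0.
have -> : (a ^+ 2 + b ^+ 2) * (p ^+ 2 + q ^+ 2) - (a * (p * c + q * s) + b * (p * s - q * c)) ^+ 2 =
  (a * (p * s - q * c) - b * (p * c + q * s)) ^+ 2 +
  (a ^+ 2 + b ^+ 2) * (p ^+ 2 + q ^+ 2) * (1 - (c ^+ 2 + s ^+ 2)) by ring.
by rewrite cs subrr mulr0 addr0 sqr_ge0.
Qed.

End trig.

(** * Lattice sums and the Sobolev embedding *)

Section lattice.
Context {R : realType} {d : nat}.
Implicit Types (k : 'rV[int]_d) (S : seq 'rV[int]_d).

Definition weight (m : nat) k : R := ((normZ1 k ^ 2 + 1) ^ m)%N%:R.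

Lemma weight_gt0 m k : 0 < weight m k.
Proof. by rewrite ltr0n expn_gt0 addn1. Qed.

Lemma coord_le_normZ1 k i : (`|k ord0 i| <= normZ1 k)%N.
Proof. by rewrite /normZ1 (bigD1 i) //= leq_addr. Qed.

Lemma count_box (M : nat) S : (0 < M)%N -> uniq S ->
  (forall k, k \in S -> (normZ1 k < M)%N) -> (size S <= (M * 2) ^ d)%N.
Proof.
move=> M0 uS H.
pose N := (M * 2).-1; have NE : N.+1 = (M * 2)%N by rewrite /N; lia.
pose F k : {ffun 'I_d -> 'I_N.+1} := [ffun i => inord `|(k 0 i + M%:Z)%R|%N].
have injF : {in S &, injective F}.
  move=> k k' kS k'S /ffunP E; apply/rowP => i.
  have := E i; rewrite !ffunE => /(congr1 val) /=.
  have a1 := coord_le_normZ1 k i; have a2 := H k kS.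
  have b1 := coord_le_normZ1 k' i; have b2 := H k' k'S.
  rewrite (_ : ord0 = 0 :> 'I_1) in a1 b1; last exact/val_inj.
  by rewrite !inordK ?NE; lia.
have := max_card (mem (map F S)).
rewrite (card_uniqP _); last by rewrite map_inj_in_uniq.
by rewrite size_map card_ffun !card_ord NE.
Qed.

(** Dyadic shells: at scale n there are at most (4 2^n)^d frequencies, each
    of weight at least 2^(2 m n) / 2^m, and 2 m > d makes the sum over n
    geometric. *)
Lemma lattice_sum (m : nat) : (d < 2 * m)%N ->
  exists2 C : R, 0 <= C & forall S, uniq S -> \sum_(k <- S) (weight m k)^-1 <= C.
Proof.
move=> dm.
pose r k := trunc_log 2 (normZ1 k).+1.
have rP k : (2 ^ r k <= (normZ1 k).+1 < 2 ^ (r k).+1)%N by exact: trunc_log_bounds.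
pose c : R := 2 ^+ m * 2 ^+ (2 * d).
have c0 : 0 <= c by rewrite mulr_ge0 // exprn_ge0.
exists (c * 2) => [|S uS]; first exact: mulr_ge0.
pose f (n : nat) : R := 2 ^+ m * (2 ^+ (2 * m * n))^-1.
have wf k : (weight m k)^-1 <= f (r k).
  have /andP[h _] := rP k.
  rewrite /f -[X in X * _]invrK -invfM lef_pV2 ?posrE ?weight_gt0//.
  rewrite mulrC ler_pdivrMr ?exprn_gt0// /weight -!natrX -natrM ler_nat.
  rewrite [(2 * m * r k)%N]mulnAC expnM -expnMn leq_exp2r; last by lia.
  rewrite mulnC expnM.
  have : ((2 ^ r k) ^ 2 <= (normZ1 k).+1 ^ 2)%N by rewrite leq_exp2r.
  by move=> h2; apply: leq_trans h2 _; nia.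
apply: (@le_trans _ _ (\sum_(k <- S) f (r k))); first exact: ler_sum.
pose B := (\max_(k <- S) r k).+1.
have E : \sum_(k <- S) f (r k) = \sum_(n < B) \sum_(k <- S | r k == n) f n.
  rewrite (exchange_big_dep xpredT) //= big_seq [RHS]big_seq.
  apply: eq_bigr => k kS.
  have rB : (r k < B)%N by rewrite ltnS; exact: (@leq_bigmax_seq _ S xpredT r).
  rewrite (bigD1 (Ordinal rB)) //= big1 ?addr0// => n /andP[/eqP rn /eqP nn].
  by exfalso; apply: nn; apply/val_inj; rewrite /= rn.
rewrite E.
apply: (@le_trans _ _ (\sum_(n < B) c * 2^-1 ^+ n)).
  apply: ler_sum => n _.
  rewrite -big_filter big_const_seq count_predT iter_addr_0.
  have sz : (size [seq k <- S | r k == n] <= (2 ^ n.+1 * 2) ^ d)%N.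
    apply: count_box; [by rewrite expn_gt0|exact: filter_uniq|].
    move=> k; rewrite mem_filter => /andP[/eqP rn _].
    by have /andP[_] := rP k; rewrite rn; lia.
  apply: (@le_trans _ _ (((2 ^ n.+1 * 2) ^ d)%N%:R * f n)).
    rewrite -[leLHS]mulr_natl; apply: ler_wpM2r; last by rewrite ler_nat.
    by rewrite /f mulr_ge0 ?invr_ge0 ?exprn_ge0.
  rewrite /f /c mulrCA -!mulrA ler_wpM2l ?exprn_ge0// exprVn.
  rewrite ler_pdivrMr ?exprn_gt0//.
  have -> : 2 ^+ (2 * d) * 2 ^- n * 2 ^+ (2 * m * n) = 2 ^+ (2 * d) * 2 ^+ (2 * m * n) / 2 ^+ n :> R by ring.
  rewrite ler_pdivlMr ?exprn_gt0// -!natrX -!natrM ler_nat.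
  have -> : ((2 ^ n.+1 * 2) ^ d = 2 ^ (n * d + 2 * d))%N.
    by rewrite -[X in (_ * X)%N]expn1 -expnD -expnM; congr expn; lia.
  by rewrite -!expnD leq_exp2l //; nia.
rewrite -mulr_sumr ler_wpM2l//.
have : \sum_(n < B) (2^-1 : R) ^+ n = (1 - 2^-1 ^+ B) * 2.
  have := subrX1 (2^-1 : R) B; rewrite -[X in _ = _ * X](big_mkord xpredT) big_mkord.
  by move: (\sum_(_ < _) _) (_ ^+ B) => s1 t1; clear; lra.
move=> ->.
have : 0 <= (2^-1 : R) ^+ B by rewrite exprn_ge0// invr_ge0.
by move: (_ ^+ B) => t1; clear; lra.
Qed.

Lemma Hm_norm_ub m (V : 'rV[R]_d -> R) (B : R) : 0 <= B ->
  (forall S, uniq S -> \sum_(k <- S) fpow V k * weight m k <= B ^+ 2) ->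
  (Hm_norm m V <= B%:E)%E.
Proof.
move=> B0 H; rewrite /Hm_norm.
have -> : B%:E = sqrte (B ^+ 2)%:E by rewrite /= sqrtr_sqr ger0_norm.
rewrite lee_sqrt; last by rewrite lee_fin sqr_ge0.
apply: ge_ereal_sup => _ [X [finX _] <-].
rewrite fsbig_finite //= sumEFin lee_fin.
under eq_bigr do rewrite normc_fourier_coef.
by apply: H; exact: finmap.fset_uniq.
Qed.

Lemma Hm_norm_lb m (V : 'rV[R]_d -> R) (B : R) : 0 <= B -> (Hm_norm m V <= B%:E)%E ->
  forall S, uniq S -> \sum_(k <- S) fpow V k * weight m k <= B ^+ 2.
Proof.
move=> B0 + S uS; rewrite /Hm_norm.
have -> : B%:E = sqrte (B ^+ 2)%:E by rewrite /= sqrtr_sqr ger0_norm.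
rewrite lee_sqrt; last by rewrite lee_fin sqr_ge0.
rewrite -lee_fin; apply: le_trans; apply: esum_ge.
exists [set` S]; first by split => //; exact: finite_seq.
rewrite -fsbig_seq // -sumEFin; apply: lee_sum => k _.
by rewrite normc_fourier_coef.
Qed.

(** The Cauchy-Schwarz inequality in Young's form sqrt p <= p w / A + A / w,
    summed; the constant is C + 1 instead of the square root of C. *)
Lemma sum_sqrt_cauchy (I : Type) (S : seq I) (p w : I -> R) (A C : R) :
  0 <= A -> 0 <= C -> (forall x, 0 <= p x) -> (forall x, 0 < w x) ->
  \sum_(k <- S) p k * w k <= A ^+ 2 -> \sum_(k <- S) (w k)^-1 <= C ->
  \sum_(k <- S) Num.sqrt (p k) <= A * (C + 1).
Proof.
move=> A0 C0 p0 w0 H1 H2.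
have [AZ|An0] := eqVneq A 0.
  have : \sum_(k <- S) Num.sqrt (p k) = 0; last by move=> ->; rewrite AZ mul0r.
  have Z : \sum_(k <- S) p k * w k = 0.
    apply/eqP; rewrite eq_le; apply/andP; split; first by rewrite AZ expr0n in H1.
    by apply: sumr_ge0 => k _; rewrite mulr_ge0// ltW.
  move: Z; rewrite {H1 H2}; elim: S => [|k S IH]; first by rewrite !big_nil.
  rewrite !big_cons => /eqP; rewrite paddr_eq0; last 2 first.
  - by rewrite mulr_ge0 // ltW.
  - by apply: sumr_ge0 => l _; rewrite mulr_ge0// ltW.
  move=> /andP[/eqP h /eqP /IH ->]; rewrite addr0.
  move/eqP: h; rewrite mulf_eq0 (gt_eqF (w0 k)) orbF => /eqP ->.
  exact: sqrtr0.
have Ap : 0 < A by rewrite lt_neqAle eq_sym An0.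
apply: (@le_trans _ _ (\sum_(k <- S) (A^-1 * (p k * w k) + A * (w k)^-1))).
  apply: ler_sum => k _.
  set s := Num.sqrt (p k); have s0 : 0 <= s by exact: sqrtr_ge0.
  have -> : p k = s ^+ 2 by rewrite sqr_sqrtr.
  have wk := w0 k.
  have : 0 <= (s * w k - A) ^+ 2 + s * w k * A by rewrite addr_ge0 ?sqr_ge0// !mulr_ge0// ltW.
  rewrite -subr_ge0.
  have -> : A^-1 * (s ^+ 2 * w k) + A * (w k)^-1 - s = ((s * w k - A) ^+ 2 + s * w k * A) / (A * w k).
    by field; rewrite !gt_eqF.
  by move=> h; rewrite divr_ge0// mulr_ge0// ltW.
rewrite big_split /= -!mulr_sumr.
have : A^-1 * (\sum_(k <- S) p k * w k) <= A.
  by rewrite ler_pdivrMl // -expr2.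
have : A * (\sum_(k <- S) (w k)^-1) <= A * C by rewrite ler_wpM2l.
lra.
Qed.

Lemma sobolev_sup m : (d < 2 * m)%N -> exists2 C : R, 0 < C &
  forall (V : 'rV[R]_d -> R) (B : R), torus_cont V -> 0 <= B -> (Hm_norm m V <= B%:E)%E ->
    forall th, `|V th| <= C * B.
Proof.
move=> dm; have [C C0 HC] := lattice_sum dm.
exists (C + 1); first by rewrite ltr_wpDl.
move=> V B cV B0 HV; apply: sup_le_fourier_sum => // S uS.
rewrite mulrC; apply: (@sum_sqrt_cauchy _ S _ (weight m)) => //.
- by move=> k; exact: fpow_ge0.
- by move=> k; exact: weight_gt0.
- exact: Hm_norm_lb.
- exact: HC.
Qed.

End lattice.

(** * Directional bounds on derivatives and the chain rule *)

Section Cb.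
Context {R : realType} {d : nat}.
Implicit Types (u v g : 'rV[R]_d -> R) (th : 'rV[R]_d) (k : 'rV[int]_d) (i : 'I_d) (B : R).

(** Only derivatives in the single coordinate i. Such bounds in each
    coordinate control the H^m norm, since the weight of a frequency k is
    dominated by 1 and the pure powers k_i^(2 m); mixed derivatives in th do not
    arise. *)
Fixpoint Cb i (j : nat) B u : Prop :=
  [/\ torus_cont u, forall th, `|u th| <= B &
    if j is j'.+1 then exists2 v, udiff i u v & Cb i j' B v else True].

Lemma Cb_cont i j B u : Cb i j B u -> torus_cont u.
Proof. by case: j => [|j] []. Qed.

Lemma Cb_bound i j B u : Cb i j B u -> forall th, `|u th| <= B.
Proof. by case: j => [|j] []. Qed.

Lemma Cb_ge0 i j B u : Cb i j B u -> 0 <= B.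
Proof. by move/Cb_bound => /(_ 0); apply: le_trans. Qed.

Lemma Cb_mono i j B B' u : B <= B' -> Cb i j B u -> Cb i j B' u.
Proof.
move=> BB; elim: j u => [|j IH] u [cu bu H]; split => //.
- by move=> th; exact: le_trans BB.
- by move=> th; exact: le_trans BB.
- by case: H => v uv cv; exists v => //; exact: IH.
Qed.

Lemma CbS i j B u : Cb i j.+1 B u -> Cb i j B u.
Proof.
elim: j u => [|j IH] u [cu bu [v uv cv]]; split => //.
by exists v => //; exact: IH.
Qed.

Lemma Cb_cst i j (c : R) : Cb i j `|c| (fun=> c).
Proof.
elim: j c => [|j IH] c; split => //; try exact: torus_cont_cst.
exists (fun=> 0); first exact: udiff_cst.
by apply: Cb_mono (IH 0); rewrite normr0.
Qed.

Lemma CbD i j B1 B2 u1 u2 : Cb i j B1 u1 -> Cb i j B2 u2 ->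
  Cb i j (B1 + B2) (fun th => u1 th + u2 th).
Proof.
elim: j u1 u2 => [|j IH] u1 u2 [c1 b1 H1] [c2 b2 H2]; split.
- exact: torus_contD.
- by move=> th; apply: le_trans (ler_normD _ _) _; exact: lerD.
- by [].
- exact: torus_contD.
- by move=> th; apply: le_trans (ler_normD _ _) _; exact: lerD.
- case: H1 H2 => v1 d1 e1 [v2 d2 e2].
  by exists (fun th => v1 th + v2 th); [exact: udiffD|exact: IH].
Qed.

(** The product rule at most doubles the bound at each order. *)
Lemma CbM i j B1 B2 u1 u2 : Cb i j B1 u1 -> Cb i j B2 u2 ->
  Cb i j (2 ^+ j * (B1 * B2)) (fun th => u1 th * u2 th).
Proof.
elim: j u1 u2 => [|j IH] u1 u2 H1 H2.
  have [c1 b1 _] := H1; have [c2 b2 _] := H2.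
  split => //; first exact: torus_contM.
  by move=> th; rewrite expr0 mul1r normrM; exact: ler_pM.
have B12 : 0 <= B1 * B2 by rewrite mulr_ge0 ?(Cb_ge0 H1) ?(Cb_ge0 H2).
have [c1 b1 [v1 d1 e1]] := H1; have [c2 b2 [v2 d2 e2]] := H2.
split.
- exact: torus_contM.
- move=> th; rewrite normrM; apply: (@le_trans _ _ (B1 * B2)); first exact: ler_pM.
  by rewrite ler_peMl// exprn_ege1// ler1n.
- exists (fun th => v1 th * u2 th + u1 th * v2 th).
    by apply: udiffM => //; exact: Cb_cont e1 || exact: Cb_cont e2.
  have -> : 2 ^+ j.+1 * (B1 * B2) = 2 ^+ j * (B1 * B2) + 2 ^+ j * (B1 * B2).
    by rewrite exprS; ring.
  by apply: CbD; apply: IH => //; exact: CbS.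
Qed.

Lemma CbZ i j (c : R) B u : Cb i j B u -> Cb i j (`|c| * B) (fun th => c * u th).
Proof.
elim: j u => [|j IH] u [cu bu H]; split.
- exact: torus_contZ.
- by move=> th; rewrite normrM ler_wpM2l.
- by [].
- exact: torus_contZ.
- by move=> th; rewrite normrM ler_wpM2l.
- case: H => v uv cv; exists (fun th => c * v th); last exact: IH.
  by apply: udiffZ => //; exact: Cb_cont cv.
Qed.

(** The witness is the j-th derivative of u. *)
Lemma fpow_Cb i j B u : Cb i j B u -> exists v, [/\ torus_cont v, forall th, `|v th| <= B &
  forall k, fpow v k = ((k 0 i)%:~R ^+ 2) ^+ j * fpow u k].
Proof.
elim: j u => [|j IH] u [cu bu H]; first by exists u; split => // k; rewrite expr0 mul1r.
have [v uv cv] := H; have [w [cw bw E]] := IH v cv.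
exists w; split => // k.
by rewrite E (fpow_udiff k cu (Cb_cont cv) uv) mulrA -exprSr.
Qed.

(** |k| is at most d times the largest coordinate. *)
Lemma weight_le m k : (0 < d)%N ->
  weight m k <= ((d ^ 2 + 1) ^ m)%N%:R * (1 + \sum_i ((k 0 i)%:~R ^+ 2) ^+ m) :> R.
Proof.
move=> d0; pose i0 : 'I_d := Ordinal d0.
case: (@arg_maxnP _ i0 xpredT (fun i => `|k ord0 i|%N) isT) => i1 _ Hmax.
set M := `|k ord0 i1|%N in Hmax.
have N1 : (normZ1 k <= d * M)%N.
  rewrite /normZ1 -[d in (d * _)%N]card_ord -sum_nat_const.
  by apply: leq_sum => i _; exact: Hmax.
have sq i : ((k 0 i)%:~R : R) ^+ 2 = ((`|k ord0 i| ^ 2)%N%:R : R).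
  rewrite natrX natr_absz intr_norm real_normK ?num_real//.
apply: (@le_trans _ _ (((d ^ 2 + 1) ^ m)%N%:R * (1 + (M ^ 2) ^ m)%N%:R)).
  rewrite /weight -natrM ler_nat.
  apply: (@leq_trans (((d ^ 2 + 1) * (maxn 1 (M ^ 2))) ^ m)).
    case: m => [//|m]; rewrite leq_exp2r //.
    have : (normZ1 k ^ 2 <= d ^ 2 * M ^ 2)%N by rewrite -expnMn leq_exp2r.
    by have := leq_maxl 1 (M ^ 2); have := leq_maxr 1 (M ^ 2); nia.
  rewrite expnMn leq_mul2l; apply/orP; right.
  by rewrite /maxn; case: ifP => _; rewrite ?exp1n ?leq_addl ?leq_addr.
rewrite ler_wpM2l // natrD lerD2l (bigD1 i1) //= sq -natrX -/M lerDl.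
by apply: sumr_ge0 => i _; rewrite exprn_ge0 // sqr_ge0.
Qed.

Definition Hm_const (m : nat) : R := ((d ^ 2 + 1) ^ m * d.+1)%N%:R.

(** Bessel's inequality for u and for its m-th derivative in each
    coordinate. *)
Lemma partial_sum_Cb m B u (S : seq 'rV[int]_d) : (0 < d)%N -> (forall i, Cb i m B u) -> uniq S ->
  \sum_(k <- S) fpow u k * weight m k <= Hm_const m * B ^+ 2.
Proof.
move=> d0 H uS; pose i0 : 'I_d := Ordinal d0.
have cu := Cb_cont (H i0); have bu := Cb_bound (H i0); have B0 := Cb_ge0 (H i0).
have bes w : torus_cont w -> (forall th, `|w th| <= B) -> \sum_(k <- S) fpow w k <= B ^+ 2.
  move=> cw bw; apply: le_trans (bessel cw uS) _.
  apply: le_trans (ler_norm _) _; apply: tmean_bound.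
    have -> : (fun th => w th ^+ 2) = (fun th => w th * w th) by apply/funext.
    exact: torus_contM.
  by move=> th; rewrite normrX lerXn2r ?nnegrE.
apply: (@le_trans _ _ (\sum_(k <- S) ((d ^ 2 + 1) ^ m)%N%:R * (fpow u k + \sum_i ((k 0 i)%:~R ^+ 2) ^+ m * fpow u k))).
  apply: ler_sum => k _; apply: le_trans (ler_wpM2l (fpow_ge0 u k) (weight_le m k d0)) _.
  by rewrite -mulr_suml mulrCA mulrDr mulr1 [X in _ * (_ + X)]mulrC.
rewrite -mulr_sumr /Hm_const natrM -mulrA ler_wpM2l // big_split /= exchange_big /=.
rewrite -natr1 mulrDl mul1r addrC; apply: lerD; last exact: bes.
apply: (@le_trans _ _ (\sum_(i < d) B ^+ 2)).
  apply: ler_sum => i _; have [v [cv bv E]] := fpow_Cb (H i).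
  by under eq_bigr do rewrite -E; exact: bes.
by rewrite sumr_const card_ord mulr_natl.
Qed.

Lemma fpow_close u v (e M : R) k : torus_cont u -> torus_cont v ->
  (forall th, `|u th| <= M) -> (forall th, `|v th - u th| <= e) -> e <= 1 ->
  fpow v k <= fpow u k + 2 * ((2 * M + 1) * e).
Proof.
move=> cu cv bu H e1.
have e0 : 0 <= e by apply: le_trans (H 0).
have M0 : 0 <= M by apply: le_trans (bu 0).
have q (a b : R) : `|a| <= M -> `|b - a| <= e -> b ^+ 2 <= a ^+ 2 + (2 * M + 1) * e.
  move=> h1 h2; have -> : b ^+ 2 = a ^+ 2 + (2 * a + (b - a)) * (b - a) by ring.
  rewrite lerD2l; apply: le_trans (ler_norm _) _; rewrite normrM; apply: ler_pM => //.
  apply: le_trans (ler_normD _ _) _; rewrite normrM ger0_norm //; apply: lerD.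
    by rewrite ler_wpM2l.
  exact: le_trans e1.
have cc w : torus_cont w -> torus_cont (fun th => w th * ccos k th) := torus_cont_fcos k.
have cs w : torus_cont w -> torus_cont (fun th => w th * csin k th) := torus_cont_fsin k.
rewrite /fpow mulr_natl mulr2n addrACA; apply: lerD; apply: q.
- apply: tmean_bound; first exact: cc.
  by move=> th; rewrite normrM -[M]mulr1; apply: ler_pM => //; exact: ccos_le1.
- rewrite /fcos -tmeanB; [|exact: cc|exact: cc].
  apply: tmean_bound; first by apply: torus_contB; exact: cc.
  by move=> th; rewrite -mulrBl normrM -[e]mulr1; apply: ler_pM => //; exact: ccos_le1.
- apply: tmean_bound; first exact: cs.
  by move=> th; rewrite normrM -[M]mulr1; apply: ler_pM => //; exact: csin_le1.
- rewrite /fsin -tmeanB; [|exact: cs|exact: cs].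
  apply: tmean_bound; first by apply: torus_contB; exact: cs.
  by move=> th; rewrite -mulrBl normrM -[e]mulr1; apply: ler_pM => //; exact: csin_le1.
Qed.

(** V need not be differentiable: a finite partial sum of the squared norm
    is continuous for the sup norm, so it inherits the bound from the
    approximants. *)
Lemma Hm_norm_Cb_lim m B V : (0 < d)%N -> 0 <= B -> torus_cont V ->
  (forall e : R, 0 < e -> exists2 u, (forall th, `|V th - u th| <= e) & forall i, Cb i m B u) ->
  (Hm_norm m V <= (Hm_const m * B)%:E)%E.
Proof.
move=> d0 B0 cV H.
have C1 : 1 <= Hm_const m by rewrite /Hm_const ler1n muln_gt0 expn_gt0 addn1.
have C0 := le_trans ler01 C1.
apply: Hm_norm_ub => [|S uS]; first exact: mulr_ge0.
apply: (@le_trans _ _ (Hm_const m * B ^+ 2)); last first.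
  by rewrite exprMn ler_wpM2r ?sqr_ge0// expr2 ler_peMl.
pose T : R := \sum_(k <- S) 2 * (2 * B + 1) * weight m k.
have T0 : 0 <= T.
  by apply: sumr_ge0 => k _; rewrite mulr_ge0 ?mulr_ge0 ?addr_ge0 ?mulr_ge0 // ltW // weight_gt0.
apply/ler_addgt0Pr => e e0.
pose e1 := Num.min 1 (e / (T + 1)).
have e10 : 0 < e1 by rewrite lt_min ltr01 divr_gt0 // ltr_wpDl.
have [u Hu Cu] := H e1 e10.
have cu := Cb_cont (Cu (Ordinal d0)); have bu := Cb_bound (Cu (Ordinal d0)).
apply: (@le_trans _ _ (\sum_(k <- S) (fpow u k * weight m k + e1 * (2 * (2 * B + 1) * weight m k)))).
  apply: ler_sum => k _.
  have w0 : 0 <= weight m k :> R by rewrite ltW // weight_gt0.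
  have := fpow_close k cu cV bu Hu; rewrite ge_min lexx => /(_ isT) h.
  apply: le_trans (ler_wpM2r w0 h) _; rewrite mulrDl lerD2l le_eqVlt; apply/orP; left.
  by apply/eqP; ring.
rewrite big_split /= -mulr_sumr; apply: lerD; first exact: partial_sum_Cb.
rewrite -/T; apply: (@le_trans _ _ (e / (T + 1) * T)).
  by rewrite ler_wpM2r // ge_min lexx orbT.
by rewrite mulrAC ler_pdivrMr ?ltr_wpDl// ler_wpM2l ?lerDl// ltW.
Qed.

End Cb.

Section composition.
Context {R : realType} {d : nat}.
Implicit Types (u v : 'rV[R]_d -> R) (th : 'rV[R]_d) (i : 'I_d) (B rho : R)
  (G : 'rV[R]_d -> R -> R).

(** Uniform differentiability in the i-th coordinate and in x jointly, as the
    chain rule for G th (u th) requires. *)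
Definition pdiff i rho G Gi Gx := forall e : R, 0 < e -> exists2 del : R, 0 < del &
  forall (h : R) th (x x' : R), `|h| <= del -> `|x| <= rho -> `|x'| <= rho -> `|x' - x| <= del ->
    `|G (th + h *: delta_mx 0 i) x' - G th x - h * Gi th x - (x' - x) * Gx th x|
      <= e * (`|h| + `|x' - x|).

Definition slab_cont rho G := torus_periodic G /\
  forall e : R, 0 < e -> exists2 del : R, 0 < del &
    forall th th' (x x' : R), `|x| <= rho -> `|x'| <= rho ->
      (forall i, `|th 0 i - th' 0 i| <= del) -> `|x - x'| <= del ->
      `|G th x - G th' x'| <= e.

(** The counterpart of [Cb] for functions of (th, x): all iterated derivatives
    in the i-th coordinate and in x, in any order, of total order at most j. *)
Fixpoint CbF i rho (j : nat) B G : Prop :=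
  [/\ slab_cont rho G, forall th (x : R), `|x| <= rho -> `|G th x| <= B &
    if j is j'.+1 then exists Gi Gx,
      [/\ pdiff i rho G Gi Gx, CbF i rho j' B Gi & CbF i rho j' B Gx] else True].

Lemma slab_cont_comp rho G u : slab_cont rho G -> torus_cont u ->
  (forall th, `|u th| <= rho) -> torus_cont (fun th => G th (u th)).
Proof.
move=> [pG cG] [pu cu] bu; split; first by move=> k th; rewrite pG pu.
move=> e e0; have [del del0 H] := cG e e0; have [del' del'0 H'] := cu del del0.
exists (Num.min del del'); first by rewrite lt_min del0.
move=> th th' h; apply: H => //.
  by move=> i; have := h i; rewrite le_min => /andP[].
by apply: H' => i; have := h i; rewrite le_min => /andP[].
Qed.

Lemma CbF_cont i rho j B G : CbF i rho j B G -> slab_cont rho G.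
Proof. by case: j => [|j] []. Qed.

Lemma CbF_bound i rho j B G : CbF i rho j B G ->
  forall th (x : R), `|x| <= rho -> `|G th x| <= B.
Proof. by case: j => [|j] []. Qed.

Lemma udiff_comp i rho G Gi Gx u v (Bx Bv : R) :
  (forall th (x : R), `|x| <= rho -> `|Gx th x| <= Bx) -> (forall th, `|v th| <= Bv) ->
  (forall th, `|u th| <= rho) -> pdiff i rho G Gi Gx -> udiff i u v ->
  udiff i (fun th => G th (u th)) (fun th => Gi th (u th) + Gx th (u th) * v th).
Proof.
move=> HGx Hv Hu HG Huv e e0.
have rho0 : 0 <= rho by apply: le_trans (Hu 0).
have Bx0 : 0 <= Bx by apply: le_trans (HGx 0 0 _); rewrite ?normr0.
have Bv0 : 0 <= Bv by apply: le_trans (Hv 0).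
pose S := Bv + Bx + 3.
have S0 : 0 < S by rewrite /S ltr_wpDl// addr_ge0.
have eS : 0 < e / S by rewrite divr_gt0.
have [d1 d10 H1] := HG _ eS.
pose e2 := Num.min 1 (e / S).
have e20 : 0 < e2 by rewrite lt_min ltr01.
have [d2 d20 H2] := Huv _ e20.
exists (Num.min d2 (d1 / (Bv + 1 + 1))).
  by rewrite lt_min d20 divr_gt0// ltr_wpDl// addr_ge0.
move=> h th; rewrite le_min => /andP[h2 h1].
have nh := normr_ge0 h.
have q := H2 h th h2.
set w := th + _ in q *.
have qu : `|u w - u th| <= (Bv + 1) * `|h|.
  have -> : u w - u th = (u w - u th - h * v th) + h * v th by ring.
  apply: le_trans (ler_normD _ _) _; rewrite mulrDl addrC mul1r; apply: lerD.
    by rewrite normrM mulrC ler_wpM2r.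
  by apply: le_trans q _; rewrite ler_piMl // ge_min lexx.
have {}h1 : (Bv + 1 + 1) * `|h| <= d1 by rewrite mulrC -ler_pdivlMr // ltr_wpDl// addr_ge0.
have hd1 : `|h| <= d1.
  by apply: le_trans h1; rewrite ler_peMl // lerDr addr_ge0.
have ud1 : `|u w - u th| <= d1.
  by apply: le_trans qu (le_trans _ h1); rewrite ler_wpM2r// lerDl.
have P := H1 h th (u th) (u w) hd1 (Hu _) (Hu _) ud1.
rewrite -/w in P.
have -> : G w (u w) - G th (u th) - h * (Gi th (u th) + Gx th (u th) * v th) =
  (G w (u w) - G th (u th) - h * Gi th (u th) - (u w - u th) * Gx th (u th)) +
  Gx th (u th) * (u w - u th - h * v th) by ring.
apply: le_trans (ler_normD _ _) _; rewrite [`|Gx _ _ * _|]normrM.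
have q' : `|u w - u th - h * v th| <= e / S * `|h|.
  by apply: le_trans q _; rewrite ler_wpM2r // ge_min lexx orbT.
have t2 := ler_pM (normr_ge0 _) (normr_ge0 _) (HGx th (u th) (Hu th)) q'.
have t1 : e / S * (`|h| + `|u w - u th|) <= e / S * ((Bv + 2) * `|h|).
  apply: ler_wpM2l; first exact: ltW.
  by move: qu; lra.
apply: le_trans (lerD (le_trans P t1) t2) _.
have -> : e / S * ((Bv + 2) * `|h|) + Bx * (e / S * `|h|) = e * `|h| * ((Bv + 2 + Bx) / S) by ring.
have eh : 0 <= e * `|h| by rewrite mulr_ge0// ltW.
by rewrite ler_piMr // ler_pdivrMr // mul1r /S; lra.
Qed.

Fixpoint comp_const (j : nat) : R := if j is j'.+1 then 2 ^+ j'.+1 * comp_const j' else 1.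

Lemma comp_const_ge1 j : 1 <= comp_const j.
Proof.
elim: j => //= j IH; rewrite -[leLHS]mulr1; apply: ler_pM => //.
by apply: exprn_ege1; rewrite ler1n.
Qed.

(** By induction on the order: the derivative of G th (u th) is Gi th (u th) +
    Gx th (u th) v th, where v is the derivative of u; the constant collects the
    factors 2^j of the product rule. *)
Lemma Cb_comp i rho j B G u : CbF i rho j B G -> (forall th, `|u th| <= rho) ->
  Cb i j 1 u -> Cb i j (comp_const j * B) (fun th => G th (u th)).
Proof.
move=> HG bu Hu; elim: j B G HG Hu => [|j IH] B G.
  move=> [cG bG _] [cu _ _]; split => //; first exact: slab_cont_comp cG cu bu.
  by move=> th; rewrite mul1r; exact: bG.
move=> [cG bG [Gi [Gx [pG HGi HGx]]]] Hu.
have B0 : 0 <= B by apply: le_trans (bG 0 (u 0) (bu 0)).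
have [cu _ [v uv Hv]] := Hu.
have hi := IH _ _ HGi (CbS Hu); have hx := IH _ _ HGx (CbS Hu).
have KB : 0 <= comp_const j * B by rewrite mulr_ge0// (le_trans ler01)// comp_const_ge1.
split.
- exact: slab_cont_comp cG cu bu.
- move=> th; apply: le_trans (bG _ _ (bu th)) _.
  by rewrite ler_peMl // -/(comp_const j.+1) comp_const_ge1.
- exists (fun th => Gi th (u th) + Gx th (u th) * v th).
    by apply: (udiff_comp (CbF_bound HGx) (Cb_bound Hv) bu).
  apply: Cb_mono (CbD hi (CbM hx Hv)).
  rewrite mulr1 -mulrA -[X in X + _ <= _]mul1r -mulrDl ler_wpM2r// exprS mulr_natl mulr2n lerD2r.
  by apply: exprn_ege1; rewrite lerDl.
Qed.

Lemma slab_contD rho G1 G2 : slab_cont rho G1 -> slab_cont rho G2 ->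
  slab_cont rho (fun th x => G1 th x + G2 th x).
Proof.
move=> [p1 c1] [p2 c2]; split; first by move=> k th; rewrite p1 p2.
move=> e e0; have e20 : 0 < e / 2 by rewrite divr_gt0.
have [d1 d10 H1] := c1 _ e20; have [d2 d20 H2] := c2 _ e20.
exists (Num.min d1 d2); first by rewrite lt_min d10.
move=> th th' x x' xr xr' h; rewrite le_min => /andP[h1 h2]; rewrite opprD addrACA (splitr e).
apply: le_trans (ler_normD _ _) _; apply: lerD; [apply: H1|apply: H2] => // i;
  by have := h i; rewrite le_min => /andP[].
Qed.

Lemma slab_contZ rho (c : R) G : slab_cont rho G -> slab_cont rho (fun th x => c * G th x).
Proof.
move=> [p1 c1]; split; first by move=> k th; rewrite p1.
move=> e e0; have e20 : 0 < e / (`|c| + 1) by rewrite divr_gt0// ltr_wpDl.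
have [d1 d10 H1] := c1 _ e20; exists d1 => // th th' x x' xr xr' h1 h2.
rewrite -mulrBr normrM; apply: le_trans (ler_wpM2l (normr_ge0 c) (H1 _ _ _ _ xr xr' h1 h2)) _.
by rewrite mulrCA ger_pMr// ler_pdivrMr ?mul1r ?lerDl// ltr_wpDl.
Qed.

Lemma pdiffD i rho G1 G1i G1x G2 G2i G2x : pdiff i rho G1 G1i G1x -> pdiff i rho G2 G2i G2x ->
  pdiff i rho (fun th x => G1 th x + G2 th x) (fun th x => G1i th x + G2i th x)
    (fun th x => G1x th x + G2x th x).
Proof.
move=> c1 c2 e e0; have e20 : 0 < e / 2 by rewrite divr_gt0.
have [d1 d10 H1] := c1 _ e20; have [d2 d20 H2] := c2 _ e20.
exists (Num.min d1 d2); first by rewrite lt_min d10.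
move=> h th x x'; rewrite !le_min => /andP[h1 h2] xr xr' /andP[k1 k2].
have a1 := H1 h th x x' h1 xr xr' k1; have a2 := H2 h th x x' h2 xr xr' k2.
have -> : e * (`|h| + `|x' - x|) = e / 2 * (`|h| + `|x' - x|) + e / 2 * (`|h| + `|x' - x|) by field.
apply: le_trans (lerD a1 a2); apply: le_trans (ler_normD _ _).
by rewrite le_eqVlt; apply/orP; left; apply/eqP; congr (`|_|); ring.
Qed.

Lemma pdiffZ i rho (c : R) G Gi Gx : pdiff i rho G Gi Gx ->
  pdiff i rho (fun th x => c * G th x) (fun th x => c * Gi th x) (fun th x => c * Gx th x).
Proof.
move=> c1 e e0; have e20 : 0 < e / (`|c| + 1) by rewrite divr_gt0// ltr_wpDl.
have [d1 d10 H1] := c1 _ e20; exists d1 => // h th x x' h1 xr xr' k1.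
have a1 := ler_wpM2l (normr_ge0 c) (H1 h th x x' h1 xr xr' k1).
rewrite -normrM in a1.
have E (a b p q : R) : c * a - c * b - h * (c * p) - (x' - x) * (c * q) = c * (a - b - h * p - (x' - x) * q) by ring.
rewrite E; apply: le_trans a1 _; rewrite mulrA ler_wpM2r ?addr_ge0//.
by rewrite mulrCA ger_pMr// ler_pdivrMr ?mul1r ?lerDl// ltr_wpDl.
Qed.

Lemma CbFD i rho j B1 B2 G1 G2 : CbF i rho j B1 G1 -> CbF i rho j B2 G2 ->
  CbF i rho j (B1 + B2) (fun th x => G1 th x + G2 th x).
Proof.
elim: j G1 G2 => [|j IH] G1 G2 [c1 b1 H1] [c2 b2 H2]; split.
- exact: slab_contD.
- by move=> th x xr; apply: le_trans (ler_normD _ _) _; apply: lerD; [exact: b1|exact: b2].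
- by [].
- exact: slab_contD.
- by move=> th x xr; apply: le_trans (ler_normD _ _) _; apply: lerD; [exact: b1|exact: b2].
- case: H1 => a1 [a2 [p1 e1 e2]]; case: H2 => a3 [a4 [p2 e3 e4]].
  exists (fun th x => a1 th x + a3 th x), (fun th x => a2 th x + a4 th x).
  by split; [exact: pdiffD|exact: IH|exact: IH].
Qed.

Lemma CbFZ i rho j (c : R) B G : CbF i rho j B G ->
  CbF i rho j (`|c| * B) (fun th x => c * G th x).
Proof.
elim: j G => [|j IH] G [c1 b1 H1]; split.
- exact: slab_contZ.
- by move=> th x xr; rewrite normrM ler_wpM2l// b1.
- by [].
- exact: slab_contZ.
- by move=> th x xr; rewrite normrM ler_wpM2l// b1.
- case: H1 => a1 [a2 [p1 e1 e2]].
  exists (fun th x => c * a1 th x), (fun th x => c * a2 th x).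
  by split; [exact: pdiffZ|exact: IH|exact: IH].
Qed.

End composition.

(** * Abel means along a linear flow *)

Section abel.
Context {R : realType} {d : nat} (omega : 'rV[R]_d).
Implicit Types (u v g : 'rV[R]_d -> R) (th : 'rV[R]_d) (k : 'rV[int]_d) (lam : R).
Local Notation mu := (@lebesgue_measure R).

Definition abel_arg lam g th (w : R) : R := g (th - (ln w / lam) *: omega).

(** The substitution w = e^(- lam s) turns this integral into the Abel mean
    lam times the integral of e^(- lam s) g (th + s omega) over s > 0. On a
    segment, the rules for integrals of bounded functions apply directly. *)
Definition abel lam g th : R := \int[mu]_(w in `[0, 1]) abel_arg lam g th w.

Lemma torus_cont_line g th : torus_cont g -> continuous (fun t : R => g (th + t *: omega)).
Proof.
move=> [_ cg] t; apply/cvgrPdist_le => e e0.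
have [del del0 H] := cg e e0.
pose S := \sum_i `|omega 0 i| + 1.
have S0 : 0 < S by rewrite ltr_wpDl// sumr_ge0.
exists (del / S) => /=; first by rewrite divr_gt0.
move=> s /= hs; apply: H => i; rewrite !mxE opprD addrACA subrr add0r -mulrBl normrM.
apply: (@le_trans _ _ (del / S * S)); last by rewrite divfK // gt_eqF.
apply: ler_pM => //; first exact: ltW.
by rewrite /S (bigD1 i) //= -addrA lerDl addr_ge0// sumr_ge0.
Qed.

Lemma abel_arg_bounded_measurable lam g th : torus_cont g -> bounded_measurable (abel_arg lam g th).
Proof.
move=> cg; split; last by have [M M0 H] := torus_cont_bounded cg; exists M => w; exact: H.
pose G (t : R) := g (th + t *: omega).
have -> : abel_arg lam g th = (fun t => G (- lam^-1 * t)) \o (@ln R).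
  by apply/funext => w; rewrite /abel_arg /G /= mulNr scaleNr [ln w / lam]mulrC.
apply: measurableT_comp; last exact: measurable_ln.
apply: continuous_measurable_fun => t.
apply: (@continuous_comp _ _ _ (fun t : R => - lam^-1 * t) G); last exact: torus_cont_line.
exact: mulrl_continuous.
Qed.

Lemma abel_integrable lam g th (a b : R) : torus_cont g ->
  mu.-integrable `[a, b] (EFin \o abel_arg lam g th).
Proof. by move=> cg; apply: bounded_measurable_integrable; exact: abel_arg_bounded_measurable. Qed.

Lemma abelD lam g1 g2 th : torus_cont g1 -> torus_cont g2 ->
  abel lam (fun th => g1 th + g2 th) th = abel lam g1 th + abel lam g2 th.
Proof.
by move=> c1 c2; rewrite /abel -RintegralD //; exact: abel_integrable.
Qed.

Lemma abelZ lam (c : R) g th : torus_cont g ->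
  abel lam (fun th => c * g th) th = c * abel lam g th.
Proof. by move=> cg; rewrite /abel -RintegralZl //; exact: abel_integrable. Qed.

Lemma integral_itvcc_cst (b c : R) : 0 <= b -> \int[mu]_(w in `[0, b]) c = c * b.
Proof.
move=> b0; rewrite Rintegral_cst//; congr (_ * _).
have H := @lebesgue_measure_itv R `[0, b].
move: H; rewrite /= lte_fin; case: ltP => h.
  by rewrite oppr0 adde0 => H; exact: (congr1 fine H).
have -> : b = 0 by apply/eqP; rewrite eq_le h b0.
by move=> H; exact: (congr1 fine H).
Qed.

Lemma abel_cst lam (c : R) th : abel lam (fun=> c) th = c.
Proof. by rewrite /abel /abel_arg integral_itvcc_cst// mulr1. Qed.

Lemma abel_le lam g1 g2 th : torus_cont g1 -> torus_cont g2 ->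
  (forall th, g1 th <= g2 th) -> abel lam g1 th <= abel lam g2 th.
Proof.
move=> c1 c2 H; apply: le_Rintegral => //; try exact: abel_integrable.
by move=> w _; exact: H.
Qed.

Lemma abelB lam g1 g2 th : torus_cont g1 -> torus_cont g2 ->
  abel lam (fun th => g1 th - g2 th) th = abel lam g1 th - abel lam g2 th.
Proof.
move=> c1 c2; rewrite -mulN1r -abelZ// -abelD//; last exact: torus_contZ.
by congr abel; apply/funext => ?; rewrite mulN1r.
Qed.

Lemma abel_bound lam g (M : R) th : torus_cont g -> (forall th, `|g th| <= M) ->
  `|abel lam g th| <= M.
Proof.
move=> cg H; rewrite ler_norml; apply/andP; split.
  rewrite -[leLHS](abel_cst lam _ th); apply: abel_le => //; first exact: torus_cont_cst.
  by move=> x; have := H x; rewrite ler_norml => /andP[].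
rewrite -[leRHS](abel_cst lam _ th); apply: abel_le => //; first exact: torus_cont_cst.
by move=> x; have := H x; rewrite ler_norml => /andP[].
Qed.

Lemma abel_shift lam g th (z : 'rV[R]_d) : abel lam g (th + z) = abel lam (fun th => g (th + z)) th.
Proof.
by rewrite /abel; apply: eq_Rintegral => w _; rewrite /abel_arg addrAC.
Qed.

Lemma abel_torus_cont lam g : torus_cont g -> torus_cont (abel lam g).
Proof.
move=> cg; have [pg ug] := cg; split.
  by move=> k th; rewrite abel_shift; congr abel; apply/funext => x; rewrite pg.
move=> e e0; have [del del0 H] := ug e e0; exists del => // th th' h.
have -> : th' = th + (th' - th) by rewrite addrC subrK.
rewrite abel_shift -abelB //; last exact: torus_cont_shift.
apply: abel_bound; first by apply: torus_contB => //; exact: torus_cont_shift.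
move=> x; apply: H => i; have := h i; rewrite !mxE.
by rewrite opprD addrA subrr add0r opprB.
Qed.

Lemma abel_udiff lam i u v : torus_cont u -> torus_cont v -> udiff i u v ->
  udiff i (abel lam u) (abel lam v).
Proof.
move=> cu cv H e e0; have [del del0 Hd] := H e e0; exists del => // h th hh.
have cs := torus_cont_shift (h *: delta_mx 0 i) cu.
rewrite abel_shift -abelB // -abelZ // -abelB; [|exact: torus_contB|exact: torus_contZ].
apply: abel_bound; last by move=> x; exact: Hd.
by apply: torus_contB; [exact: torus_contB|exact: torus_contZ].
Qed.

Lemma abel_Cb lam i j B u : Cb i j B u -> Cb i j B (abel lam u).
Proof.
elim: j u => [|j IH] u [cu bu H]; split.
- exact: abel_torus_cont.
- by move=> th; exact: abel_bound.
- by [].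
- exact: abel_torus_cont.
- by move=> th; exact: abel_bound.
- case: H => v uv cv; exists (abel lam v); last exact: IH.
  by apply: abel_udiff => //; exact: Cb_cont cv.
Qed.

Lemma bounded_linear_unique lam (y1 y2 q : R -> R) (B1 B2 : R) : 0 < lam ->
  (forall t : R, is_derive t (1:R) y1 (lam * (y1 t - q t))) ->
  (forall t : R, is_derive t (1:R) y2 (lam * (y2 t - q t))) ->
  (forall t, `|y1 t| <= B1) -> (forall t, `|y2 t| <= B2) -> forall t, y1 t = y2 t.
Proof.
move=> lam0 d1 d2 b1 b2 t.
apply/eqP; rewrite -subr_eq0; apply/eqP.
apply: (@bounded_exp_growth_eq0 _ (fun t => y1 t - y2 t) (fun=> 0) lam (B1 + B2)) => //.
- by move=> s; apply: le_trans (ler_normB _ _) _; exact: lerD.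
- move=> s; have := @is_deriveB _ _ _ _ _ _ _ _ _ (d1 s) (d2 s).
  by move=> h; apply: (is_derive_eq h); ring.
- by move=> s; rewrite normr0 mulr_ge0// divr_ge0// ltW.
Qed.

(** Y th is the solution of y' = lam (y - g) along the orbit of th
    obtained by variation of constants, with the Abel mean as its value at
    time 0. It is bounded. The same holds for the orbit of th + t omega, and
    bounded solutions are unique, so the value of Y th at time t is the Abel
    mean at th + t omega. *)
Lemma abel_flow lam g th : 0 < lam -> torus_cont g -> forall t : R,
  is_derive t (1:R) (fun t : R => abel lam g (th + t *: omega))
    (lam * (abel lam g (th + t *: omega) - g (th + t *: omega))).
Proof.
move=> lam0 cg; have [M M0 HM] := torus_cont_bounded cg.
have l0 : lam != 0 by rewrite gt_eqF.
pose Y th (t : R) := expR (lam * t) * \int[mu]_(w in `[0, expR (- lam * t)]) abel_arg lam g th w.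
have dY th0 (t : R) : is_derive t (1:R) (Y th0) (lam * (Y th0 t - g (th0 + t *: omega))).
  have dlin (c : R) : is_derive t (1:R) (fun t : R => c * t) c.
    have h := @is_deriveZ _ _ _ (@id R) c t 1 1 (@is_derive_id _ _ _ _).
    by apply: (is_derive_eq h); rewrite /GRing.scale/= mulr1.
  have dexp (c : R) : is_derive t (1:R) (fun t : R => expR (c * t)) (c * expR (c * t)).
    have h := @is_derive1_comp _ expR (fun t : R => c * t) t _ _ (is_derive_expR _) (dlin c).
    by apply: (is_derive_eq h); rewrite /GRing.scale/= mulrC.
  have d1 : is_derive (expR (- lam * t)) (1:R) (fun y : R => \int[mu]_(s in `[0, y]) abel_arg lam g th0 s) (abel_arg lam g th0 (expR (- lam * t))).
    apply: integral_FTC1; [exact: abel_arg_bounded_measurable|exact: expR_gt0|].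
    have dln := is_derive1_ln (expR_gt0 (- lam * t)).
    have := is_derive_continuous dln => cln.
    pose G (t : R) := g (th0 + t *: omega).
    have -> : abel_arg lam g th0 = (fun s => G (- lam^-1 * s)) \o (@ln R).
      by apply/funext => w; rewrite /abel_arg /G /= mulNr scaleNr [ln w / lam]mulrC.
    apply: continuous_comp; first exact: cln.
    apply: (@continuous_comp _ _ _ (fun t : R => - lam^-1 * t) G); last exact: torus_cont_line.
    exact: mulrl_continuous.
  have d2 := @is_derive1_comp _ _ (fun t : R => expR (- lam * t)) t _ _ d1 (dexp (- lam)).
  have d3 := @is_deriveM _ _ _ _ _ _ _ _ (dexp lam) d2.
  apply: (is_derive_eq d3).
  have AE : abel_arg lam g th0 (expR (- lam * t)) = g (th0 + t *: omega).
    rewrite /abel_arg expRK; have -> : (- lam * t / lam) = - t by field.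
    by rewrite scaleNr opprK.
  rewrite AE /Y; set G := g _; set I := \int[mu]_(w in _) abel_arg _ _ _ _.
  change (expR (lam * t) * (G * (- lam * expR (- lam * t))) + I * (lam * expR (lam * t)) =
    lam * (expR (lam * t) * I - G)).
  have E : expR (lam * t) * expR (- lam * t) = 1.
    by rewrite -expRD mulNr subrr expR0.
  have -> : expR (lam * t) * (G * (- lam * expR (- lam * t))) =
    - lam * G * (expR (lam * t) * expR (- lam * t)) by ring.
  rewrite E; ring.
have bY th0 (t : R) : `|Y th0 t| <= M.
  rewrite /Y normrM gtr0_norm ?expR_gt0//.
  have : `|\int[mu]_(w in `[0, expR (- lam * t)]) abel_arg lam g th0 w| <= M * expR (- lam * t).
    apply: le_trans (le_normr_Rintegral _ _) _ => //; first exact: abel_integrable.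
    rewrite -integral_itvcc_cst ?expR_ge0//.
    apply: le_Rintegral => //.
    - apply: bounded_measurable_integrable; have [mf _] := abel_arg_bounded_measurable lam th0 cg.
      by split; [exact: measurableT_comp|exists M => x; rewrite normr_id; exact: HM].
    - by apply: bounded_measurable_integrable; exact: bounded_measurable_cst.
    - by move=> x _; exact: HM.
  move=> h; apply: le_trans (ler_wpM2l (expR_ge0 _) h) _.
  by rewrite mulrCA -expRD mulNr subrr expR0 mulr1.
have AY th0 : abel lam g th0 = Y th0 0.
  by rewrite /Y !mulr0 expR0 mul1r.
have key (t : R) : abel lam g (th + t *: omega) = Y th t.
  rewrite AY -[in RHS](add0r t).
  apply: (@bounded_linear_unique lam (Y (th + t *: omega)) (fun s => Y th (s + t)) (fun s => g (th + (s + t) *: omega)) M M lam0) => //.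
    move=> s; have := dY (th + t *: omega) s.
    by rewrite -addrA -scalerDl [t + s]addrC.
  move=> s; have /is_derive_epsP H := dY th (s + t); apply/is_derive_epsP => e e0.
  have [del del0 Hd] := H e e0; exists del; first exact: del0.
  move=> h hh; have -> : s + h + t = s + t + h by rewrite addrAC.
  exact: Hd.
move=> t; have -> : (fun t : R => abel lam g (th + t *: omega)) = Y th by apply/funext.
by rewrite key; exact: dY.
Qed.

(** Since k . omega is nonzero, a nonconstant character is the derivative
    along the flow of a trigonometric polynomial S. Its Abel mean is then lam
    times the difference of the Abel mean of S and S. *)
Lemma abel_trig u : nonresonant omega -> trig u -> exists2 C : R, 0 <= C &
  forall lam th, 0 < lam -> `|abel lam u th - tmean u| <= C * lam.
Proof.
move=> nr.
have cob (g S : 'rV[R]_d -> R) (B : R) : torus_cont g -> torus_cont S -> (forall th, `|S th| <= B) ->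
   (forall th (t : R), is_derive t (1:R) (fun t : R => S (th + t *: omega)) (g (th + t *: omega))) ->
   tmean g = 0 -> forall lam th, 0 < lam -> `|abel lam g th - tmean g| <= 2 * B * lam.
  move=> cg cS bS dS -> lam th lam0; rewrite subr0.
  have [M M0 HM] := torus_cont_bounded cg.
  have E : forall t : R, abel lam g (th + t *: omega) = lam * (abel lam S (th + t *: omega) - S (th + t *: omega)).
    apply: (@bounded_linear_unique lam (fun t => abel lam g (th + t *: omega))
      (fun t => lam * (abel lam S (th + t *: omega) - S (th + t *: omega)))
      (fun t => g (th + t *: omega)) M (lam * (B + B)) lam0).
    - exact: (abel_flow th lam0 cg).
    - move=> t; have h1 := abel_flow th lam0 cS t; have h2 := dS th t.
      have h3 := @is_deriveZ _ _ _ _ lam _ _ _ (@is_deriveB _ _ _ _ _ _ _ _ _ h1 h2).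
      by apply: (is_derive_eq h3); rewrite /GRing.scale/=.
    - by move=> t; exact: abel_bound.
    - move=> t; rewrite normrM gtr0_norm//; apply: ler_wpM2l; first exact: ltW.
      by apply: le_trans (ler_normB _ _) _; apply: lerD => //; exact: abel_bound.
  have := E 0; rewrite scale0r addr0 => ->.
  rewrite normrM gtr0_norm// mulrC; apply: ler_wpM2r; first exact: ltW.
  apply: le_trans (ler_normB _ _) _; rewrite mulr_natl mulr2n.
  by apply: lerD => //; exact: abel_bound.
have dline k th (t : R) : is_derive t (1:R) (fun t : R => dotv (zvec R k) (th + t *: omega)) (dotv (zvec R k) omega).
  have -> : (fun t : R => dotv (zvec R k) (th + t *: omega)) = (fun t : R => dotv (zvec R k) th + dotv (zvec R k) omega * t).
    by apply/funext => s; rewrite dotvDr dotvZr mulrC.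
  have h := @is_deriveZ _ _ _ (@id R) (dotv (zvec R k) omega) t 1 1 (@is_derive_id _ _ _ _).
  have h2 := @is_deriveD _ _ _ _ _ _ _ _ _ (@is_derive_cst _ _ _ (dotv (zvec R k) th) t (1:R)) h.
  by apply: (is_derive_eq h2); rewrite /GRing.scale/= add0r mulr1.
elim=> [k|k|{}u v tu [C1 C10 H1] tv [C2 C20 H2]|c {}u tu [C1 C10 H1]].
- have [->|k0] := eqVneq k 0.
    exists 0 => // lam th lam0; rewrite mul0r.
    have -> : @ccos R d 0 = fun=> 1 by apply/funext => x; rewrite ccos0k.
    by rewrite abel_cst tmean_cst subrr normr0.
  have w0 := nr k k0; set w := dotv _ _ in w0.
  exists (2 * `|w^-1|); first by rewrite mulr_ge0.
  move=> lam th lam0; apply: (@cob _ (fun th => w^-1 * csin k th)) => //.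
  + exact: torus_cont_ccos.
  + by apply: torus_contZ; exact: torus_cont_csin.
  + by move=> x; rewrite normrM ler_piMr // csin_le1.
  + move=> x t; have h := @is_derive1_comp _ sin _ t _ _ (is_derive_sin _) (dline k x t).
    have h2 := @is_deriveZ _ _ _ _ w^-1 _ _ _ h.
    by apply: (is_derive_eq h2); rewrite /GRing.scale/= /ccos -/w; field.
  + by rewrite tmean_ccos (negbTE k0).
- have [->|k0] := eqVneq k 0.
    exists 0 => // lam th lam0; rewrite mul0r.
    have -> : @csin R d 0 = fun=> 0 by apply/funext => x; rewrite csin0k.
    by rewrite abel_cst tmean_cst subrr normr0.
  have w0 := nr k k0; set w := dotv _ _ in w0.
  exists (2 * `|w^-1|); first by rewrite mulr_ge0.
  move=> lam th lam0; apply: (@cob _ (fun th => - w^-1 * ccos k th)) => //.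
  + exact: torus_cont_csin.
  + by apply: torus_contZ; exact: torus_cont_ccos.
  + by move=> x; rewrite normrM normrN ler_piMr // ccos_le1.
  + move=> x t; have h := @is_derive1_comp _ cos _ t _ _ (is_derive_cos _) (dline k x t).
    have h2 := @is_deriveZ _ _ _ _ (- w^-1) _ _ _ h.
    by apply: (is_derive_eq h2); rewrite /GRing.scale/= /csin -/w; field.
  + exact: tmean_csin.
- exists (C1 + C2) => [|lam th lam0]; first exact: addr_ge0.
  have cu := trig_torus_cont tu; have cv := trig_torus_cont tv.
  rewrite abelD // tmeanD // opprD addrACA mulrDl.
  by apply: le_trans (ler_normD _ _) _; apply: lerD; [exact: H1|exact: H2].
- exists (`|c| * C1) => [|lam th lam0]; first exact: mulr_ge0.
  have cu := trig_torus_cont tu.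
  by rewrite abelZ // tmeanZ // -mulrBr normrM -mulrA ler_wpM2l // H1.
Qed.

(** Trigonometric polynomials are dense, and neither the Abel mean nor the
    mean over the torus increases the sup norm. *)
Lemma abel_ergodic g (e : R) : nonresonant omega -> torus_cont g -> 0 < e ->
  exists2 lam0 : R, 0 < lam0 & forall lam th, 0 < lam -> lam < lam0 ->
    `|abel lam g th - tmean g| <= e.
Proof.
move=> nr cg e0; have e30 : 0 < e / 3 by rewrite divr_gt0.
have [u tu Hu] := trig_dense cg e30; have cu := trig_torus_cont tu.
have [C C0 HC] := abel_trig nr tu.
exists (e / 3 / (C + 1)); first by rewrite divr_gt0// ltr_wpDl.
move=> lam th lam0; rewrite ltr_pdivlMr ?ltr_wpDl// => hl.
have h1 : `|abel lam g th - abel lam u th| <= e / 3.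
  by rewrite -abelB//; apply: abel_bound => //; exact: torus_contB.
have h2 : `|tmean u - tmean g| <= e / 3.
  by apply: tmean_unif => // x; rewrite distrC.
have h3 : `|abel lam u th - tmean u| <= e / 3.
  by apply: le_trans (HC lam th lam0) _; lra.
have -> : abel lam g th - tmean g = (abel lam g th - abel lam u th) + (abel lam u th - tmean u) + (tmean u - tmean g) by ring.
apply: le_trans (ler_normD _ _) _; apply: le_trans (lerD (ler_normD _ _) (lexx _)) _.
by apply: le_trans (lerD (lerD h1 h3) h2) _; lra.
Qed.

(** The Abel means at the point 0 only see the orbit of 0, and they converge
    to the mean over the torus; so g has mean zero against every character. *)
Lemma orbit_determines g : nonresonant omega -> torus_cont g ->
  (forall t : R, g (t *: omega) = 0) -> forall th, g th = 0.
Proof.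
move=> nr cg H; apply: fourier_uniqueness => // k.
have K q : torus_cont q -> tmean (fun th => g th * q th) = 0.
  move=> cq; have cgq := torus_contM cg cq.
  apply/eqP; rewrite -normr_eq0 eq_le normr_ge0 andbT.
  apply/ler_addgt0Pr => e e0; rewrite add0r.
  have [l0 l00 /(_ (l0 / 2) 0)] := abel_ergodic nr cgq e0.
  rewrite divr_gt0// ltr_pdivrMr// ltr_pMr// ltr1n => /(_ isT isT).
  rewrite (_ : abel _ _ _ = 0) ?sub0r ?normrN//.
  rewrite -[RHS](mul0r 1) -[RHS]integral_itvcc_cst//; apply: eq_Rintegral => w _.
  by rewrite /abel_arg sub0r -scaleNr H mul0r.
by split; apply: K; [exact: torus_cont_ccos|exact: torus_cont_csin].
Qed.

End abel.

(** * Functions of class C^n near x = 0 *)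

Section directional.
Context {R : realType} {d : nat}.
Local Notation E := ('rV[R]_d * R)%type.
Implicit Types (g : E -> R) (z v w : E).

Lemma is_derive_line g z v (t : R) : derivable g (z + t *: v) v ->
  is_derive t (1:R) (fun s : R => g (z + s *: v)) ('D_v g (z + t *: v)).
Proof.
move=> dg.
have H : (fun h : R => h^-1 *: ((fun s : R => g (z + s *: v)) (h *: 1 + t) - g (z + t *: v))) =
  (fun h : R => h^-1 *: (g (h *: v + (z + t *: v)) - g (z + t *: v))).
  apply/funext => h; congr (_ *: (g _ - _)).
  by rewrite [h *: 1]mulr1 scalerDl addrCA.
by split; rewrite /derivable /derive /= H.
Qed.

Lemma mvt_centered (f df : R -> R) (h : R) :
  (forall t, `|t| <= `|h| -> is_derive t (1:R) f (df t)) ->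
  exists2 xi : R, `|xi| <= `|h| & f h - f 0 = h * df xi.
Proof.
move=> H.
have cw (a b : R) : `|a| <= `|h| -> `|b| <= `|h| -> {within `[a, b], continuous f}.
  move=> ah bh; apply: derivable_within_continuous => x; rewrite in_itv/= => /andP[ax xb].
  have xh : `|x| <= `|h|.
    move: ah bh; rewrite !ler_norml => /andP[? ?] /andP[? ?]; apply/andP; split; lra.
  by have [] := H x xh.
have [h0|h0] := leP 0 h.
  have [||c] := @MVT_segment _ f df 0 h h0.
  - move=> x; rewrite in_itv/= => /andP[x0 xh]; apply: H.
    by rewrite !ger0_norm ?ltW// (lt_trans x0).
  - by apply: cw; rewrite ?normr0.
  rewrite in_itv/= subr0 => /andP[c0 ch] E; exists c; last by rewrite E mulrC.
  by rewrite !ger0_norm.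
have [||c] := @MVT_segment _ f df h 0 (ltW h0).
- move=> x; rewrite in_itv/= => /andP[hx x0]; apply: H.
  by rewrite !ltr0_norm// lerN2 ltW.
- by apply: cw; rewrite ?normr0.
rewrite in_itv/= sub0r => /andP[hc c0] E; exists c.
  by rewrite ler0_norm// ltr0_norm// lerN2.
by rewrite -[LHS]opprB E; ring.
Qed.

Lemma mvt_line g z v (h : R) :
  (forall t : R, `|t| <= `|h| -> derivable g (z + t *: v) v) ->
  exists2 xi : R, `|xi| <= `|h| & g (z + h *: v) - g z = h * 'D_v g (z + xi *: v).
Proof.
move=> H; have [xi xih E] := @mvt_centered (fun s => g (z + s *: v)) (fun s => 'D_v g (z + s *: v)) h
  (fun t th => is_derive_line (H t th)).
by exists xi => //; rewrite -E scale0r addr0.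
Qed.

Lemma continuous_plane g z v w (e : R) : {for z, continuous g} -> 0 < e ->
  exists2 del : R, 0 < del & forall t s : R, `|t| <= del -> `|s| <= del ->
    `|g (z + t *: v + s *: w) - g z| <= e.
Proof.
move=> /cvgrPdist_le /(_ e) + e0 => /(_ e0) /nbhs_normP[r /= r0 Hr].
pose N : R := `|v| + `|w| + 1.
have N0 : 0 < N by rewrite /N ltr_wpDl// addr_ge0.
exists (r / 2 / N); first by rewrite !divr_gt0.
move=> t s ht hs; rewrite distrC; apply: Hr => /=.
rewrite -addrA opprD addrA subrr add0r normrN.
apply: le_lt_trans (ler_normD _ _) _; rewrite !normrZ.
apply: (@le_lt_trans _ _ (r / 2 / N * `|v| + r / 2 / N * `|w|)).
  by apply: lerD; apply: ler_wpM2r.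
rewrite -mulrDr; apply: (@le_lt_trans _ _ (r / 2)).
  rewrite -mulrA ger_pMr ?divr_gt0// mulrC ler_pdivrMr // mul1r /N lerDl//.
by rewrite ltr_pdivrMr // ltr_pMr // ltr1n.
Qed.

(** Both mixed derivatives, at points within q of z, are equal to the same
    second difference De divided by q^2. *)
Lemma clairaut g v w z (r : R) : 0 < r ->
  (forall t s : R, `|t| <= r -> `|s| <= r ->
     [/\ derivable g (z + t *: v + s *: w) v, derivable g (z + t *: v + s *: w) w,
         derivable ('D_v g) (z + t *: v + s *: w) w &
         derivable ('D_w g) (z + t *: v + s *: w) v]) ->
  {for z, continuous ('D_w ('D_v g))} -> {for z, continuous ('D_v ('D_w g))} ->
  'D_w ('D_v g) z = 'D_v ('D_w g) z.
Proof.
move=> r0 H c1 c2.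
apply/eqP; rewrite -subr_eq0 -normr_eq0 eq_le normr_ge0 andbT.
apply/ler_addgt0Pr => e e0; rewrite add0r; have e20 : 0 < e / 2 by rewrite divr_gt0.
have [d1 d10 H1] := continuous_plane v w c1 e20.
have [d2 d20 H2] := continuous_plane v w c2 e20.
pose q := Num.min r (Num.min d1 d2).
have q0 : 0 < q by rewrite !lt_min r0 d10.
have qn : `|q| = q by rewrite gtr0_norm.
have qnr : `|q| <= r by rewrite qn ge_min lexx.
have [qr q1 q2] : [/\ q <= r, q <= d1 & q <= d2].
  by split; rewrite !ge_min lexx ?orbT.
have n0 : `|0 : R| <= r by rewrite normr0 ltW.
pose De := g (z + q *: v + q *: w) - g (z + q *: v) - (g (z + q *: w) - g z).
have [xi xiq [et etq E1]] : exists2 xi : R, `|xi| <= q & exists2 et : R, `|et| <= q &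
    De = q * (q * 'D_w ('D_v g) (z + xi *: v + et *: w)).
  have [|xi xiq E] := @mvt_centered (fun t => g (z + q *: w + t *: v) - g (z + t *: v))
     (fun t => 'D_v g (z + q *: w + t *: v) - 'D_v g (z + t *: v)) q _; last first.
    rewrite qn in xiq; exists xi; first exact: xiq.
    have [|et etq E'] := @mvt_line ('D_v g) (z + xi *: v) w q _; last first.
      rewrite qn in etq; exists et; first exact: etq.
      rewrite -E' /De; move: E; rewrite scale0r !addr0 ![z + q *: w + _]addrAC => E.
      by rewrite E.
    move=> t; rewrite qn => tq; have [_ _ h _] := H xi t (le_trans xiq qr) (le_trans tq qr).
    exact: h.
  move=> t; rewrite qn => tq; have tr := le_trans tq qr.
  apply: is_deriveB; apply: is_derive_line.
    by have [h _ _ _] := H t q tr qnr; rewrite addrAC; exact: h.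
  by have [h _ _ _] := H t 0 tr n0; rewrite scale0r addr0 in h; exact: h.
have [xi' xiq' [et' etq' E2]] : exists2 xi : R, `|xi| <= q & exists2 et : R, `|et| <= q &
    De = q * (q * 'D_v ('D_w g) (z + xi *: v + et *: w)).
  have [|xi' xiq' E] := @mvt_centered (fun t => g (z + q *: v + t *: w) - g (z + t *: w))
     (fun t => 'D_w g (z + q *: v + t *: w) - 'D_w g (z + t *: w)) q _; last first.
    rewrite qn in xiq'.
    have [|et' etq' E'] := @mvt_line ('D_w g) (z + xi' *: w) v q _; last first.
      rewrite qn in etq'; exists et'; first exact: etq'.
      exists xi'; first exact: xiq'.
      rewrite [z + et' *: v + _]addrAC -E' /De; move: E; rewrite scale0r !addr0 => E.
      have -> : g (z + q *: v + q *: w) - g (z + q *: v) - (g (z + q *: w) - g z) =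
        g (z + q *: v + q *: w) - g (z + q *: w) - (g (z + q *: v) - g z) by ring.
      by rewrite E; congr (_ * ('D_w g _ - _)); rewrite addrAC.
    move=> t; rewrite qn => tq; have [_ _ _ h] := H t xi' (le_trans tq qr) (le_trans xiq' qr).
    by rewrite addrAC; exact: h.
  move=> t; rewrite qn => tq; have tr := le_trans tq qr.
  apply: is_deriveB; apply: is_derive_line.
    by have [_ h _ _] := H q t qnr tr; exact: h.
  by have [_ h _ _] := H 0 t n0 tr; rewrite scale0r addr0 in h; exact: h.
have A1 := H1 xi et (le_trans xiq q1) (le_trans etq q1).
have A2 := H2 xi' et' (le_trans xiq' q2) (le_trans etq' q2).
have qN : q != 0 by rewrite gt_eqF.
clear - A1 A2 E1 E2 qN; move: A1 A2 E1 E2.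
move: ('D_w ('D_v g) (z + xi *: v + et *: w)) ('D_v ('D_w g) (z + xi' *: v + et' *: w)).
move: ('D_w ('D_v g) z) ('D_v ('D_w g) z) De => a b De X Y A1 A2 E1 E2.
have EE : X = Y by apply: (mulfI qN); apply: (mulfI qN); rewrite -E1 -E2.
rewrite EE in A1; have -> : a - b = (Y - b) - (Y - a) by ring.
by apply: le_trans (ler_normB _ _) _; rewrite [e]splitr; apply: lerD.
Qed.

End directional.

Lemma increment_bound (R : realType) (a b c h k p q p' q' e : R) :
  a - b = h * p' -> b - c = k * q' -> `|p' - p| <= e -> `|q' - q| <= e ->
  `|a - c - h * p - k * q| <= e * (`|h| + `|k|).
Proof.
move=> E1 E2 h1 h2.
have -> : a - c - h * p - k * q = (a - b - h * p) + (b - c - k * q) by ring.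
have e1 : h * p' - h * p = h * (p' - p) by ring.
have e2 : k * q' - k * q = k * (q' - q) by ring.
rewrite E1 E2 e1 e2 [e * _]mulrDr; apply: le_trans (ler_normD _ _) _.
by rewrite !normrM ![e * _]mulrC; apply: lerD; apply: ler_wpM2l.
Qed.

Section class_C.
Context {R : realType} {d : nat} (F : 'rV[R]_d -> R -> R) (n : nat) (del : R).
Local Notation E := ('rV[R]_d * R)%type.
Local Notation Fz := (fun z : E => F z.1 z.2).
Local Notation P s := (iter_partial s Fz).
Local Notation U := [set z : E | `|z.2| < del].
Hypothesis pF : torus_periodic F.
Hypothesis cF : class_C n U Fz.
Implicit Types (s : seq (option 'I_d)) (o : option 'I_d) (th : 'rV[R]_d) (x : R).

Lemma iter_partial_periodic s (k : 'rV[int]_d) th x :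
  P s (th + (2 * pi) *: zvec R k, x) = P s (th, x).
Proof.
elim: s th x => [|o s IH] th x /=; first by rewrite pF.
rewrite /derive /=.
have -> // : (fun h : R => h^-1 *: (P s (h *: coord_dir R o + (th + (2 * pi) *: zvec R k, x)) -
    P s (th + (2 * pi) *: zvec R k, x))) =
  (fun h : R => h^-1 *: (P s (h *: coord_dir R o + (th, x)) - P s (th, x))).
apply/funext => h; rewrite IH; congr (_ *: (_ - _)).
have -> : h *: coord_dir R o + (th + (2 * pi) *: zvec R k, x) =
  ((h *: coord_dir R o).1 + th + (2 * pi) *: zvec R k, (h *: coord_dir R o).2 + x).
  by rewrite -addrA; case: (h *: _).
by rewrite IH; case: (h *: _).
Qed.

Lemma iter_partial_continuous s (z : E) : (size s <= n)%N -> `|z.2| < del ->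
  {for z, continuous (P s)}.
Proof. by move=> sn zd; have [] := cF sn zd. Qed.

Lemma iter_partial_derivable s (z : E) o : (size s < n)%N -> `|z.2| < del ->
  derivable (P s) z (coord_dir R o).
Proof. by move=> sn zd; have [_ ] := cF (ltnW sn) zd; apply. Qed.

Lemma iter_partial_bounded rho s : rho < del -> (size s <= n)%N ->
  exists2 M : R, 0 <= M & forall th x, `|x| <= rho -> `|P s (th, x)| <= M.
Proof.
move=> rd sn.
have [||M HM] := @periodic_continuous_bounded R d (P s) rho.
- by move=> k th x; exact: iter_partial_periodic.
- by move=> z zr; apply: iter_partial_continuous => //; exact: le_lt_trans rd.
by exists `|M| => // th x xr; apply: le_trans (ler_norm M); exact: HM.
Qed.

Lemma iter_partial_bounded_all rho (m : nat) : rho < del -> (m <= n)%N ->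
  exists2 M : R, 0 <= M & forall s, (size s <= m)%N -> forall th x, `|x| <= rho -> `|P s (th, x)| <= M.
Proof.
move=> rd; elim: m => [|m IH] mn.
  have [M M0 HM] := iter_partial_bounded rd (s := [::]) isT.
  by exists M => // s; rewrite leqn0 => /nilP ->.
have [M M0 HM] := IH (ltnW mn).
have K (t : m.+1.-tuple (option 'I_d)) : exists Mt : R, 0 <= Mt /\ forall th x, `|x| <= rho -> `|P t (th, x)| <= Mt.
  have [|Mt ? ?] := iter_partial_bounded rd (s := t); first by rewrite size_tuple.
  by exists Mt.
have [B HB] := choice K.
exists (M + \sum_t B t).
  by rewrite addr_ge0 // sumr_ge0 // => t _; have [] := HB t.
have S0 : 0 <= \sum_t B t by apply: sumr_ge0 => t _; have [] := HB t.
move=> s; rewrite leq_eqVlt => /orP[/eqP sm|sm] th x xr; last first.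
  by apply: le_trans (HM s sm th x xr) _; rewrite lerDl.
have := HB (tcast sm (in_tuple s)) => -[_ /(_ th x xr)].
rewrite val_tcast /= => h; apply: le_trans h _.
rewrite (bigD1 (tcast sm (in_tuple s))) //= addrCA lerDl addr_ge0 // sumr_ge0 // => t _.
by have [] := HB t.
Qed.

Lemma iter_partial_slab rho s : rho < del -> (size s <= n)%N ->
  slab_cont rho (fun th x => P s (th, x)).
Proof.
move=> rd sn; split.
  by move=> k th; apply/funext => x; exact: iter_partial_periodic.
move=> e e0.
have [||dl dl0 H] := @periodic_continuous_unif R d (P s) rho _ _ e e0.
- by move=> k th x; exact: iter_partial_periodic.
- by move=> z zr; apply: iter_partial_continuous => //; exact: le_lt_trans rd.
by exists dl => // th th' x x' xr _ h1 h2; exact: H.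
Qed.

Lemma coord_SomeE (i : 'I_d) th x (t : R) :
  ((th, x) : E) + t *: coord_dir R (Some i) = (th + t *: delta_mx 0 i, x).
Proof. by apply: injective_projections; rewrite /= ?scaler0 ?addr0. Qed.

Lemma coord_NoneE th x (t : R) :
  ((th, x) : E) + t *: coord_dir R (@None 'I_d) = (th, x + t).
Proof. by apply: injective_projections; rewrite /= ?scaler0 ?addr0 // [t *: 1]mulr1. Qed.

Lemma iter_partial_mvt_x s th x y : (size s < n)%N -> `|x| + `|y - x| < del ->
  exists2 z : R, `|z - x| <= `|y - x| &
    P s (th, y) - P s (th, x) = (y - x) * P (None :: s) (th, z).
Proof.
move=> sn xy.
have [|xi xih E] := @mvt_line R d (P s) (th, x) (coord_dir R None) (y - x).
  move=> t ht; rewrite coord_NoneE; apply: iter_partial_derivable => //=.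
  apply: le_lt_trans (ler_normD _ _) _; apply: le_lt_trans xy; exact: lerD.
exists (x + xi); first by rewrite addrAC subrr add0r.
by move: E; rewrite !coord_NoneE [x + (y - x)]addrC subrK.
Qed.

Lemma iter_partial_mvt_th s (i : 'I_d) th x (h : R) : (size s < n)%N -> `|x| < del ->
  exists2 xi : R, `|xi| <= `|h| &
    P s (th + h *: delta_mx 0 i, x) - P s (th, x) = h * P (Some i :: s) (th + xi *: delta_mx 0 i, x).
Proof.
move=> sn xd.
have [|xi xih E] := @mvt_line R d (P s) (th, x) (coord_dir R (Some i)) h.
  by move=> t ht; rewrite coord_SomeE; exact: iter_partial_derivable.
by exists xi => //; move: E; rewrite !coord_SomeE.
Qed.

(** The increment is the sum of a step in x and a step in the i-th coordinate,
    each given by the mean value theorem; uniform continuity compares the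
    derivatives at the intermediate points with those at (th, x). *)
Lemma iter_partial_pdiff i rho s : 0 <= rho -> rho < del -> (size s < n)%N ->
  pdiff i rho (fun th x => P s (th, x)) (fun th x => P (Some i :: s) (th, x))
    (fun th x => P (None :: s) (th, x)).
Proof.
move=> r0 rd sn e e0.
(* Between rho and del there is room for the intermediate points. *)
pose r1 := (rho + del) / 2.
have rr1 : rho < r1 by rewrite /r1; lra.
have r1d : r1 < del by rewrite /r1; lra.
have [_ /(_ e e0)[d1 d10 H1]] := iter_partial_slab r1d (s := Some i :: s) sn.
have [_ /(_ e e0)[d2 d20 H2]] := iter_partial_slab r1d (s := None :: s) sn.
pose q := Num.min (r1 - rho) (Num.min d1 d2).
exists q; first by rewrite !lt_min subr_gt0 rr1 d10.
have [qr q1 q2] : [/\ q <= r1 - rho, q <= d1 & q <= d2].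
  by split; rewrite !ge_min lexx ?orbT.
move=> h th x x' hq xr xr' xq.
have rin (y : R) : `|y| <= rho -> `|y| <= r1 by move=> h'; exact: le_trans (ltW rr1).
have [xi xih E1] := iter_partial_mvt_th i th h sn (le_lt_trans xr' rd).
have [|z zx E2] := iter_partial_mvt_x th (x := x) (y := x') sn.
  by apply: le_lt_trans (lerD xr (le_trans xq qr)) _; rewrite addrC subrK.
apply: (increment_bound E1 E2).
  apply: H1; [exact: rin|exact: rin| |exact: le_trans xq q1].
  move=> l; rewrite !mxE addrAC subrr add0r normrM.
  apply: le_trans (le_trans xih (le_trans hq q1)); rewrite ler_piMr //.
  by rewrite eqxx /=; case: (l == i); rewrite ?normr1 ?normr0.
apply: H2 => //; [|exact: rin| |exact: le_trans zx (le_trans xq q2)].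
- have -> : z = x + (z - x) by rewrite addrC subrK.
  apply: le_trans (ler_normD _ _) _; apply: le_trans (lerD xr (le_trans zx (le_trans xq qr))) _.
  by rewrite addrC subrK.
- by move=> l; rewrite subrr normr0 ltW.
Qed.

Lemma slab_nbhs (z : E) : `|z.2| < del -> \forall z' \near z, `|z'.2| < del.
Proof.
move=> zd; apply/nbhs_normP; exists (del - `|z.2|) => /=; first by rewrite subr_gt0.
move=> z' /=; rewrite /Num.norm /= gt_max => /andP[_].
rewrite ltrBrDr => h; have -> : z'.2 = - (z.2 - z'.2) + z.2 by rewrite opprB subrK.
by apply: le_lt_trans (ler_normD _ _) _; rewrite normrN.
Qed.

Lemma iter_partial_ext o (g1 g2 : E -> R) (z : E) : (forall z', `|z'.2| < del -> g1 z' = g2 z') ->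
  `|z.2| < del -> 'D_(coord_dir R o) g1 z = 'D_(coord_dir R o) g2 z.
Proof.
move=> H zd; apply: near_eq_derive.
by have := slab_nbhs zd; apply: filterS => z'; exact: H.
Qed.

Lemma iter_partial_swap (i : 'I_d) s (z : E) : ((size s).+2 <= n)%N -> `|z.2| < del ->
  P (None :: Some i :: s) z = P (Some i :: None :: s) z.
Proof.
move=> sn zd; apply: (@clairaut R d (P s) (coord_dir R (Some i)) (coord_dir R None) z ((del - `|z.2|) / 2)).
- by rewrite divr_gt0// subr_gt0.
- move=> t r tq rq.
  have zd' : `|(z + t *: coord_dir R (Some i) + r *: coord_dir R None).2| < del.
    rewrite /= scaler0 addr0 [r *: 1]mulr1; apply: le_lt_trans (ler_normD _ _) _; lra.
  split.
  + by apply: iter_partial_derivable; [exact: ltnW|exact: zd'].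
  + by apply: iter_partial_derivable; [exact: ltnW|exact: zd'].
  + by apply: (iter_partial_derivable (s := Some i :: s)); [exact: sn|exact: zd'].
  + by apply: (iter_partial_derivable (s := None :: s)); [exact: sn|exact: zd'].
- exact: (iter_partial_continuous (s := None :: Some i :: s)).
- exact: (iter_partial_continuous (s := Some i :: None :: s)).
Qed.

Lemma iter_partial_swapn (i : 'I_d) j s (z : E) : (j + (size s).+1 <= n)%N -> `|z.2| < del ->
  P (nseq j None ++ Some i :: s) z = P (Some i :: nseq j None ++ s) z.
Proof.
elim: j z => [//|j IH] z sn zd.
rewrite -[LHS]/('D_(coord_dir R None) (P (nseq j None ++ Some i :: s)) z).
rewrite (@iter_partial_ext None _ (P (Some i :: nseq j None ++ s)) z _ zd); last first.
  by move=> z' zd'; apply: IH => //; exact: ltnW.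
rewrite -[LHS]/(P (None :: Some i :: nseq j None ++ s) z) iter_partial_swap //.
by rewrite size_cat size_nseq; lia.
Qed.

Lemma iter_partial_nones j th x : P (nseq j None) (th, x) = derive1n j (F th) x.
Proof.
elim: j x => [//|j IH] x /=; rewrite /derive /derive1 /=.
have -> // : (fun h : R => h^-1 *: (P (nseq j None) (h *: (0, 1) + (th, x)) - P (nseq j None) (th, x))) =
  (fun h : R => h^-1 *: (derive1n j (F th) (h + x) - derive1n j (F th) x)).
apply/funext => h; rewrite -!IH; congr (_ *: (P _ _ - _)).
by apply: injective_projections; rewrite /= ?scaler0 ?add0r // [h *: 1]mulr1.
Qed.

Lemma derive_zero_line i (g : E -> R) th : (forall th, g (th, 0) = 0) ->
  'D_(coord_dir R (Some i)) g (th, 0) = 0.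
Proof.
move=> H; rewrite /derive.
have -> : (fun h : R => h^-1 *: ((g \o shift (th, 0)) (h *: coord_dir R (Some i)) - g (th, 0))) = (fun=> 0).
  apply/funext => h /=.
  have -> : h *: (delta_mx 0 i, 0) + (th, 0) = (h *: delta_mx 0 i + th, 0) :> E.
    by apply: injective_projections; rewrite /= ?scaler0 ?addr0.
  by rewrite !H subrr scaler0.
exact: lim_cst.
Qed.

Hypothesis del0 : 0 < del.

(** The prefix nseq j None collects the x-derivatives of the word s met so
    far. An x-derivative at the head of s joins it; a derivative in th commutes
    with it by Clairaut's theorem, and then acts on a function that vanishes on
    all of x = 0. *)
Lemma iter_partial_vanish l : vanishes_to_orderS l F -> forall s j th,
  (j + size s <= n)%N -> (j + count_mem None s <= l)%N -> P (nseq j None ++ s) (th, 0) = 0.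
Proof.
move=> V; elim=> [|[i|] s IH] j th js jl.
- by rewrite cats0 iter_partial_nones V // -[j]addn0.
- rewrite iter_partial_swapn //= ?normr0//.
  apply: derive_zero_line => th'; apply: IH => //.
  by move: js => /=; lia.
- have -> : nseq j None ++ None :: s = nseq j.+1 None ++ s.
    by elim: j {IH js jl} => //= j ->.
  apply: IH.
  + by move: js => /=; lia.
  + by move: jl => /=; lia.
Qed.

(** Each further x-derivative that vanishes at x = 0 contributes a factor |x|,
    by the mean value theorem. *)
Lemma iter_partial_order l rho (M : R) : vanishes_to_orderS l F -> 0 <= rho -> rho < del -> 0 <= M ->
  (forall s, (size s <= n)%N -> forall th x, `|x| <= rho -> `|P s (th, x)| <= M) ->
  forall k s th x, (size s + k <= n)%N -> (count_mem None s + k <= l.+1)%N -> `|x| <= rho ->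
    `|P s (th, x)| <= M * `|x| ^+ k.
Proof.
move=> V r0 rd M0 HM; elim=> [|k IH] s th x sk ck xr.
  by rewrite expr0 mulr1; apply: HM => //; rewrite -[size s]addn0.
have Z : P s (th, 0) = 0.
  by apply: (iter_partial_vanish V (s := s) (j := 0%N)); rewrite add0n; lia.
have [||z zx E] := iter_partial_mvt_x th (s := s) (x := 0) (y := x).
- by lia.
- by rewrite normr0 add0r subr0; exact: le_lt_trans rd.
rewrite !subr0 in zx E; rewrite Z subr0 in E.
rewrite E normrM exprS mulrCA; apply: ler_wpM2l => //.
apply: (@le_trans _ _ (M * `|z| ^+ k)).
  apply: IH; [by move: sk => /=; lia|by move: ck => /=; lia|exact: le_trans zx xr].
by apply: ler_wpM2l => //; apply: lerXn2r; rewrite ?nnegrE.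
Qed.

End class_C.

(** * Forces rescaled around a small equilibrium *)

Section affine.
Context {R : realType} {d : nat}.
Implicit Types (i : 'I_d) (rho a B : R) (G : 'rV[R]_d -> R -> R) (s : seq (option 'I_d)).

Lemma affine_range a rho (u : R) : `|a| * (3 / 2) <= rho -> `|u| <= 2^-1 ->
  `|a * (1 + u)| <= `|a| * (3 / 2) /\ `|a * (1 + u)| <= rho.
Proof.
move=> ar ur; have h : `|a * (1 + u)| <= `|a| * (3 / 2).
  rewrite normrM; apply: ler_wpM2l => //.
  by apply: le_trans (ler_normD _ _) _; rewrite normr1; lra.
by split => //; exact: le_trans ar.
Qed.

Lemma affine_dist a (u u' q : R) : 0 < q -> `|u' - u| <= q / (`|a| + 1) ->
  `|a * (1 + u') - a * (1 + u)| <= q.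
Proof.
move=> q0 h; have -> : a * (1 + u') - a * (1 + u) = a * (u' - u) by ring.
rewrite normrM; apply: le_trans (ler_wpM2l (normr_ge0 a) h) _.
have a1 : 0 < `|a| + 1 by rewrite ltr_wpDl.
by rewrite mulrCA ger_pMr // ler_pdivrMr // mul1r lerDl.
Qed.

Lemma slab_cont_affine rho a G : `|a| * (3 / 2) <= rho -> slab_cont rho G ->
  slab_cont 2^-1 (fun th u => G th (a * (1 + u))).
Proof.
move=> ar [pG cG]; split; first by move=> k th; rewrite pG.
move=> e e0; have [q q0 H] := cG e e0.
have a1 : 0 < `|a| + 1 by rewrite ltr_wpDl.
exists (q / (`|a| + 1)); first by rewrite divr_gt0.
move=> th th' u u' ur ur' h1 h2; apply: H.
- by have [] := affine_range ar ur.
- by have [] := affine_range ar ur'.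
- move=> i; apply: le_trans (h1 i) _.
  by rewrite ler_pdivrMr // ler_peMr ?lerDr// ltW.
- exact: affine_dist.
Qed.

Lemma pdiff_affine i rho a G Gi Gx : `|a| * (3 / 2) <= rho -> pdiff i rho G Gi Gx ->
  pdiff i 2^-1 (fun th u => G th (a * (1 + u))) (fun th u => Gi th (a * (1 + u)))
    (fun th u => a * Gx th (a * (1 + u))).
Proof.
move=> ar H e e0.
have a1 : 0 < `|a| + 1 by rewrite ltr_wpDl.
have [q q0 Hq] := H _ (divr_gt0 e0 a1).
exists (q / (`|a| + 1)); first by rewrite divr_gt0.
move=> h th u u' hh ur ur' uu.
have hq : `|h| <= q.
  by apply: le_trans hh _; rewrite ler_pdivrMr // ler_peMr ?lerDr// ltW.
have [_ r1] := affine_range ar ur; have [_ r2] := affine_range ar ur'.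
have K := Hq h th _ _ hq r1 r2 (affine_dist q0 uu).
have E : a * (1 + u') - a * (1 + u) = a * (u' - u) by ring.
rewrite E in K.
have -> : (u' - u) * (a * Gx th (a * (1 + u))) = a * (u' - u) * Gx th (a * (1 + u)) by ring.
apply: le_trans K _; rewrite normrM.
rewrite -mulrA; apply: ler_wpM2l; first exact: ltW.
rewrite ler_pdivrMl // mulrDr mulrDl mul1r.
rewrite [X in _ <= _ + X]mulrDl mul1r.
have h0 := normr_ge0 h; have u0 := normr_ge0 (u' - u); have a0 := normr_ge0 a.
have p1 : 0 <= `|a| * `|h| by rewrite mulr_ge0.
by move: (`|a| * `|h|) (`|a| * `|u' - u|) p1 h0 u0 => X Y; lra.
Qed.

(** A family of functions indexed by words in the coordinates and closed under
    differentiation, such as the iterated derivatives of F, is all that the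
    recursive definition of [CbF] asks for. *)
Lemma CbF_family i rho B (m : nat) (Psi : seq (option 'I_d) -> 'rV[R]_d -> R -> R) :
  (forall s, (size s <= m)%N -> slab_cont rho (Psi s)) ->
  (forall s, (size s <= m)%N -> forall th (x : R), `|x| <= rho -> `|Psi s th x| <= B) ->
  (forall s, (size s < m)%N -> pdiff i rho (Psi s) (Psi (Some i :: s)) (Psi (None :: s))) ->
  CbF i rho m B (Psi [::]).
Proof.
move=> H1 H2 H3.
suff K : forall j s, (size s + j <= m)%N -> CbF i rho j B (Psi s) by apply: K.
elim=> [|j IH] s sj; split => //; try (apply: H1; lia); try (apply: H2; lia).
exists (Psi (Some i :: s)), (Psi (None :: s)); split; first by apply: H3; lia.
  by apply: IH; rewrite /=; lia.
by apply: IH; rewrite /=; lia.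
Qed.

Lemma CbF_lipschitz i rho j B G th (x x' : R) : CbF i rho j.+1 B G ->
  `|x| < rho -> `|x'| < rho -> `|G th x' - G th x| <= B * `|x' - x|.
Proof.
move=> [_ _ [Gi [Gx [pG _ HGx]]]].
have bGx := CbF_bound HGx.
have D (y : R) : `|y| < rho -> is_derive y (1:R) (G th) (Gx th y).
  move=> yr; apply/is_derive_epsP => e e0.
  have [q q0 Hq] := pG e e0.
  exists (Num.min q (rho - `|y|)); first by rewrite lt_min q0 subr_gt0.
  move=> h; rewrite lt_min => /andP[hq hr].
  have yh : `|y + h| <= rho by apply: le_trans (ler_normD _ _) _; lra.
  have := Hq 0 th y (y + h); rewrite normr0 (ltW q0) => /(_ isT (ltW yr) yh).
  have -> : y + h - y = h by ring.
  by rewrite (ltW hq) => /(_ isT); rewrite scale0r addr0 mul0r subr0 add0r.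
have main (y y' : R) : y <= y' -> `|y| < rho -> `|y'| < rho -> `|G th y' - G th y| <= B * `|y' - y|.
  move=> yy yr yr'.
  have inr (t : R) : y <= t -> t <= y' -> `|t| < rho.
    move: yr yr'; rewrite !ltr_norml => /andP[? ?] /andP[? ?] ? ?; apply/andP; split; lra.
  have [||c] := @MVT_segment _ (G th) (Gx th) y y' yy.
  - by move=> t; rewrite in_itv/= => /andP[t1 t2]; apply: D; apply: inr; exact: ltW.
  - apply: derivable_within_continuous => t; rewrite in_itv/= => /andP[t1 t2].
    by have [] := D t (inr t t1 t2).
  rewrite in_itv/= => /andP[c1 c2] ->.
  by rewrite normrM ler_wpM2r// bGx// ltW// inr.
move=> xr xr'; have [h|h] := leP x x'; first exact: main.
by rewrite distrC [X in _ * X]distrC; apply: main => //; exact: ltW.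
Qed.

End affine.

Section scaled.
Context {R : realType} {d : nat} (F : 'rV[R]_d -> R -> R) (n : nat) (del : R).
Local Notation E := ('rV[R]_d * R)%type.
Local Notation Fz := (fun z : E => F z.1 z.2).
Local Notation P s := (iter_partial s Fz).
Hypothesis pF : torus_periodic F.
Hypothesis cF : class_C n [set z : E | `|z.2| < del] Fz.
Hypothesis del0 : 0 < del.
Implicit Types (s : seq (option 'I_d)) (a : R).

Let half_lt : del / 2 < del. Proof. by rewrite ltr_pdivrMr // ltr_pMr // ltr1n. Qed.
Let half_ge0 : 0 <= del / 2. Proof. by rewrite divr_ge0 // ltW. Qed.

(** The derivative along s of F th (a (1 + u)) in (th, u): each
    differentiation in u contributes a factor a. *)
Definition scaled a s : 'rV[R]_d -> R -> R :=
  fun th u => a ^+ count_mem None s * P s (th, a * (1 + u)).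

Lemma scaled_slab a s : `|a| * (3 / 2) <= del / 2 -> (size s <= n)%N ->
  slab_cont 2^-1 (scaled a s).
Proof.
move=> ar sn; apply: slab_contZ.
exact: (slab_cont_affine ar (iter_partial_slab pF cF half_lt sn)).
Qed.

Lemma scaled_pdiff i a s : `|a| * (3 / 2) <= del / 2 -> (size s < n)%N ->
  pdiff i 2^-1 (scaled a s) (scaled a (Some i :: s)) (scaled a (None :: s)).
Proof.
move=> ar sn.
have H := pdiffZ (a ^+ count_mem None s) (pdiff_affine ar (iter_partial_pdiff pF cF i half_ge0 half_lt sn)).
have -> : scaled a (None :: s) = (fun th u => a ^+ count_mem None s * (a * P (None :: s) (th, a * (1 + u)))).
  by apply/funext => th; apply/funext => u; rewrite /scaled /= add1n exprSr -mulrA.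
exact: H.
Qed.

(** Consider a derivative with b differentiations in u. If b <= l + 1, the
    order of vanishing of F gives |a|^b |a|^(l + 1 - b); if b > l + 1, the factor
    |a|^b suffices. Division by a^l leaves one factor |a|. Up to m + l + 1
    derivatives of F are used. *)
Lemma scaled_order_bound l m : (m + l.+1 <= n)%N -> vanishes_to_orderS l F ->
  exists2 C : R, 0 <= C & forall a, 0 < `|a| -> `|a| <= Num.min 1 (del / 3) -> forall i,
    CbF i 2^-1 m (C * `|a|) (fun th u => a ^- l * F th (a * (1 + u))).
Proof.
move=> mn V.
have mn' : (m <= n)%N by exact: leq_trans (leq_addr _ _) mn.
have [M M0 HM] := iter_partial_bounded_all pF cF half_lt (leqnn n).
exists (M * (3 / 2) ^+ l.+1); first by rewrite mulr_ge0 // exprn_ge0.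
move=> a a0; rewrite le_min => /andP[a1 ad] i.
have ar : `|a| * (3 / 2) <= del / 2 by lra.
have -> : (fun th u => a ^- l * F th (a * (1 + u))) = (fun th u => a ^- l * scaled a [::] th u).
  by apply/funext => th; apply/funext => u; rewrite /scaled /= expr0 mul1r.
apply: (@CbF_family _ _ i 2^-1 _ m (fun s th u => a ^- l * scaled a s th u)).
- by move=> s sm; apply: slab_contZ; apply: scaled_slab; [exact: ar|exact: leq_trans sm mn'].
- move=> s sm th u ur; rewrite /scaled.
  have [r1 r2] := affine_range ar ur; set y := a * (1 + u) in r1 r2 *.
  have sn := leq_trans sm mn'.
  have h32 : 1 <= (3 / 2 : R) by lra.
  set b := count_mem None s.
  have bs : (b <= size s)%N by exact: count_size.
  rewrite !normrM normfV !normrX; set A := `|a| in a0 a1 ar r1 *.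
  have [bl|bl] := leqP b l.+1.
    have k1 : (size s + (l.+1 - b) <= n)%N.
      by apply: leq_trans mn; apply: leq_add => //; exact: leq_subr.
    have k2 : (count_mem None s + (l.+1 - b) <= l.+1)%N by rewrite subnKC.
    have K := iter_partial_order cF del0 V half_ge0 half_lt M0 HM th k1 k2 r2.
    have K2 : `|P s (th, y)| <= M * (A * (3 / 2)) ^+ (l.+1 - b).
      apply: le_trans K _; apply: ler_wpM2l => //; apply: lerXn2r; rewrite ?nnegrE//.
      by apply: mulr_ge0; [exact: ltW|lra].
    rewrite mulrC ler_pdivrMr ?exprn_gt0//.
    apply: le_trans (ler_wpM2l (exprn_ge0 b (ltW a0)) K2) _.
    rewrite exprMn.
    have -> : A ^+ b * (M * (A ^+ (l.+1 - b) * (3 / 2) ^+ (l.+1 - b))) =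
      M * (3 / 2) ^+ (l.+1 - b) * (A ^+ b * A ^+ (l.+1 - b)) by ring.
    rewrite -exprD subnKC // exprS -!mulrA; apply: ler_wpM2l => //.
    apply: ler_wpM2r; first by rewrite mulr_ge0 ?exprn_ge0// ltW.
    exact: (ler_weXn2l h32 (leq_subr b l.+1)).
  have K2 : `|P s (th, y)| <= M by exact: HM.
  rewrite mulrC ler_pdivrMr ?exprn_gt0//.
  apply: le_trans (ler_wpM2l (exprn_ge0 b (ltW a0)) K2) _.
  rewrite mulrC -[leRHS]mulrA -[leRHS]mulrA; apply: ler_wpM2l => //.
  rewrite -exprS; apply: (@le_trans _ _ (A ^+ l.+1)).
    by apply: ler_wiXn2l; [exact: ltW|exact: a1|exact: ltnW].
  by rewrite ler_peMl ?exprn_ege1// exprn_ge0// ltW.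
- by move=> s sm; apply: pdiffZ; apply: scaled_pdiff; [exact: ar|exact: leq_trans sm mn'].
Qed.

(** A derivative with at least one differentiation in u carries a factor a.
    One without is the increment of a derivative of F between x = 0 and x = a (1 +
    u), which is O(a) by the mean value theorem. T s is the derivative of the
    subtracted term, and it is 0 as soon as s differentiates in u. *)
Lemma scaled_increment_bound m : (m.+1 <= n)%N ->
  exists2 C : R, 0 <= C & forall a, 0 < `|a| -> `|a| <= Num.min 1 (del / 3) -> forall i,
    CbF i 2^-1 m (C * `|a|) (fun th u => F th (a * (1 + u)) - F th 0).
Proof.
move=> mn.
have [M M0 HM] := iter_partial_bounded_all pF cF half_lt (leqnn n).
exists (M * 2); first by rewrite mulr_ge0.
move=> a a0; rewrite le_min => /andP[a1 ad] i.
have ar : `|a| * (3 / 2) <= del / 2 by lra.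
pose T s : 'rV[R]_d -> R -> R := fun th u => if count_mem None s == 0%N then P s (th, 0) else 0.
have zr : `|0 : R| <= del / 2 by rewrite normr0.
have T_slab s : (size s <= n)%N -> slab_cont 2^-1 (T s).
  move=> sn; have [pP cP] := iter_partial_slab pF cF half_lt sn; split.
    by move=> k th; apply/funext => u; rewrite /T (iter_partial_periodic pF).
  move=> e e0; have [q q0 Hq] := cP e e0; exists q => // th th' u u' _ _ h _.
  rewrite /T; case: ifP => _; last by rewrite subrr normr0 ltW.
  by apply: Hq => //; rewrite subrr normr0 ltW.
have T_pdiff s : (size s < n)%N -> pdiff i 2^-1 (T s) (T (Some i :: s)) (T (None :: s)).
  move=> sn e e0; have [q q0 Hq] := iter_partial_pdiff pF cF i half_ge0 half_lt sn e0.
  exists q => // h th u u' hq _ _ _.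
  rewrite {4}/T /= mulr0 subr0 /T /= add0n; case: ifP => _; last first.
    by rewrite subrr mulr0 subr0 normr0 mulr_ge0 ?addr_ge0// ltW.
  have := Hq h th 0 0 hq zr zr; rewrite subrr normr0 (ltW q0) => /(_ isT).
  rewrite mul0r subr0 addr0 => /le_trans; apply.
  by apply: ler_wpM2l; [exact: ltW|rewrite lerDl].
have -> : (fun th u => F th (a * (1 + u)) - F th 0) = (fun th u => scaled a [::] th u + -1 * T [::] th u).
  by apply/funext => th; apply/funext => u; rewrite /scaled /T /= expr0 mul1r mulN1r.
apply: (@CbF_family _ _ i 2^-1 _ m (fun s th u => scaled a s th u + -1 * T s th u)).
- move=> s sm; have sn := leq_trans sm (ltnW mn).
  by apply: slab_contD; [exact: scaled_slab|apply: slab_contZ; exact: T_slab].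
- move=> s sm th u ur; rewrite /scaled /T.
  have [r1 r2] := affine_range ar ur; set y := a * (1 + u) in r1 r2 *.
  case: eqP => [b0|/eqP b0].
    rewrite b0 expr0 mul1r mulN1r.
    have [||z zy ->] := iter_partial_mvt_x cF th (s := s) (x := 0) (y := y).
    + exact: leq_ltn_trans sm mn.
    + by rewrite normr0 add0r subr0; exact: le_lt_trans half_lt.
    rewrite !subr0 in zy *; rewrite normrM -mulrA mulrC.
    apply: ler_pM => //.
      by apply: (HM (None :: s)); [exact: leq_ltn_trans sm mn|exact: le_trans zy r2].
    by apply: le_trans r1 _; rewrite mulrC; apply: ler_wpM2r => //; lra.
  rewrite mulr0 addr0 normrM normrX.
  have K2 : `|P s (th, y)| <= M by apply: HM => //; exact: leq_trans sm (ltnW mn).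
  rewrite mulrC -mulrA; apply: ler_pM => //.
  apply: (@le_trans _ _ `|a|); last by rewrite ler_peMl // ler1n.
  by rewrite -[leRHS]expr1; apply: ler_wiXn2l => //; rewrite lt0n.
- move=> s sm; have sn := leq_trans sm (ltnW mn).
  by apply: pdiffD; [exact: scaled_pdiff|apply: pdiffZ; exact: T_pdiff].
Qed.

End scaled.

(** * Fixed points of the rescaled equation *)

Section binomial_tail.
Context {R : realType} {d : nat}.

Definition bintail (l : nat) (u : R) : R := (1 + u) ^+ l - 1 - l%:R * u.

Lemma bintailS l u : bintail l.+1 u = bintail l u + u * bintail l u + l%:R * (u * u).
Proof.
have E : l.+1%:R = l%:R + 1 :> R by rewrite -natr1.
by rewrite /bintail E exprS; ring.
Qed.

Lemma bintail0 u : bintail 0 u = 0.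
Proof. by rewrite /bintail expr0 subrr mul0r subrr. Qed.

(** The recursion on l expresses bintail through products of two small
    factors. *)
Lemma bintail_Cb l m : exists2 Q : R, 0 <= Q & forall (i : 'I_d) (tau : R) (U : 'rV[R]_d -> R),
  tau <= 1 -> Cb i m tau U -> Cb i m (Q * tau ^+ 2) (fun th => bintail l (U th)).
Proof.
elim: l => [|l [Q Q0 IH]].
  exists 0 => // i tau U _ _; rewrite mul0r.
  under eq_fun do rewrite bintail0.
  by apply: Cb_mono (Cb_cst i m 0); rewrite normr0.
exists (Q + 2 ^+ m * Q + l%:R * 2 ^+ m).
  by rewrite !addr_ge0 ?mulr_ge0 ?exprn_ge0.
move=> i tau U t1 HU; have t0 := Cb_ge0 HU; have HQ := IH i tau U t1 HU.
under eq_fun do rewrite bintailS.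
apply: Cb_mono (CbD (CbD HQ (CbM HU HQ)) (CbZ l%:R (CbM HU HU))).
rewrite normr_nat !mulrDl; apply: lerD; first apply: lerD => //.
  rewrite -mulrA; apply: ler_wpM2l; first exact: exprn_ge0.
  by rewrite ler_piMl// mulr_ge0 ?sqr_ge0.
by rewrite -expr2 mulrA.
Qed.

Lemma bintail_lipschitz l : exists2 L : R, 0 <= L & forall tau u v : R, tau <= 1 ->
  `|u| <= tau -> `|v| <= tau -> `|bintail l u - bintail l v| <= L * tau * `|u - v|.
Proof.
elim: l => [|l [L L0 IH]].
  by exists 0 => // tau u v *; rewrite !bintail0 subrr normr0 !mul0r.
exists (3 * L + 2 * l%:R).
  by rewrite addr_ge0 ?mulr_ge0.
move=> tau u v t1 ut vt; have t0 : 0 <= tau by exact: le_trans ut.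
have H1 := IH tau u v t1 ut vt.
have H2 : `|bintail l v| <= L * tau.
  have Z : bintail l 0 = 0 by rewrite /bintail addr0 expr1n mulr0 subrr subr0.
  have := IH tau v 0 t1 vt; rewrite normr0 Z !subr0 => /(_ t0) h; apply: le_trans h _.
  by rewrite ler_piMr ?mulr_ge0 // (le_trans vt).
rewrite !bintailS.
have -> : bintail l u + u * bintail l u + l%:R * (u * u) - (bintail l v + v * bintail l v + l%:R * (v * v)) =
  (1 + u) * (bintail l u - bintail l v) + (u - v) * bintail l v + l%:R * (u + v) * (u - v) by ring.
have n0 := normr_ge0 (u - v).
have b1 : `|(1 + u) * (bintail l u - bintail l v)| <= 2 * (L * tau * `|u - v|).
  rewrite normrM; apply: ler_pM => //; apply: le_trans (ler_normD _ _) _.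
  by rewrite normr1; move: ut; lra.
have b2 : `|(u - v) * bintail l v| <= `|u - v| * (L * tau).
  by rewrite normrM ler_wpM2l.
have b3 : `|l%:R * (u + v) * (u - v)| <= l%:R * (2 * tau) * `|u - v|.
  rewrite !normrM normr_nat; apply: ler_wpM2r => //; apply: ler_wpM2l => //.
  by apply: le_trans (ler_normD _ _) _; lra.
apply: le_trans (ler_normD _ _) _; apply: le_trans (lerD (ler_normD _ _) (lexx _)) _.
apply: le_trans (lerD (lerD b1 b2) b3) _.
by rewrite le_eqVlt; apply/orP; left; apply/eqP; ring.
Qed.

End binomial_tail.

Section small_averages.
Context {R : realType} {d : nat} (omega : 'rV[R]_d).

(** Abel means commute with derivatives, and derivatives have mean zero, so
    the ergodic theorem applies at each order. *)
Lemma abel_Cb_small i j B (g : 'rV[R]_d -> R) (eta : R) : nonresonant omega -> Cb i j B g ->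
  tmean g = 0 -> 0 < eta -> exists2 lam0 : R, 0 < lam0 &
    forall lam, 0 < lam -> lam < lam0 -> Cb i j eta (abel omega lam g).
Proof.
move=> nr Hg mg e0; elim: j g Hg mg => [|j IH] g [cg bg H] mg.
  have [l0 l00 Hl] := abel_ergodic nr cg e0; exists l0 => // lam h1 h2; split => //.
    exact: abel_torus_cont.
  by move=> th; rewrite -[X in `|X|]subr0 -mg; exact: Hl.
have [v uv cv] := H.
have [l0 l00 Hl] := abel_ergodic nr cg e0.
have [l1 l10 Hl1] := IH v cv (udiff_tmean0 cg (Cb_cont cv) uv).
exists (Num.min l0 l1); first by rewrite lt_min l00.
move=> lam h1; rewrite lt_min => /andP[h2 h3]; split.
- exact: abel_torus_cont.
- by move=> th; rewrite -[X in `|X|]subr0 -mg; exact: Hl.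
- by exists (abel omega lam v); [apply: abel_udiff => //; exact: Cb_cont cv|exact: Hl1].
Qed.

Lemma abel_Cb_small_all j B (g : 'rV[R]_d -> R) (eta : R) : nonresonant omega ->
  (forall i, Cb i j B g) -> tmean g = 0 -> 0 < eta -> exists2 lam0 : R, 0 < lam0 &
    forall lam, 0 < lam -> lam < lam0 -> forall i, Cb i j eta (abel omega lam g).
Proof.
move=> nr Hg mg e0.
have K (i : 'I_d) : exists l0 : R, 0 < l0 /\ forall lam, 0 < lam -> lam < l0 -> Cb i j eta (abel omega lam g).
  by have [l0 ? ?] := abel_Cb_small nr (Hg i) mg e0; exists l0.
have [l Hl] := choice K.
have S0 : 0 < \sum_i (l i)^-1 + 1.
  by rewrite ltr_wpDl// sumr_ge0 // => i _; have [h _] := Hl i; rewrite invr_ge0 ltW.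
exists (\sum_i (l i)^-1 + 1)^-1; first by rewrite invr_gt0.
move=> lam h1 h2 i; have [li0 H] := Hl i; apply: H => //; apply: lt_le_trans h2 _.
rewrite -[leRHS]invrK lef_pV2 ?posrE ?invr_gt0//.
rewrite (bigD1 i) //= -addrA lerDl addr_ge0// sumr_ge0 // => i' _.
by have [h _] := Hl i'; rewrite invr_ge0 ltW.
Qed.

End small_averages.

Section class_C_CbF.
Context {R : realType} {d : nat} (F : 'rV[R]_d -> R -> R) (n : nat) (del : R).
Local Notation E := ('rV[R]_d * R)%type.
Hypothesis pF : torus_periodic F.
Hypothesis cF : class_C n [set z : E | `|z.2| < del] (fun z : E => F z.1 z.2).
Hypothesis del0 : 0 < del.

(** F th 0 is the composition of F with the zero function. *)
Lemma class_C_zero_section m : (m <= n)%N -> exists B : R, forall i : 'I_d, Cb i m B (fun th => F th 0).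
Proof.
move=> mn; have h2 : del / 2 < del by rewrite ltr_pdivrMr // ltr_pMr // ltr1n.
have h0 : 0 <= del / 2 by rewrite divr_ge0 // ltW.
have [M M0 HM] := iter_partial_bounded_all pF cF h2 (leqnn n).
exists (comp_const m * M) => i.
pose Psi s : 'rV[R]_d -> R -> R := fun th x => iter_partial s (fun z : E => F z.1 z.2) (th, x).
have C : CbF i (del / 2) m M (Psi [::]).
  apply: CbF_family.
  - by move=> s sm; exact: (iter_partial_slab pF cF h2 (leq_trans sm mn)).
  - by move=> s sm th x xr; apply: HM => //; exact: leq_trans mn.
  - by move=> s sm; exact: (iter_partial_pdiff pF cF i h0 h2 (leq_trans sm mn)).
have := @Cb_comp R d i (del / 2) m M (Psi [::]) (fun=> 0) C; apply.
  by move=> th; rewrite normr0.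
by apply: Cb_mono (Cb_cst i m 0); rewrite normr0.
Qed.

End class_C_CbF.

Section fixed_point.
Context {R : realType} {d : nat} (omega : 'rV[R]_d) (l m : nat).
Variables (lam tau B eta Q : R) (G : 'rV[R]_d -> R -> R) (g : 'rV[R]_d -> R).
Hypothesis l0 : (0 < l)%N.
Hypothesis d0 : (0 < d)%N.
Hypothesis lam0 : 0 < lam.
Hypothesis tau0 : 0 <= tau.
Hypothesis tau_half : tau <= 2^-1.
Hypothesis cg : torus_cont g.
Hypothesis small_g : forall i, Cb i m eta (abel omega lam g).
Hypothesis HG : forall i, CbF i 2^-1 m B G.
Hypothesis HQ : forall (i : 'I_d) (U : 'rV[R]_d -> R),
  Cb i m tau U -> Cb i m (Q * tau ^+ 2) (fun th => bintail l (U th)).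
Hypothesis budget : Q * tau ^+ 2 + comp_const m * B + eta <= l%:R * tau.
Hypothesis lip : forall th (u v : R), `|u| <= tau -> `|v| <= tau ->
  `|(bintail l u + G th u) - (bintail l v + G th v)| <= l%:R / 2 * `|u - v|.

Let N (U : 'rV[R]_d -> R) th : R := bintail l (U th) + G th (U th).
(** Along the flow, A F solves y' = lam (y - F) for A the Abel mean; so a
    fixed point of Psi solves U' = lam U + (lam / l) (N U - g). *)
Let Psi (U : 'rV[R]_d -> R) th : R := - l%:R^-1 * (abel omega lam (N U) th - abel omega lam g th).

Let lr0 : 0 < l%:R :> R. Proof. by rewrite ltr0n. Qed.

Lemma N_torus_cont U : torus_cont U -> (forall th, `|U th| <= tau) -> torus_cont (N U).
Proof.
move=> cU bU; apply: torus_contD; last first.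
  apply: (slab_cont_comp (CbF_cont (HG (Ordinal d0)))) => // th.
  exact: le_trans (bU th) tau_half.
rewrite /bintail; have cX n : torus_cont (fun th => (1 + U th) ^+ n).
  elim: n => [|n IH]; first exact: torus_cont_cst.
  under eq_fun do rewrite exprS.
  by apply: torus_contM => //; apply: torus_contD => //; exact: torus_cont_cst.
by apply: torus_contB; [apply: torus_contB => //; exact: torus_cont_cst|exact: torus_contZ].
Qed.

Lemma Psi_Cb U : (forall i, Cb i m tau U) -> forall i, Cb i m tau (Psi U).
Proof.
move=> HU i.
have t1 : tau <= 1 by apply: le_trans tau_half _; rewrite invf_le1 ?ler1n.
have bU := Cb_bound (HU i).
have H1 := CbD (HQ (HU i)) (Cb_comp (HG i) (fun th => le_trans (bU th) tau_half) (Cb_mono t1 (HU i))).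
have H2 := CbD (abel_Cb omega lam H1) (CbZ (-1) (small_g i)).
have H3 := CbZ (- l%:R^-1) H2.
have -> : Psi U = (fun th => - l%:R^-1 * (abel omega lam (N U) th + -1 * abel omega lam g th)).
  by apply/funext => th; rewrite /Psi mulN1r.
apply: Cb_mono H3; rewrite normrN normfV normr_nat normrN1 mul1r.
by rewrite ler_pdivrMl.
Qed.

(** The contraction is in the sup norm, which only asks for a Lipschitz bound
    on the nonlinearity itself; the derivatives of the iterates are merely kept
    bounded, by [Psi_Cb]. *)
Lemma Psi_contract U V (e : R) : torus_cont U -> torus_cont V ->
  (forall th, `|U th| <= tau) -> (forall th, `|V th| <= tau) ->
  (forall th, `|U th - V th| <= e) -> forall th, `|Psi U th - Psi V th| <= e / 2.
Proof.
move=> cU cV bU bV H th.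
have NU := N_torus_cont cU bU; have NV := N_torus_cont cV bV.
have -> : Psi U th - Psi V th = - l%:R^-1 * (abel omega lam (N U) th - abel omega lam (N V) th).
  by rewrite /Psi; ring.
rewrite -abelB // normrM normrN normfV normr_nat ler_pdivrMl //.
apply: abel_bound; first exact: torus_contB.
move=> x; apply: le_trans (lip x (bU x) (bV x)) _.
have -> : l%:R * (e / 2) = l%:R / 2 * e by ring.
by apply: ler_wpM2l => //; rewrite divr_ge0.
Qed.

Let it n := iter n Psi (fun=> 0).

Lemma it_Cb n : forall i, Cb i m tau (it n).
Proof.
elim: n => [|n IH] i; last exact: Psi_Cb.
by apply: Cb_mono (Cb_cst i m 0); rewrite normr0.
Qed.

Let it_cont n : torus_cont (it n). Proof. exact: Cb_cont (it_Cb n (Ordinal d0)). Qed.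
Let it_bound n th : `|it n th| <= tau. Proof. exact: Cb_bound (it_Cb n (Ordinal d0)) th. Qed.

Lemma it_step n th : `|it n.+1 th - it n th| <= tau * 2^-1 ^+ n.
Proof.
elim: n th => [|n IH] th.
  by rewrite expr0 mulr1 /= subr0; exact: (it_bound 1).
rewrite exprSr mulrA.
exact: (Psi_contract (it_cont n.+1) (it_cont n) (it_bound n.+1) (it_bound n) IH).
Qed.

Lemma it_cauchy n p th : `|it (n + p) th - it n th| <= 2 * tau * 2^-1 ^+ n - tau * 2 * 2^-1 ^+ (n + p).
Proof.
elim: p => [|p IH]; first by rewrite addn0 subrr normr0 [2 * tau]mulrC subrr.
rewrite addnS; have := it_step (n + p) th; set a := it (n + p).+1 th => h.
have -> : a - it n th = (a - it (n + p) th) + (it (n + p) th - it n th) by ring.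
apply: le_trans (ler_normD _ _) _; apply: le_trans (lerD h IH) _.
rewrite exprS; move: (2^-1 ^+ (n + p)) (2^-1 ^+ n) => X Y.
have -> : tau * 2 * (2^-1 * X) = tau * X by field.
by rewrite le_eqVlt; apply/orP; left; apply/eqP; ring.
Qed.

Lemma fixed_point_exists : exists U : 'rV[R]_d -> R,
  [/\ torus_cont U, forall th, `|U th| <= tau,
      forall e : R, 0 < e -> exists2 u, (forall th, `|U th - u th| <= e) & forall i, Cb i m tau u &
      forall th t, is_derive t (1:R) (fun t : R => U (th + t *: omega))
        (lam * U (th + t *: omega) + lam / l%:R * (N U (th + t *: omega) - g (th + t *: omega)))].
Proof.
pose D n : R := 2 * tau * 2^-1 ^+ n.
have D0 n : 0 <= D n by rewrite !mulr_ge0 // exprn_ge0 // invr_ge0.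
have half0 n : 0 <= (2^-1 : R) ^+ n by rewrite exprn_ge0 // invr_ge0.
have near n p th : (n <= p)%N -> `|it p th - it n th| <= D n.
  move=> /subnKC <-; apply: le_trans (it_cauchy _ _ _) _.
  by rewrite /D lerBlDr lerDl !mulr_ge0.
(* The limit as a cut: each it n th - D n is below each it p th + D p. *)
pose S th : set R := [set x | exists n, x = it n th - D n].
pose U th := sup (S th).
have ub n th : ubound (S th) (it n th + D n).
  move=> x [p ->]; have [np|pn] := leqP n p.
    by have := near n p th np; have := D0 p; rewrite ler_norml => ? /andP[_ ?]; lra.
  by have := near p n th (ltnW pn); have := D0 n; rewrite ler_norml => ? /andP[? _]; lra.
have Sne th : S th !=set0 by exists (it 0 th - D 0%N), 0%N.
have hs th : has_sup (S th) by split; [exact: Sne|exists (it 0 th + D 0%N); exact: ub].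
have close n th : `|U th - it n th| <= D n.
  rewrite ler_distl; apply/andP; split.
    by apply: sup_upper_bound; [exact: hs|exists n].
  by apply: sup_le_ub; [exact: Sne|exact: ub].
have small (e : R) : 0 < e -> exists n, D n <= e.
  move=> e0; pose n := Num.bound (2 * tau / e); exists n.
  have hn : 2 * tau / e < n%:R by apply: archi_boundP; rewrite divr_ge0 ?mulr_ge0 // ltW.
  have h2 : n%:R <= (2 : R) ^+ n.
    by rewrite -natrX ler_nat ltnW // ltn_expl.
  rewrite /D exprVn ler_pdivrMr ?exprn_gt0//.
  rewrite ltr_pdivrMr // in hn; rewrite mulrC; apply: le_trans (ltW _) _.
    by rewrite mulrC; exact: hn.
  by rewrite mulrC; apply: ler_wpM2l => //; exact: ltW.
have cU : torus_cont U.
  apply: torus_cont_unif_lim.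
    move=> k th; rewrite /U /S; congr sup; apply/funext => x; apply/propext.
    have E n : it n (th + (2 * pi) *: zvec R k) = it n th by have [p _] := it_cont n; rewrite p.
    by split => -[n ->]; exists n; rewrite E.
  move=> e e0; have [n hn] := small e e0; exists (it n); first exact: it_cont.
  by move=> th; exact: le_trans (close n th) hn.
have bU th : `|U th| <= tau.
  apply/ler_addgt0Pr => e e0; have [n hn] := small e e0.
  have -> : U th = it n th + (U th - it n th) by ring.
  apply: le_trans (ler_normD _ _) _; apply: lerD; first exact: it_bound.
  exact: le_trans (close n th) hn.
have fix_U th : U th = Psi U th.
  apply/eqP; rewrite -subr_eq0 -normr_eq0 eq_le normr_ge0 andbT.
  apply/ler_addgt0Pr => e e0; rewrite add0r; have e20 : 0 < e / 2 by rewrite divr_gt0.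
  have [n hn] := small _ e20.
  have c1 x : `|it n x - U x| <= D n by rewrite distrC; exact: close.
  have h1 := Psi_contract (it_cont n) cU (it_bound n) bU c1 th.
  have h2 := close n.+1 th.
  have h3 : D n.+1 <= e / 2.
    have e1 : D n.+1 = 2^-1 * D n by rewrite /D exprS; ring.
    by apply: le_trans hn; rewrite e1; have := D0 n; lra.
  have -> : U th - Psi U th = (U th - it n.+1 th) + (Psi (it n) th - Psi U th).
    by rewrite -[it n.+1 th]/(Psi (it n) th); ring.
  apply: le_trans (ler_normD _ _) _; rewrite [e]splitr; apply: lerD; first exact: le_trans h3.
  by apply: le_trans h1 _; have := D0 n; lra.
exists U; split => //.
  move=> e e0; have [n hn] := small e e0; exists (it n); last exact: it_Cb.
  by move=> th; exact: le_trans (close n th) hn.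
move=> th t.
have cN := torus_contB (N_torus_cont cU bU) cg.
have H := @is_deriveZ _ _ _ _ (- l%:R^-1) _ _ _ (abel_flow omega th lam0 cN t).
have E x : U x = - l%:R^-1 * abel omega lam (fun y => N U y - g y) x.
  by rewrite {1}fix_U /Psi abelB //; exact: N_torus_cont.
have -> : (fun t : R => U (th + t *: omega)) = (- l%:R^-1) \*: (fun t : R => abel omega lam (fun y => N U y - g y) (th + t *: omega)).
  by apply/funext => s; rewrite E.
apply: (is_derive_eq H); rewrite (E (th + t *: omega)).
set A := abel _ _ _ _; set n1 := N _ _; set g1 := g _.
change (- l%:R^-1 * (lam * (A - (n1 - g1))) = lam * (- l%:R^-1 * A) + lam / l%:R * (n1 - g1)).
ring.
Qed.

End fixed_point.

(** * The dominant balance and the rescaled equation *)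

Section root.
Context {R : realType}.

Lemma eps_range_small (l : nat) (c eps0 eps : R) :
  eps \in eps_range l c eps0 -> `|eps| < eps0.
Proof.
rewrite /eps_range; case: ifP => _; last case: ifP => _; rewrite in_itv/= => /andP[h1 h2].
- by rewrite ltr_norml h1 h2.
- by rewrite ltr0_norm // ltrNl.
- by rewrite gtr0_norm.
Qed.

(** The sign of a is that of - eps c if l is odd, and a > 0 if l is even,
    where the range of eps ensures that - eps c > 0. In both cases a^(l - 1) >
    0. *)
Lemma balance_root (l : nat) (c eps0 eps : R) : (0 < l)%N -> c != 0 -> eps != 0 ->
  eps \in eps_range l c eps0 -> exists a : R,
  [/\ a ^+ l + eps * c = 0, `|a| = `|c| `^ l%:R^-1 * `|eps| `^ l%:R^-1 & 0 < a ^+ l.-1].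
Proof.
move=> l0 c0 e0 er.
pose r := `|c| `^ l%:R^-1 * `|eps| `^ l%:R^-1.
have lr : l%:R != 0 :> R by rewrite pnatr_eq0 -lt0n.
have cn : 0 < `|c| by rewrite normr_gt0.
have en : 0 < `|eps| by rewrite normr_gt0.
have r0 : 0 < r by rewrite mulr_gt0 // powR_gt0.
have rl : r ^+ l = `|eps * c|.
  rewrite /r exprMn -!powR_mulrn ?powR_ge0// -!powRrM mulVf // !powRr1 //.
  by rewrite normrM mulrC.
have rp : 0 < r ^+ l.-1 by exact: exprn_gt0.
have [neg|pos] := ltP (eps * c) 0.
  exists r; split => //; last by rewrite gtr0_norm.
  by rewrite rl ltr0_norm // addNr.
have ol : odd l.
  apply/negPn/negP => nol; move: er; rewrite /eps_range (negbTE nol); case: ltP => c00; rewrite in_itv/= => /andP[h1 h2].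
    by move: pos; rewrite leNgt nmulr_rlt0 // c00.
  have c1 : c < 0 by rewrite lt_neqAle c0 c00.
  by move: pos; rewrite leNgt pmulr_rlt0 // c1.
have el : ~~ odd l.-1 by move: ol; rewrite -{1}(prednK l0).
exists (- r); split.
- by rewrite exprNn -signr_odd ol expr1 mulN1r rl ger0_norm // addNr.
- by rewrite normrN gtr0_norm.
- by rewrite exprNn -signr_odd (negbTE el) expr0 mul1r.
Qed.

End root.

Section rescaled_rhs.
Context {R : realType} (l d m : nat) (omega : 'rV[R]_d) (f h : 'rV[R]_d -> R -> R) (eps a c : R).
Hypothesis l0 : (0 < l)%N.
Hypothesis a0 : a != 0.
Hypothesis c0 : c != 0.
Hypothesis ac : a ^+ l + eps * c = 0.

(** Since eps = - a^l / c, this is what h and the x-dependence of f contribute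
    after division by a^l, at x = a (1 + u). *)
Definition reduced_force : 'rV[R]_d -> R -> R := fun th u =>
  a ^- l * h th (a * (1 + u)) + - c^-1 * (f th (a * (1 + u)) - f th 0).

Definition osc_force : 'rV[R]_d -> R := fun th => c^-1 * f th 0 - 1.

Lemma rhs_rescaled th (u : R) :
  (a + a * u) ^+ l + h th (a + a * u) + eps * f th (a + a * u) =
  a * ((l%:R * a ^+ l.-1) * u + (l%:R * a ^+ l.-1) / l%:R * (bintail l u + reduced_force th u - osc_force th)).
Proof.
have lr : l%:R != 0 :> R by rewrite pnatr_eq0 -lt0n.
have al : a ^+ l != 0 by rewrite expf_neq0.
have E : eps = - a ^+ l * c^-1.
  have : eps * c = - a ^+ l by apply/eqP; rewrite -subr_eq0 opprK addrC ac.
  by move=> <-; rewrite mulfK.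
have xE : a + a * u = a * (1 + u) by ring.
have pE : a * a ^+ l.-1 = a ^+ l by rewrite -exprS prednK.
rewrite xE /reduced_force /osc_force; set F := f th _; set H := h th _; set F0 := f th 0.
rewrite exprMn E.
have -> : a * (l%:R * a ^+ l.-1 * u + l%:R * a ^+ l.-1 / l%:R * (bintail l u + (a ^- l * H + - c^-1 * (F - F0)) - (c^-1 * F0 - 1))) =
  (a * a ^+ l.-1) * (l%:R * u + l%:R / l%:R * (bintail l u + (a ^- l * H + - c^-1 * (F - F0)) - (c^-1 * F0 - 1))) by ring.
rewrite pE divff // mul1r /bintail.
have -> : a ^+ l * (l%:R * u + ((1 + u) ^+ l - 1 - l%:R * u + (a ^- l * H + - c^-1 * (F - F0)) - (c^-1 * F0 - 1))) =
  a ^+ l * (1 + u) ^+ l + (a ^+ l * a ^- l) * H - a ^+ l * c^-1 * F by ring.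
by rewrite divff // mul1r; ring.
Qed.

End rescaled_rhs.

(** * Existence and local uniqueness *)

Section rescaling.
Context {R : realType} {d : nat} (l : nat) (omega : 'rV[R]_d).

Definition rescaled_field (lam : R) (G : 'rV[R]_d -> R -> R) (g U : 'rV[R]_d -> R) (th : 'rV[R]_d) : R :=
  lam * U th + lam / l%:R * (bintail l (U th) + G th (U th) - g th).

Lemma solves_rescaled (f h : 'rV[R]_d -> R -> R) (eps a c : R) (U : 'rV[R]_d -> R) :
  (0 < l)%N -> a != 0 -> c != 0 -> a ^+ l + eps * c = 0 ->
  solves l omega f h eps (response omega a (fun th => a * U th)) <->
  forall t, is_derive t (1:R) (fun t : R => U (t *: omega))
    (rescaled_field (l%:R * a ^+ l.-1) (reduced_force l f h a c) (osc_force f c) U (t *: omega)).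
Proof.
move=> l0 a0 c0 ac; split => H t.
  have D := is_deriveZ a^-1 (is_deriveB (H t) (is_derive_cst a t 1)).
  have E : (fun t : R => U (t *: omega)) =
      a^-1 \*: (response omega a (fun th => a * U th) - cst a).
    apply/funext => s.
    change (U (s *: omega) = a^-1 * (a + a * U (s *: omega) - a)).
    by rewrite addrAC subrr add0r mulKf.
  rewrite E; apply: (is_derive_eq D).
  rewrite subr0 /response (rhs_rescaled f h l0 a0 c0 ac).
  exact: mulKf.
have D := is_deriveD (is_derive_cst a t 1) (is_deriveZ a (H t)).
apply: (is_derive_eq D).
by rewrite add0r /response (rhs_rescaled f h l0 a0 c0 ac).
Qed.

(** The difference of the two solutions along the orbit of 0 satisfies y' =
    lam y + r with |r| <= (lam / 2) |y|, so it vanishes; and the orbit determines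
    the functions. *)
Lemma rescaled_unique (lam tau : R) (G : 'rV[R]_d -> R -> R) (g U W : 'rV[R]_d -> R) :
  (0 < l)%N -> 0 < lam -> nonresonant omega -> torus_cont U -> torus_cont W ->
  (forall th, `|U th| <= tau) -> (forall th, `|W th| <= tau) ->
  (forall th (u v : R), `|u| <= tau -> `|v| <= tau ->
    `|(bintail l u + G th u) - (bintail l v + G th v)| <= l%:R / 2 * `|u - v|) ->
  (forall t, is_derive t (1:R) (fun t : R => U (t *: omega)) (rescaled_field lam G g U (t *: omega))) ->
  (forall t, is_derive t (1:R) (fun t : R => W (t *: omega)) (rescaled_field lam G g W (t *: omega))) ->
  W = U.
Proof.
move=> l0 lam0 nr cU cW bU bW lip HU HW.
have lr : 0 < l%:R :> R by rewrite ltr0n.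
pose y t := W (t *: omega) - U (t *: omega).
pose NL V th := bintail l (V th) + G th (V th).
pose r t := lam / l%:R * (NL W (t *: omega) - NL U (t *: omega)).
have y0 t : y t = 0.
  apply: (@bounded_exp_growth_eq0 R y r lam (tau + tau)) => //.
  - by move=> s; apply: le_trans (ler_normB _ _) _; exact: lerD.
  - move=> s; apply: (is_derive_eq (is_deriveB (HW s) (HU s))).
    by rewrite /rescaled_field /y /r /NL; ring.
  - have q0 : 0 <= lam / l%:R by apply: divr_ge0; exact: ltW.
    move=> s; rewrite /r normrM (ger0_norm q0).
    apply: le_trans (ler_wpM2l q0 (lip (s *: omega) _ _ (bW _) (bU _))) _.
    rewrite -/(y s) mulrA; apply: ler_wpM2r => //.
    by rewrite le_eqVlt; apply/orP; left; apply/eqP; field; rewrite gt_eqF.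
apply/funext => th; apply/eqP; rewrite -subr_eq0; apply/eqP.
exact: (orbit_determines nr (torus_contB cW cU) y0 th).
Qed.

End rescaling.

Section forces.
Context {R : realType} {d : nat} (l m q n : nat) (f h : 'rV[R]_d -> R -> R) (c : R).
Local Notation E := ('rV[R]_d * R)%type.
Hypothesis pf : torus_periodic f.
Hypothesis cf : class_C n setT (fun z : E => f z.1 z.2).
Hypothesis ph : torus_periodic h.
Hypothesis ch : class_C_bounded_near0 q h.
Hypothesis vh : vanishes_to_orderS l h.
Hypothesis mn : (m.+1 <= n)%N.
Hypothesis mq : (m + l.+1 <= q)%N.

Let cf1 : class_C n [set z : E | `|z.2| < 1] (fun z : E => f z.1 z.2).
Proof. by move=> s z sn _; exact: cf. Qed.

Lemma reduced_force_small : exists2 a1 : R, 0 < a1 & exists2 C : R, 0 <= C &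
  forall a, 0 < `|a| -> `|a| <= a1 -> forall i, CbF i 2^-1 m (C * `|a|) (reduced_force l f h a c).
Proof.
have [del [del0 [ch' _]]] := ch.
have [Ch Ch0 Hh] := scaled_order_bound ph ch' del0 mq vh.
have [Cf Cf0 Hf] := scaled_increment_bound pf cf1 ltr01 mn.
exists (Num.min (Num.min 1 (del / 3)) (Num.min 1 (1 / 3))).
  by rewrite !lt_min !ltr01 !divr_gt0.
exists (Ch + `|c^-1| * Cf); first by rewrite addr_ge0// mulr_ge0.
move=> a a0; rewrite le_min => /andP[a1 a2] i.
have := CbFD (Hh a a0 a1 i) (CbFZ (- c^-1) (Hf a a0 a2 i)).
by rewrite normrN mulrDl -mulrA.
Qed.

Lemma osc_force_Cb : exists B, forall i, Cb i m B (osc_force f c).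
Proof.
have [B HB] := class_C_zero_section pf cf1 ltr01 (ltnW mn).
exists (`|c^-1| * B + `|-1|) => i.
exact: (CbD (CbZ c^-1 (HB i)) (Cb_cst i m (-1))).
Qed.

Lemma osc_force_tmean0 : (0 < d)%N -> c = fbar f 0 -> c != 0 -> tmean (osc_force f c) = 0.
Proof.
move=> d0 cE c0; have [B HB] := class_C_zero_section pf cf1 ltr01 (ltnW mn).
have cont := Cb_cont (HB (Ordinal d0)).
rewrite /osc_force tmeanB; [|exact: torus_contZ|exact: torus_cont_cst].
by rewrite tmeanZ // tmean_cst -/(fbar f 0) -cE mulVf // subrr.
Qed.

End forces.

Lemma bintail_force_lipschitz (R : realType) (d l j : nat) (i : 'I_d) (L tau B : R) (G : 'rV[R]_d -> R -> R) :
  (forall tau u v : R, tau <= 1 -> `|u| <= tau -> `|v| <= tau ->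
     `|bintail l u - bintail l v| <= L * tau * `|u - v|) ->
  tau < 2^-1 -> CbF i 2^-1 j.+1 B G -> L * tau + B <= l%:R / 2 ->
  forall th (u v : R), `|u| <= tau -> `|v| <= tau ->
    `|(bintail l u + G th u) - (bintail l v + G th v)| <= l%:R / 2 * `|u - v|.
Proof.
move=> HL t12 HG b th u v ut vt.
have t1 : tau <= 1 by apply: ltW; apply: lt_le_trans t12 _; rewrite invf_le1 ?ler1n.
have h1 := HL tau u v t1 ut vt.
have h2 := CbF_lipschitz th HG (le_lt_trans vt t12) (le_lt_trans ut t12).
have -> : bintail l u + G th u - (bintail l v + G th v) = (bintail l u - bintail l v) + (G th u - G th v) by ring.
apply: le_trans (ler_normD _ _) _; apply: le_trans (lerD h1 h2) _.
by rewrite -mulrDl; apply: ler_wpM2r.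
Qed.

Lemma Hm_norm0_le (R : realType) (d m : nat) : (0 < d)%N -> (Hm_norm m (fun _ : 'rV[R]_d => 0%R : R) <= 0%:E)%E.
Proof.
move=> d0; have := @Hm_norm_Cb_lim R d m 0 (fun=> 0) d0 (lexx 0) (torus_cont_cst d 0).
rewrite mulr0; apply=> e e0; exists (fun=> 0).
  by move=> th; rewrite subrr normr0 ltW.
by move=> i; have := Cb_cst i m (0 : R); rewrite normr0.
Qed.

Lemma common_lower_bound (R : realType) (x y : R) : 0 < x -> 0 < y ->
  exists2 z : R, 0 < z & z <= x /\ z <= y.
Proof.
move=> x0 y0; exists (Num.min x y); first by rewrite lt_min x0.
by rewrite !ge_min !lexx orbT.
Qed.

Theorem theorem12 (R : realType) (l d m : nat) :
  (2 <= l)%N -> (1 <= d)%N -> (d%:R / 2 < m%:R :> R) ->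
  exists (q : nat) (kappa : R), 0 < kappa /\
  forall (p : nat) (omega : 'rV[R]_d) (f h : 'rV[R]_d -> R -> R),
    (1 <= p)%N ->
    nonresonant omega ->
    class_C_torus (m + p) f ->
    class_C_torus (m + p) h ->
    vanishes_to_orderS l h ->
    class_C_bounded_near0 q h ->
    in_Hm m (fun theta => ftilde f theta 0) ->
    fbar f 0 != 0 ->
    (Hm_norm m (fun theta => ftilde f theta 0)
       <= (kappa * `|fbar f 0|)%:E)%E ->
  exists eps0 A : R, [/\ 0 < eps0, 0 < A &
  forall eps : R, eps \in eps_range l (fbar f 0) eps0 ->
  exists (a : R) (V : 'rV[R]_d -> R),
    [/\ a ^+ l + eps * fbar f 0 = 0,
        in_Hm m V,
        (Hm_norm m V <= (A * `|eps| `^ l%:R^-1)%:E)%E,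
        solves l omega f h eps (response omega a V) &
        forall W : 'rV[R]_d -> R,
          in_Hm m W ->
          (Hm_norm m W <= (A * `|eps| `^ l%:R^-1)%:E)%E ->
          solves l omega f h eps (response omega a W) ->
          W = V]].
Proof.
move=> l2 d1 dm_real.
have l0 : (0 < l)%N by exact: ltnW.
have dm : (d < 2 * m)%N.
  by rewrite -(ltr_nat R) natrM mulrC -ltr_pdivrMr.
have m0 : (0 < m)%N by case: m dm {dm_real} => //; rewrite muln0.
have [CS CS0 sob] := @sobolev_sup R d m dm.
have [Q Q0 HQ] := @bintail_Cb R d l m.
have [L L0 HL] := @bintail_lipschitz R l.
pose CH := @Hm_const R d m.
have CH1 : 1 <= CH by rewrite /CH /Hm_const ler1n muln_gt0 expn_gt0 addn1.
have CH0 : 0 < CH by exact: lt_le_trans CH1.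
pose K := @comp_const R m.
have K1 : 1 <= K := comp_const_ge1 m.
have q3 : 0 < 3^-1 :> R by rewrite invr_gt0 ltr0n.
have q4 : 0 < 4^-1 :> R by rewrite invr_gt0 ltr0n.
(* On functions bounded by tau0 the nonlinearity has Lipschitz constant at
   most 1/2, half of it from bintail and half from the reduced force. This
   determines the ball of uniqueness. *)
have [tau0 [tau00 tau0_half Ltau0]] : exists tau0 : R, [/\ 0 < tau0, tau0 < 2^-1 & L * tau0 <= 4^-1].
  have L1 : 0 < L + 1 by rewrite ltr_wpDl.
  have [x x0 [x1 x2]] := common_lower_bound q4 (divr_gt0 q4 L1).
  exists x; split => //; first by clear - x1; lra.
  rewrite ler_pdivlMr // mulrDr mulr1 mulrC in x2; apply: le_trans x2.
  by rewrite lerDl ltW.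
(* The iterates are bounded by tau in C^m. Then a U has H^m norm at most CH
   |a| tau, and CS CH tau <= tau0 puts it into the ball in which functions are
   at most |a| tau0 in the sup norm. A third of tau is allotted to each of
   bintail, the reduced force and the oscillation of f. *)
have [tau [tau_gt0 tau_tau0 tau_H tau_Q]] : exists tau : R,
    [/\ 0 < tau, tau <= tau0, CS * CH * tau <= tau0 & Q * tau ^+ 2 <= tau / 3].
  have Q1 : 0 < Q + 1 by rewrite ltr_wpDl.
  have [y y0 [y1 y2]] := common_lower_bound (divr_gt0 tau00 (mulr_gt0 CS0 CH0)) (divr_gt0 q3 Q1).
  have [x x0 [x1 x2]] := common_lower_bound tau00 y0.
  exists x; split => //.
    by rewrite mulrC -ler_pdivlMr ?mulr_gt0 // (le_trans x2).
  rewrite expr2 mulrA [leRHS]mulrC; apply: ler_wpM2r; first exact: ltW.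
  have := le_trans x2 y2; rewrite ler_pdivlMr // mulrDr mulr1 mulrC => h.
  by apply: le_trans h; rewrite lerDl ltW.
have tau_half : tau <= 2^-1 by apply: ltW; exact: le_lt_trans tau0_half.
have tau_1 : tau <= 1 by apply: le_trans tau_half _; rewrite invf_le1 ?ler1n.
exists (m + l.+1)%N, 1; split => // p omega f h p1 nr [pf cf] [ph _] vh ch _ c0 _.
set c := fbar f 0 in c0 *.
have mn : (m.+1 <= m + p)%N by rewrite -addn1 leq_add2l.
have [a1 a10 [CG CG0 HG]] := reduced_force_small c pf cf ph ch vh mn (leqnn _).
have [Bg Hg] := osc_force_Cb c pf cf mn.
have mg := osc_force_tmean0 pf cf mn d1 (erefl c) c0.
have eta0 : 0 < tau / 3 by rewrite divr_gt0.
have [lam0 lam00 Hlam] := abel_Cb_small_all nr Hg mg eta0.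
have lr : 0 < l%:R :> R by rewrite ltr0n.
have cn : 0 < `|c| by rewrite normr_gt0.
have KG : 0 < 3 * (K * CG) + 1.
  by rewrite ltr_wpDl // !mulr_ge0 // (le_trans ler01).
have CG4 : 0 < 4 * CG + 1 by rewrite ltr_wpDl // mulr_ge0.
(* A bound for |a|: it makes the reduced force small, and makes lam = l a^(l
   - 1) so small that the Abel mean of the oscillation is at most tau / 3 in
   C^m. *)
have [b [b0 b_1 b_a1 [b_tau b_CG b_lam]]] : exists b : R, [/\ 0 < b, b <= 1, b <= a1 &
    [/\ b <= tau / (3 * (K * CG) + 1), b <= 1 / (4 * CG + 1) & b <= lam0 / l%:R]].
  have [x x0 [x1 x2]] := common_lower_bound (divr_gt0 ltr01 CG4) (divr_gt0 lam00 lr).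
  have [y y0 [y1 y2]] := common_lower_bound (divr_gt0 tau_gt0 KG) x0.
  have [z z0 [z1 z2]] := common_lower_bound a10 y0.
  have [b b0 [b1 b2]] := common_lower_bound ltr01 z0.
  have by_ := le_trans b2 z2; have bx := le_trans by_ y2.
  exists b; split => //; first exact: le_trans b2 z1.
  by split; [exact: le_trans by_ y1|exact: le_trans bx x1|exact: le_trans bx x2].
exists (b ^+ l / `|c|), (tau0 * `|c| `^ l%:R^-1 / CS); split.
- by rewrite divr_gt0 // exprn_gt0.
- by rewrite divr_gt0 // mulr_gt0 // powR_gt0.
move=> eps er.
have small_eps := eps_range_small er.
(* At eps = 0, which belongs to the range if l is odd, the ball is reduced
   to V = 0. *)
have [e0|e0] := eqVneq eps 0.
  have li : l%:R^-1 != 0 :> R by rewrite invr_eq0 gt_eqF.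
  have l_neq0 : (l == 0)%N = false by apply/negbTE; rewrite -lt0n.
  rewrite e0 normr0 powR0 // mulr0.
  exists 0, (fun=> 0); split.
  - by rewrite expr0n l_neq0 mul0r addr0.
  - split; [by []|exact: cst_continuous|].
    exact: le_lt_trans (Hm_norm0_le R m d1) (ltry 0).
  - exact: Hm_norm0_le.
  - move=> t; rewrite /response addr0 expr0n l_neq0 add0r mul0r addr0.
    have -> : h (t *: omega) 0 = 0 by exact: (vh (t *: omega) 0%N).
    exact: is_derive_cst.
  - move=> W [pW cW _] HW _; apply/funext => th.
    have := sob W 0 (continuous_torus_cont pW cW) (lexx 0) HW th.
    by rewrite mulr0 normr_le0 => /eqP.
have [a [ac aE al0]] := balance_root l0 c0 e0 er.
have a_pos : 0 < `|a| by rewrite aE mulr_gt0 // powR_gt0 // normr_gt0.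
have a_neq0 : a != 0 by rewrite -normr_gt0.
have a_b : `|a| < b.
  have al : `|a| ^+ l < b ^+ l.
    have -> : `|a| ^+ l = `|eps| * `|c|.
      by rewrite -normrX -normrM; move/eqP: ac; rewrite addr_eq0 => /eqP ->; rewrite normrN.
    by rewrite -ltr_pdivlMr.
  rewrite ltNge; apply/negP => ba; move: al; rewrite ltNge => /negP; apply.
  by apply: lerXn2r => //; rewrite nnegrE ltW.
have a_1 : `|a| <= 1 by exact: le_trans (ltW a_b) b_1.
pose lam := l%:R * a ^+ l.-1.
have lam_gt0 : 0 < lam by exact: mulr_gt0.
have lam_lt : lam < lam0.
  have : `|a| < lam0 / l%:R by exact: lt_le_trans b_lam.
  rewrite ltr_pdivlMr // mulrC; apply: le_lt_trans.
  apply: ler_wpM2l; first exact: ltW.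
  rewrite -[X in X <= _](ger0_norm (ltW al0)) normrX -[X in _ <= X]expr1.
  by apply: ler_wiXn2l => //; rewrite -ltnS prednK.
pose G := reduced_force l f h a c; pose g := osc_force f c.
have HGa i : CbF i 2^-1 m (CG * `|a|) G.
  by apply: HG => //; exact: le_trans (ltW a_b) b_a1.
have K_a : K * (CG * `|a|) <= tau / 3.
  have h1 : `|a| <= tau / (3 * (K * CG) + 1) by exact: le_trans (ltW a_b) b_tau.
  rewrite ler_pdivlMr // mulrDr mulr1 in h1.
  rewrite ler_pdivlMr //; apply: le_trans h1.
  rewrite -[leLHS]addr0; apply: lerD => //.
  by rewrite le_eqVlt; apply/orP; left; apply/eqP; ring.
have CG_a : CG * `|a| <= 4^-1.
  have h1 : `|a| <= 1 / (4 * CG + 1) by exact: le_trans (ltW a_b) b_CG.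
  rewrite ler_pdivlMr // mulrDr mulr1 in h1.
  clear - h1 a_pos; rewrite mulrC; move: h1; rewrite mulrCA; move: (`|a| * CG) => X; lra.
have l2r : 2 <= l%:R :> R by rewrite ler_nat.
have lip0 th (u v : R) : `|u| <= tau0 -> `|v| <= tau0 ->
    `|(bintail l u + G th u) - (bintail l v + G th v)| <= l%:R / 2 * `|u - v|.
  (* A Lipschitz bound takes one order of [CbF], available since m > 0. *)
  have HGm : CbF (Ordinal d1) 2^-1 m.-1.+1 (CG * `|a|) G by rewrite prednK.
  apply: (bintail_force_lipschitz HL tau0_half HGm).
  by apply: le_trans (lerD Ltau0 CG_a) _; clear - l2r; lra.
have lipt th (u v : R) : `|u| <= tau -> `|v| <= tau ->
    `|(bintail l u + G th u) - (bintail l v + G th v)| <= l%:R / 2 * `|u - v|.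
  by move=> ut vt; apply: lip0; exact: le_trans tau_tau0.
have cg : torus_cont g := Cb_cont (Hg (Ordinal d1)).
have budget : Q * tau ^+ 2 + K * (CG * `|a|) + tau / 3 <= l%:R * tau.
  apply: le_trans (lerD (lerD tau_Q K_a) (lexx _)) _.
  apply: (@le_trans _ _ (2 * tau)); first by clear - tau_gt0; lra.
  by apply: ler_wpM2r l2r; exact: ltW.
have [U [cU bU appU solU]] := fixed_point_exists l0 d1 lam_gt0 (ltW tau_gt0) tau_half cg
  (Hlam lam lam_gt0 lam_lt) HGa (fun i U => HQ i tau U tau_1) budget lipt.
have solU0 t : is_derive t (1:R) (fun t : R => U (t *: omega)) (rescaled_field l lam G g U (t *: omega)).
  have := solU 0 t; rewrite add0r.
  by under [fun t : R => U (0 + t *: omega)]eq_fun do rewrite add0r.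
have radius : tau0 * `|c| `^ l%:R^-1 / CS * `|eps| `^ l%:R^-1 = `|a| * tau0 / CS.
  by rewrite aE; ring.
rewrite radius.
have normV : (Hm_norm m (fun th => (a * U th)%R) <= (`|a| * tau0 / CS)%:E)%E.
  apply: le_trans (_ : (CH * (`|a| * tau))%:E <= _)%E; last first.
    rewrite lee_fin ler_pdivlMr // mulrCA -[leLHS]mulrA; apply: ler_wpM2l => //.
    by rewrite mulrC mulrA.
  apply: Hm_norm_Cb_lim => //; first by rewrite mulr_ge0 // ltW.
    exact: torus_contZ.
  move=> e e_gt0; have [u uU Hu] := appU (e / `|a|) (divr_gt0 e_gt0 a_pos).
  exists (fun th => a * u th); last by move=> i; exact: CbZ.
  by move=> th; rewrite -mulrBr normrM mulrC -ler_pdivlMr.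
exists a, (fun th => a * U th); split => //.
- have [pV cV] := torus_contZ a cU; split => //.
    exact: (torus_cont_continuous (torus_contZ a cU)).
  exact: le_lt_trans normV (ltry _).
- exact/(solves_rescaled _ _ _ _ l0 a_neq0 c0 ac).
move=> W [pW cW _] HW solW.
have tW := continuous_torus_cont pW cW.
have bW th : `|W th| <= `|a| * tau0.
  have := sob W _ tW _ HW th; rewrite [CS * _]mulrC divfK ?gt_eqF//; apply.
  by rewrite divr_ge0 ?mulr_ge0 // ltW.
have WE : W = (fun th => a * (a^-1 * W th)).
  by apply/funext => th; rewrite mulVKf.
rewrite WE in solW.
have solW' := (solves_rescaled omega f h (fun th => a^-1 * W th) l0 a_neq0 c0 ac).1 solW.
have EU : (fun th => a^-1 * W th) = U.
  apply: (rescaled_unique l0 lam_gt0 nr cU (torus_contZ a^-1 tW) _ _ lip0 solU0 solW').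
    by move=> th; exact: le_trans (bU th) tau_tau0.
  by move=> th; rewrite normrM normfV mulrC ler_pdivrMr // mulrC.
by rewrite WE; apply/funext => th; rewrite -EU.
Qed.
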